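(* Let $(M,g)$ be a Riemannian manifold of dimension $m$, let $r>0$ be a fixed constant, and for positive constants $f_1,f_2$ let $TM$ carry the metric $G=g^{f_1,f_2}=f_1\pi^*g\oplus f_2\pi^*g$ on $H\oplus V=TTM$ and let $S_rM=\{u\in TM:\ \|u\|=r\}$ carry the induced metric. 1. If $m=2$, then for all positive constants $f_1,f_2$, $TM$ and $S_rM$ have the same Ricci and scalar curvatures; that is, the Ricci tensor and the scalar curvature of $S_rM$ coincide with the restrictions to $S_rM$ of the Ricci tensor and the scalar curvature of $(TM,G)$. 2. Let $m\geq 3$ and suppose that $M$ has bounded sectional curvatures (for instance, $M$ compact). Then: (a) for every constant $f_2>0$, for all sufficiently large constants $f_1>0$ (that is, there is $c>0$, depending on $f_2$, such that for all $f_1\ge c$) the tangent sphere bundle $(S_rM,g^{f_1,f_2})$ has positive scalar curvature; (b) for every constant $f_1>0$, for all sufficiently small constants $f_2>0$ (that is, there is $c>0$, depending on $f_1$, such that for all $0<f_2\le c$) the tangent sphere bundle $(S_rM,g^{f_1,f_2})$ has positive scalar curvature.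
   Context: Let $\pi:TM\to M$ be the tangent bundle and $\nabla$ the Levi-Civita connection of $(M,g)$. It induces the splitting $TTM=H\oplus V$, where $V=\ker d\pi$ is the vertical bundle and $H$ is the horizontal bundle of $\nabla$; both $H$ and $V$ are identified with $\pi^*TM$ ($H$ via $d\pi$, $V$ via the canonical identification $V_u=T_{\pi(u)}M$). The metric $g^{f_1,f_2}$ makes $H$ and $V$ orthogonal and equals $f_1\pi^*g$ on $H$ and $f_2\pi^*g$ on $V$. The norm $\|u\|$ of $u\in TM$ is taken with respect to $g$. *)

(* Defs.v *)
From HB Require Import structures.
From mathcomp Require Import all_boot all_order all_algebra.
From mathcomp Require Import all_classical all_reals all_analysis.
From mathcomp Require Import ring.

Set Implicit Arguments.
Unset Strict Implicit.
Unset Printing Implicit Defensive.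

Import Order.TTheory GRing.Theory Num.Theory.
Import numFieldNormedType.Exports.

Local Open Scope classical_set_scope.
Local Open Scope ring_scope.

(** Conventions. Coordinate and tangent vectors are row vectors, so that the
    differential of [F] at [x] is [v |-> v *m jacobian F x], and a bilinear form
    is the matrix [A] of [(v, w) |-> v *m A *m w^T]. *)

(** * Calculus on open subsets of R^n *)

Definition pd {R : realType} {n : nat} {W : normedModType R}
    (i : 'I_n) (f : 'rV[R]_n -> W) (x : 'rV[R]_n) : W :=
  'D_(delta_mx 0 i) f x.

Fixpoint Ck {R : realType} {n : nat} {W : normedModType R} (k : nat)
    (A : set 'rV[R]_n) (f : 'rV[R]_n -> W) : Prop :=
  match k with
  | 0 => forall x, A x -> {for x, continuous f}
  | k'.+1 => (forall x, A x -> differentiable f x) /\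
             (forall i : 'I_n, Ck k' A (pd i f))
  end.

Definition smooth_on {R : realType} {n : nat} {W : normedModType R}
    (A : set 'rV[R]_n) (f : 'rV[R]_n -> W) : Prop :=
  forall k, Ck k A f.

Definition form {R : realType} {n : nat} (A : 'M[R]_n) (v w : 'rV[R]_n) : R :=
  (v *m A *m w^T) 0 0.

Definition pullback {R : realType} {k n : nat} (F : 'rV[R]_k -> 'rV[R]_n)
    (h : 'rV[R]_n -> 'M[R]_n) (y : 'rV[R]_k) : 'M[R]_k :=
  jacobian F y *m h (F y) *m (jacobian F y)^T.

(** * Curvature of a metric given in coordinates *)

(** [christoffel h x k i j] is Gamma^k_ij: nabla_i d_j = Gamma^k_ij d_k. *)
Definition christoffel {R : realType} {n : nat} (h : 'rV[R]_n -> 'M[R]_n)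
    (x : 'rV[R]_n) (k i j : 'I_n) : R :=
  2^-1 * \sum_l invmx (h x) k l *
    (pd i (fun y => h y j l) x + pd j (fun y => h y i l) x
     - pd l (fun y => h y i j) x).

(** The [christoffel] coefficients are those of the Levi-Civita connection:
    it is torsion-free and compatible with the metric. *)
Lemma christoffel_torsion_free {R : realType} {n : nat}
    (h : 'rV[R]_n -> 'M[R]_n) (x : 'rV[R]_n) (k i j : 'I_n) :
  (forall y, (h y)^T = h y) -> christoffel h x k i j = christoffel h x k j i.
Proof.
move=> hs; rewrite /christoffel; congr (_ * _); apply: eq_bigr => l _.
congr (_ * _); rewrite [X in X - _]addrC; congr (_ - pd l _ x).
by apply/funext => y; rewrite -[in LHS](hs y) mxE.
Qed.

Lemma christoffel_metric {R : realType} {n : nat}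
    (h : 'rV[R]_n -> 'M[R]_n) (x : 'rV[R]_n) (k i j : 'I_n) :
  (forall y, (h y)^T = h y) -> h x \in unitmx ->
  pd k (fun y => h y i j) x =
    \sum_l christoffel h x l k i * h x l j
    + \sum_l christoffel h x l k j * h x i l.
Proof.
move=> hs hu.
have hsE y a b : h y a b = h y b a by rewrite -[in LHS](hs y) mxE.
have low a b c : \sum_l christoffel h x l a b * h x l c =
    2^-1 * (pd a (fun y => h y b c) x + pd b (fun y => h y a c) x
            - pd c (fun y => h y a b) x).
  under eq_bigr do rewrite /christoffel -mulrA mulr_suml.
  rewrite -mulr_sumr; congr (_ * _); rewrite exchange_big /=.
  set E := fun l => pd a (fun y => h y b l) x + pd b (fun y => h y a l) x
                    - pd l (fun y => h y a b) x.
  transitivity (\sum_l (h x *m invmx (h x)) c l * E l).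
    apply: eq_bigr => l _; rewrite mxE mulr_suml; apply: eq_bigr => k' _.
    by rewrite (hsE x c) /E; ring.
  rewrite mulmxV // (bigD1 c) //= big1 => [|l lc].
    by rewrite mxE eqxx mul1r addr0.
  by rewrite mxE eq_sym (negbTE lc) mul0r.
under [X in _ = _ + X]eq_bigr do rewrite (hsE x).
rewrite !low -mulrDr.
have -> : (fun y => h y j i) = (fun y => h y i j) by apply/funext => y.
have -> : (fun y => h y k j) = (fun y => h y j k) by apply/funext => y.
have -> : (fun y => h y k i) = (fun y => h y i k) by apply/funext => y.
set a := pd k _ x; set b := pd i _ x; set c := pd j _ x.
have -> : a + b - c + (a + c - b) = 2 * a by ring.
by rewrite mulrA mulVf ?mul1r // pnatr_eq0.
Qed.

(** [riemann h x l i j k] is the [l]-th component of [R(d_i, d_j) d_k], where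
    R(X,Y) = [nabla_X, nabla_Y] - nabla_[X,Y]. *)
Definition riemann {R : realType} {n : nat} (h : 'rV[R]_n -> 'M[R]_n)
    (x : 'rV[R]_n) (l i j k : 'I_n) : R :=
  pd i (fun y => christoffel h y l j k) x
  - pd j (fun y => christoffel h y l i k) x
  + \sum_p (christoffel h x l i p * christoffel h x p j k
            - christoffel h x l j p * christoffel h x p i k).

(** Ric(Y,Z) is the trace of X |-> R(X,Y)Z. *)
Definition ricci {R : realType} {n : nat} (h : 'rV[R]_n -> 'M[R]_n)
    (x : 'rV[R]_n) : 'M[R]_n :=
  \matrix_(j, k) \sum_i riemann h x i i j k.

Definition scalar_curvature {R : realType} {n : nat} (h : 'rV[R]_n -> 'M[R]_n)
    (x : 'rV[R]_n) : R :=
  \tr (invmx (h x) *m ricci h x).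

(** <R(v,w)w, v> / (|v|^2 |w|^2 - <v,w>^2), meaningful for independent [v, w]. *)
Definition sectional_curvature {R : realType} {n : nat}
    (h : 'rV[R]_n -> 'M[R]_n) (x v w : 'rV[R]_n) : R :=
  form (h x)
    (\row_l \sum_i \sum_j \sum_k riemann h x l i j k * v 0 i * w 0 j * w 0 k) v
  / (form (h x) v v * form (h x) w w - form (h x) v w ^+ 2).

(** * Riemannian manifolds *)

(** A smooth atlas, together with the matrices of the metric in the charts. The
    chart [i] is the homeomorphism [coord i] from the open set [dom i] onto an
    open subset of R^m, with inverse [param i]; all functions are total, but
    only their values on these sets matter. *)
Record riemannian_manifold (R : realType) (m : nat) := RiemannianManifold {
  carrier :> topologicalType ;
  carrier_hausdorff : hausdorff_space carrier ;
  carrier_second_countable : @second_countable carrier ;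
  chart : Type ;
  dom : chart -> set carrier ;
  coord : chart -> carrier -> 'rV[R]_m ;
  param : chart -> 'rV[R]_m -> carrier ;
  dom_cover : forall p, exists i, dom i p ;
  dom_open : forall i, open (dom i) ;
  coord_open : forall i, open (coord i @` dom i) ;
  coordK : forall i p, dom i p -> param i (coord i p) = p ;
  coord_continuous : forall i p, dom i p -> {for p, continuous (coord i)} ;
  param_continuous :
    forall i x, (coord i @` dom i) x -> {for x, continuous (param i)} ;
  transition_smooth : forall i j,
    smooth_on (coord i @` (dom i `&` dom j)) (coord j \o param i) ;
  metric : chart -> 'rV[R]_m -> 'M[R]_m ;
  metric_smooth : forall i, smooth_on (coord i @` dom i) (metric i) ;
  metric_sym : forall i x, (coord i @` dom i) x -> (metric i x)^T = metric i x ;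
  metric_pos : forall i x, (coord i @` dom i) x ->
    forall v, v != 0 -> 0 < form (metric i x) v v ;
  metric_compat : forall i j x, (coord i @` (dom i `&` dom j)) x ->
    metric i x = pullback (coord j \o param i) (metric j) x
}.

Definition bounded_sectional_curvature {R : realType} {m : nat}
    (M : riemannian_manifold R m) : Prop :=
  exists C : R, forall (i : chart M) (p : M) (v w : 'rV[R]_m),
    dom i p -> row_free (col_mx v w) ->
    `|sectional_curvature (metric i) (coord i p) v w| <= C.

(** * The tangent bundle *)

(** A tangent vector at [tpt] is the family of its component vectors in the
    charts around [tpt]; in the other charts the components are set to [0], so
    that equal tangent vectors are equal as records. *)
Record tangent_bundle {R : realType} {m : nat} (M : riemannian_manifold R m) :=
  TangentVector {
  tpt : M ;
  tcomp : chart M -> 'rV[R]_m ;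
  tcomp_compat : forall i j, dom i tpt -> dom j tpt ->
    tcomp j = tcomp i *m jacobian (coord j \o param i) (coord i tpt) ;
  tcomp_out : forall i, ~ dom i tpt -> tcomp i = 0
}.

(** The chart of TM induced by the chart [i] of M: u |-> (x, v). *)
Definition tdom {R : realType} {m : nat} {M : riemannian_manifold R m}
    (i : chart M) : set (tangent_bundle M) :=
  [set u | dom i (tpt u)].

Definition tcoord {R : realType} {m : nat} {M : riemannian_manifold R m}
    (i : chart M) (u : tangent_bundle M) : 'rV[R]_(m + m) :=
  row_mx (coord i (tpt u)) (tcomp u i).

(** In the chart [i], d pi : T_u TM -> T_(pi u) M is (X, xi) |-> X; its kernel is
    the vertical bundle V. *)
Definition dpi_mx {R : realType} {m : nat} : 'M[R]_(m + m, m) :=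
  col_mx 1%:M 0.

(** The vertical projection T_u TM -> V_u = T_(pi u) M along the horizontal
    bundle H: at z = (x, v) it sends (X, xi) to the vector with components
    xi^k + Gamma^k_ij X^i v^j, and its kernel is H. *)
Definition vert_mx {R : realType} {m : nat} (g : 'rV[R]_m -> 'M[R]_m)
    (z : 'rV[R]_(m + m)) : 'M[R]_(m + m, m) :=
  col_mx
    (\matrix_(i, k) \sum_j christoffel g (lsubmx z) k i j * rsubmx z 0 j)
    1%:M.

(** The metric f1 pi^*g (+) f2 pi^*g on TTM = H (+) V, in the induced chart [i]. *)
Definition TM_metric {R : realType} {m : nat} {M : riemannian_manifold R m}
    (f1 f2 : R) (i : chart M) (z : 'rV[R]_(m + m)) : 'M[R]_(m + m) :=
  let g := metric i in
  f1 *: (dpi_mx *m g (lsubmx z) *m dpi_mx^T)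
  + f2 *: (vert_mx g z *m g (lsubmx z) *m (vert_mx g z)^T).

(** * The tangent sphere bundle *)

Definition tnorm {R : realType} {m : nat} {M : riemannian_manifold R m}
    (i : chart M) (u : tangent_bundle M) : R :=
  Num.sqrt (form (metric i (coord i (tpt u))) (tcomp u i) (tcomp u i)).

(** The value of [tnorm i u] is the same for all charts [i] around the base
    point of [u]. *)
Definition sphere_bundle {R : realType} {m : nat} (M : riemannian_manifold R m)
    (r : R) : set (tangent_bundle M) :=
  [set u | forall i, tdom i u -> tnorm i u = r].
Arguments sphere_bundle {R m} M r _.

(** Local parametrizations of the (2m-1)-dimensional submanifold S_rM lying over
    the chart [i]: injective immersions of an open set of R^(2m-1) into TM with
    values in S_rM. As the dimensions agree, these are exactly the inverses of
    the charts of the maximal atlas of S_rM (restricted to [tdom i]). *)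
Record sphere_param {R : realType} {m : nat} {M : riemannian_manifold R m}
    (r : R) (i : chart M) := SphereParam {
  sdom : set 'rV[R]_((m + m).-1) ;
  sfun :> 'rV[R]_((m + m).-1) -> tangent_bundle M ;
  sdom_open : open sdom ;
  sfun_tdom : forall y, sdom y -> tdom i (sfun y) ;
  sfun_sphere : forall y, sdom y -> sphere_bundle M r (sfun y) ;
  sfun_smooth : smooth_on sdom (tcoord i \o sfun) ;
  sfun_inj : forall y z, sdom y -> sdom z -> sfun y = sfun z -> y = z ;
  sfun_immersion :
    forall y, sdom y -> row_free (jacobian (tcoord i \o sfun) y)
}.

(** The matrix of the induced metric of S_rM in a local parametrization. *)
Definition sphere_metric {R : realType} {m : nat} {M : riemannian_manifold R m}
    {r : R} {i : chart M} (f1 f2 : R) (s : sphere_param r i) :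
    'rV[R]_((m + m).-1) -> 'M[R]_((m + m).-1) :=
  pullback (tcoord i \o s) (TM_metric f1 f2 i).

Definition same_ricci_curvature {R : realType} {m : nat}
    (M : riemannian_manifold R m) (r f1 f2 : R) : Prop :=
  forall (i : chart M) (s : sphere_param r i) y, sdom s y ->
    ricci (sphere_metric f1 f2 s) y =
    pullback (tcoord i \o s) (ricci (TM_metric f1 f2 i)) y.

Definition same_scalar_curvature {R : realType} {m : nat}
    (M : riemannian_manifold R m) (r f1 f2 : R) : Prop :=
  forall (i : chart M) (s : sphere_param r i) y, sdom s y ->
    scalar_curvature (sphere_metric f1 f2 s) y =
    scalar_curvature (TM_metric f1 f2 i) (tcoord i (s y)).

Definition sphere_positive_scalar_curvature {R : realType} {m : nat}
    (M : riemannian_manifold R m) (r f1 f2 : R) : Prop :=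
  forall (i : chart M) (s : sphere_param r i) y, sdom s y ->
    0 < scalar_curvature (sphere_metric f1 f2 s) y.

(* Main.v *)
Require Import Defs.
From mathcomp Require Import all_boot all_order all_algebra.
From mathcomp Require Import all_classical all_reals all_analysis.
From mathcomp Require Import ring lra.
(* Imported again: [form] is shadowed by a MathComp constant. *)
Require Import Defs.

Set Implicit Arguments.
Unset Strict Implicit.
Unset Printing Implicit Defensive.

Import Order.TTheory GRing.Theory Num.Theory.
Import numFieldNormedType.Exports.

Local Open Scope classical_set_scope.
Local Open Scope ring_scope.

(** The unit normal of S_rM in (TM, G) is proportional to the Euler field
    U(x, v) = (0, v). By Koszul's formula for horizontal and vertical lifts,
    the covariant derivative of U is the vertical projection, which is parallel
    along U; hence R(., U)U = 0, and the shape operator of S_rM vanishes on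
    horizontal vectors and is a multiple of the identity on vertical ones. In the
    Gauss equation the Ricci terms in the normal direction therefore drop out,
    and the quadratic terms contribute (m-1)(m-2)/(f2 r^2) to the scalar
    curvature; for m = 2 the second fundamental form has rank one and they
    vanish altogether.

    As in O'Neill's formulas, in a lifted orthonormal frame the curvature of G is
    K(X, Y)/f1 - 3 f2/(4 f1^2) |R(X, Y)v|^2 on horizontal planes, nonnegative on
    mixed ones and zero on vertical ones. If the sectional curvature is bounded,
    then so are, by polarization, all components of R, whence a lower bound
    (m-1)(m-2)/(f2 r^2) - A1/f1 - A2 f2/f1^2 for the scalar curvature of S_rM. *)

(** * Smooth functions on open subsets of R^n *)

(** The normal field is never normalised: all formulas use [euler] itself, whose squared length N =
    f2 r^2 on S_rM is constant and becomes the denominator of the extra term. No frame of S_rM is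
    built either, as its parametrizations are arbitrary. Traces over its tangent spaces are taken
    with J^T P^-1 J, where J is the jacobian and P the induced metric; this matrix equals G^-1 -
    N^-1 U^T U. A trace on S_rM is thus a trace on TM minus one normal term, and R(., U)U = 0 kills
    the latter. In the quadratic terms, G^-1 times the vertical part of G is a projector of rank m;
    removing the normal line leaves rank m-1, whence (m-1)^2 - (m-1).

    Both regimes of f1 and f2 rest on one inequality. Multiplied by f2 r^2, the negative terms are
    (A1/f1 + A2 f2/f1^2) f2 r^2, small in either regime, while the positive term is (m-1)(m-2) >= 2.
    That v has length r on S_rM is what bounds |R(X, Y)v|.

    Chart expressions are total functions that are meaningful on an open set only, so the calculus
    is relative to an open set and begins with locality. *)

Section Differentiability.
Context {R : realType}.

(** The little-o condition sees only a neighbourhood of [x], so a function that vanishes there has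
    differential 0. Two functions that agree near [x] differ by such a function, which makes
    differentiability local. *)
Lemma near0_differentiable (V W : normedModType R) (f : V -> W) (x : V) :
  (\near x, f x = 0) -> differentiable f x.
Proof.
move=> f0.
have fx0 : f x = 0 by exact: nbhs_singleton f0.
have e0 : f \o shift x = cst (f x) + (\0 : V -> W) +o_ 0 id.
  apply/eqaddoP => _/posnumP[e]; near=> h.
  have -> : (f \o shift x - (cst (f x) + (\0 : V -> W))) h = 0.
    rewrite !fctE /= fx0 addr0 subr0; near: h.
    have := f0; rewrite (near_shift 0) subr0; exact: filterS.
  by rewrite normr0 mulr_ge0.
have dc : continuous (\0 : V -> W) by exact: cst_continuous.
apply/diff_locallyP.
have -> : 'd f x = (\0 : V -> W) :> (V -> W) by exact: diff_unique.
by split.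
Unshelve. all: by end_near. Qed.

Lemma near_eq_differentiable (V W : normedModType R) (f g : V -> W) (x : V) :
  (\near x, f x = g x) -> differentiable f x -> differentiable g x.
Proof.
move=> fg df; have -> : g = f + (g - f).
  by apply/funext => y; rewrite !fctE addrC subrK.
apply: (differentiableD df); apply: near0_differentiable.
by apply: filterS fg => y; rewrite !fctE => ->; rewrite subrr.
Qed.

Lemma continuous_mx (T : topologicalType) p q (f : T -> 'M[R]_(p, q)) x :
  (forall a b, {for x, continuous (fun y => f y a b)}) -> {for x, continuous f}.
Proof.
move=> cf; apply/cvgrPdist_le => e e0; near=> y.
rewrite [leLHS]/Num.Def.normr/= mx_normrE (bigmax_le _ (ltW e0))//= => i _.
rewrite !mxE/=.
move: i; near: y; apply: filter_forall => /= i.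
by have /cvgrPdist_le := cf i.1 i.2; apply.
Unshelve. all: by end_near. Qed.

Lemma differentiable_mx (V : normedModType R) p q (f : V -> 'M[R]_(p, q)) x :
  (forall i j, differentiable (fun y => f y i j) x) -> differentiable f x.
Proof.
move=> df.
have -> : f = \sum_(i < p) \sum_(j < q) (fun y => f y i j *: delta_mx i j).
  apply/funext => y; rewrite [LHS]matrix_sum_delta fct_sumE.
  by apply: eq_bigr => i _; rewrite fct_sumE.
apply: differentiable_sum => i; apply: differentiable_sum => j.
by apply: differentiableZl.
Qed.

Lemma differentiable_entry (V : normedModType R) p q (f : V -> 'M[R]_(p, q))
    i j x :
  differentiable f x -> differentiable (fun y => f y i j) x.
Proof.
move=> df; apply: (@differentiable_comp _ _ _ _ f (fun N : 'M[R]_(p, q) => N i j)).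
  by [].
exact: differentiable_coord.
Qed.

Lemma derive_entry (V : normedModType R) p q (f : V -> 'M[R]_(p, q)) x v i j :
  differentiable f x -> ('D_v f x) i j = 'D_v (fun y => f y i j) x.
Proof.
by move=> df; rewrite derive_mx ?mxE //; apply: diff_derivable.
Qed.

Lemma derive_comp (U V W : normedModType R) (F : U -> V) (f : V -> W) x v :
  differentiable F x -> differentiable f (F x) ->
  'D_v (f \o F) x = 'D_('D_v F x) f (F x).
Proof.
move=> dF df; rewrite [LHS]deriveE; last exact: differentiable_comp.
by rewrite diff_comp // (deriveE _ dF) (deriveE _ df).
Qed.

Lemma derive_linear_comb (V W : normedModType R) (f : V -> W) x (I : finType)
    (a : I -> R) (v : I -> V) :
  differentiable f x -> 'D_(\sum_i a i *: v i) f x = \sum_i a i *: 'D_(v i) f x.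
Proof.
move=> df; rewrite deriveE // linear_sum; apply: eq_bigr => i _.
by rewrite linearZ deriveE.
Qed.

Lemma derive_pd n (W : normedModType R) (f : 'rV[R]_n -> W) x v :
  differentiable f x -> 'D_v f x = \sum_i v 0 i *: pd i f x.
Proof. by move=> df; rewrite {1}(row_sum_delta v) derive_linear_comb. Qed.

End Differentiability.

Section SmoothScalar.
Context {R : realType} {n : nat}.
Implicit Types A : set 'rV[R]_n.

Lemma open_near A x : open A -> A x -> \near x, A x.
Proof. by move=> oA Ax; apply: open_nbhs_nbhs; split. Qed.

Lemma near_eq_open (W : Type) A (f g : 'rV[R]_n -> W) : open A ->
  (forall x, A x -> f x = g x) -> forall x, A x -> \near x, f x = g x.
Proof.
by move=> oA fg x Ax; apply: filterS fg _; exact: open_near.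
Qed.

Lemma pd_ext (W : normedModType R) A (f g : 'rV[R]_n -> W) i :
  open A -> (forall x, A x -> f x = g x) ->
  forall x, A x -> pd i f x = pd i g x.
Proof.
move=> oA fg x Ax; apply: near_eq_derive.
exact: near_eq_open oA fg _ Ax.
Qed.

(** Values outside [A] are arbitrary, so each differentiation rule below holds on [A] only and is
    transported by this lemma. Openness of [A] passes the agreement on to partial derivatives, which
    is why [f] and [g] vary in the induction. *)
Lemma Ck_ext (W : normedModType R) k A (f g : 'rV[R]_n -> W) :
  open A -> (forall x, A x -> f x = g x) -> Ck k A f -> Ck k A g.
Proof.
move=> oA; elim: k f g => [|k IH] f g fg /=.
  move=> cf x Ax; rewrite /prop_for /continuous_at -(fg _ Ax).
  have := cf _ Ax; rewrite /prop_for /continuous_at; apply: cvg_trans.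
  exact: near_eq_cvg (near_eq_open oA fg Ax).
move=> [df pf]; split=> [x Ax|i].
  apply: near_eq_differentiable (df x Ax).
  exact: near_eq_open oA fg _ Ax.
by apply: IH (pf i); apply: pd_ext.
Qed.

Lemma CkW (W : normedModType R) k A (f : 'rV[R]_n -> W) :
  Ck k.+1 A f -> Ck k A f.
Proof.
elim: k f => [|k IH] f [df pf].
  by move=> x Ax; apply: differentiable_continuous; apply: df.
by split=> // i; apply: IH; apply: pf.
Qed.

Lemma Ck_cst (W : normedModType R) k A (c : W) : Ck k A (fun=> c).
Proof.
elim: k c => [|k IH] c /=; first by move=> x _; apply: cst_continuous.
split=> [x _|i]; first exact: differentiable_cst.
suff -> : pd i (fun=> c) = fun=> 0 by [].
by apply/funext => x; rewrite /pd derive_cst.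
Qed.

Lemma CkD (W : normedModType R) k A (f g : 'rV[R]_n -> W) : open A ->
  Ck k A f -> Ck k A g -> Ck k A (fun x => f x + g x).
Proof.
move=> oA; elim: k f g => [|k IH] f g /=.
  by move=> cf cg x Ax; apply: continuousD; [apply: cf|apply: cg].
move=> [df pf] [dg pg]; split=> [x Ax|i].
  by apply: differentiableD; [apply: df|apply: dg].
apply: Ck_ext (IH _ _ (pf i) (pg i)) => // x Ax; rewrite /pd -deriveD //.
  exact/diff_derivable/df.
exact/diff_derivable/dg.
Qed.

Lemma CkM k A (f g : 'rV[R]_n -> R) : open A ->
  Ck k A f -> Ck k A g -> Ck k A (fun x => f x * g x).
Proof.
move=> oA; elim: k f g => [|k IH] f g.
  by move=> cf cg x Ax; apply: continuousM; [apply: cf|apply: cg].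
move=> Cf Cg; have [df pf] := Cf; have [dg pg] := Cg; split=> [x Ax|i].
  by apply: differentiableM; [apply: df|apply: dg].
have CFG := CkD oA (IH _ _ (CkW Cf) (pg i)) (IH _ _ (CkW Cg) (pf i)).
apply: Ck_ext CFG => // x Ax; rewrite /pd.
rewrite (_ : (fun x => f x * g x) = f * g) // deriveM //.
  exact/diff_derivable/df.
exact/diff_derivable/dg.
Qed.

(** The derivative -(1/f)^2 f' involves only 1/f and f', so the induction hypothesis for the same
    [f] at the lower order suffices. *)
Lemma CkV k A (f : 'rV[R]_n -> R) : open A -> (forall x, A x -> f x != 0) ->
  Ck k A f -> Ck k A (fun x => (f x)^-1).
Proof.
move=> oA f0; elim: k => [|k IH].
  by move=> cf x Ax; apply: continuousV; [apply: f0|apply: cf].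
move=> Cf; have [df pf] := Cf; split=> [x Ax|i].
  by apply: differentiableV; [apply: df|apply: f0].
have Cfk := IH (CkW Cf).
have CFG := CkM oA (Ck_cst k A (-1 : R)) (CkM oA (CkM oA Cfk Cfk) (pf i)).
apply: Ck_ext CFG => // x Ax; rewrite /pd deriveV ?f0 //; last first.
  exact/diff_derivable/df.
by rewrite -exprVn expr2 mulN1r scaleNr.
Qed.

Lemma Ck_sum (W : normedModType R) k A I (s : seq I) (P : pred I)
    (f : I -> 'rV[R]_n -> W) :
  open A -> (forall i, P i -> Ck k A (f i)) ->
  Ck k A (fun x => \sum_(i <- s | P i) f i x).
Proof.
move=> oA Cf; elim: s => [|a s IH].
  by apply: Ck_ext (Ck_cst _ _ 0) => // x _; rewrite big_nil.
have [Pa|Pa] := boolP (P a).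
  apply: Ck_ext (CkD oA (Cf a Pa) IH) => // x _; rewrite big_cons Pa //.
by apply: Ck_ext IH => // x _; rewrite big_cons (negbTE Pa).
Qed.

Lemma Ck_prod k A I (s : seq I) (P : pred I)
    (f : I -> 'rV[R]_n -> R) :
  open A -> (forall i, P i -> Ck k A (f i)) ->
  Ck k A (fun x => \prod_(i <- s | P i) f i x).
Proof.
move=> oA Cf; elim: s => [|a s IH].
  by apply: Ck_ext (Ck_cst k A (1 : R)) => // x _; rewrite big_nil.
have [Pa|Pa] := boolP (P a).
  apply: Ck_ext (CkM oA (Cf a Pa) IH) => // x _; rewrite big_cons Pa //.
by apply: Ck_ext IH => // x _; rewrite big_cons (negbTE Pa).
Qed.

Lemma pd_entry p q A (f : 'rV[R]_n -> 'M[R]_(p, q)) i a b x :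
  differentiable f x -> pd i (fun y => f y a b) x = pd i f x a b.
Proof. by move=> df; rewrite /pd derive_entry. Qed.

Lemma Ck_entry p q k A (f : 'rV[R]_n -> 'M[R]_(p, q)) a b : open A ->
  Ck k A f -> Ck k A (fun x => f x a b).
Proof.
move=> oA; elim: k f => [|k IH] f.
  move=> cf x Ax; apply: (@continuous_comp _ _ _ f (fun N : 'M[R]_(p, q) => N a b)).
    exact: cf.
  exact: matrix_normedtype.coord_continuous.
move=> [df pf]; split=> [x Ax|i].
  by apply: differentiable_entry; apply: df.
apply: Ck_ext (IH _ (pf i)) => // x Ax; rewrite (pd_entry A) //; exact: df.
Qed.

Lemma Ck_mx p q k A (f : 'rV[R]_n -> 'M[R]_(p, q)) : open A ->
  (forall a b, Ck k A (fun x => f x a b)) -> Ck k A f.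
Proof.
move=> oA; elim: k f => [|k IH] f.
  by move=> cf x Ax; apply: continuous_mx => a b; apply: cf.
move=> Cf.
have df x : A x -> differentiable f x.
  by move=> Ax; apply: differentiable_mx => a b; case: (Cf a b) => + _; apply.
split=> // i; apply: IH => a b; case: (Cf a b) => _ /(_ i).
by apply: Ck_ext => // x Ax; rewrite (pd_entry A) //; exact: df.
Qed.

Lemma Ck_coord k A i : open A -> Ck k A (fun x : 'rV[R]_n => x 0 i).
Proof.
move=> oA; case: k => [|k]; first by move=> x _; exact: matrix_normedtype.coord_continuous.
split=> [x _|j]; first exact: differentiable_coord.
apply: Ck_ext (Ck_cst k A (((delta_mx 0 j) : 'rV[R]_n) 0 i)) => // x Ax.
by rewrite /pd -(@derive_entry _ _ _ _ id) // derive_id.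
Qed.

End SmoothScalar.

(** By the chain rule, partial derivatives of the composite are sums of partial derivatives of [F]
    times composites of [F] with partial derivatives of [f]. The induction therefore varies [f] and
    keeps [F] fixed. *)
Lemma Ck_comp {R : realType} {k n : nat} (l : nat) (A : set 'rV[R]_k)
    (B : set 'rV[R]_n) (F : 'rV[R]_k -> 'rV[R]_n) (f : 'rV[R]_n -> R) :
  open A -> open B -> (forall x, A x -> B (F x)) ->
  Ck l A F -> Ck l B f -> Ck l A (f \o F).
Proof.
move=> oA oB AB; elim: l f => [|l IH] f.
  by move=> cF cf x Ax; apply: continuous_comp; [apply: cF|apply/cf/AB].
move=> CF Cf; have [dF pF] := CF; have [df pf] := Cf; split=> [x Ax|i].
  by apply: differentiable_comp; [apply: dF|apply/df/AB].
have CS : Ck l A (fun x => \sum_j pd i F x 0 j * (pd j f \o F) x).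
  apply: Ck_sum => // j _; apply: CkM => //.
    exact: Ck_entry (pF i).
  by apply: IH; [apply: CkW|apply: pf].
apply: Ck_ext CS => // x Ax.
have dfx : differentiable f (F x) by apply/df/AB.
rewrite /pd [RHS]derive_comp //; last exact: dF.
by rewrite [RHS]derive_pd //; apply: eq_bigr.
Qed.

(** * Symmetry of second derivatives *)

Section Schwarz.
Context {R : realType} {V : normedModType R}.

Lemma MVT_line (F : V -> R) (x u : V) (h : R) : 0 < h ->
  (forall s, 0 <= s <= h -> differentiable F (x + s *: u)) ->
  exists2 c, 0 < c < h & F (x + h *: u) - F x = 'D_u F (x + c *: u) * h.
Proof.
move=> h0 dF; pose G (s : R) := x + s *: u.
have dG s : differentiable G s by apply: differentiableD.
have DG s : 'D_1 G s = u.
  rewrite (deriveE _ (dG s)).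
  have -> : G = cst x + ( *:%R^~ u : R -> V) by [].
  rewrite (diffD (differentiable_cst _ _) (@ex_diff _ _ _ _ _ _ _ (is_diff_scalel _ u))).
  rewrite diff_cst (@diff_val _ _ _ _ _ _ _ (is_diff_scalel _ u)) /=.
  by rewrite [X in X + _]/= add0r scale1r.
have [||c cab E] := @MVT R (F \o G) (fun s => 'D_u F (G s)) 0 h h0.
- move=> s; rewrite in_itv /= => /andP[s0 sh].
  have dFs : differentiable F (G s) by apply: dF; rewrite !ltW.
  apply: DeriveDef; last by rewrite derive_comp // DG.
  by apply/diff_derivable/differentiable_comp.
- apply: continuous_in_subspaceT => s; rewrite inE /= in_itv /= => s0h.
  by apply/differentiable_continuous/differentiable_comp => //; apply: dF.
exists c; first by move: cab; rewrite in_itv.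
by move: E; rewrite /G /= scale0r addr0 subr0.
Qed.

Lemma derive_translate (W : normedModType R) (f : V -> W) w u x :
  'D_u (fun y => f (y + w)) x = 'D_u f (x + w).
Proof. by rewrite /derive /=; under eq_fun do rewrite -addrA. Qed.

(** The second difference is the increment along [u] of y |-> f (y + h v) - f y. The mean value
    theorem along [u], then along [v], turns it into a mixed derivative at an inner point. *)
Lemma second_difference (f : V -> R) (x u v : V) (h : R) : 0 < h ->
  (forall s t, 0 <= s <= h -> 0 <= t <= h ->
     differentiable f (x + s *: u + t *: v) /\
     differentiable ('D_u f) (x + s *: u + t *: v)) ->
  exists s t, [/\ 0 < s < h, 0 < t < h &
    f (x + h *: u + h *: v) - f (x + h *: u) - f (x + h *: v) + f x =
    'D_v ('D_u f) (x + s *: u + t *: v) * h ^+ 2].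
Proof.
move=> h0 df; have h0h : 0 <= h <= h by rewrite lexx ltW.
have z0h : 0 <= (0 : R) <= h by rewrite lexx ltW.
have dfw s w : 0 <= s <= h -> 0 <= w <= h ->
    differentiable (fun y => f (y + w *: v)) (x + s *: u).
  move=> s0h w0h; apply: (@differentiable_comp _ _ _ _ (fun y => y + w *: v) f).
    by [].
  by have [] := df s w s0h w0h.
have df0 s : 0 <= s <= h -> differentiable f (x + s *: u).
  by move=> s0h; have [] := df s 0 s0h z0h; rewrite scale0r addr0.
have [s s0h E1] := @MVT_line (fun y => f (y + h *: v) - f y) x u h h0 (fun s s0h =>
  differentiableB (dfw s h s0h h0h) (df0 s s0h)).
have sh : 0 <= s <= h by move/andP: s0h => [? ?]; rewrite !ltW.
have [t t0h E2] := @MVT_line ('D_u f) (x + s *: u) v h h0 (fun t t0h =>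
  (df s t sh t0h).2).
exists s, t; split=> //; move: E1.
rewrite (_ : (fun y => _) = (fun y => f (y + h *: v)) - f) //.
rewrite deriveB; last 2 first.
- by apply: diff_derivable; apply: dfw.
- by apply: diff_derivable; apply: df0.
rewrite derive_translate E2 expr2 mulrA => <-; ring.
Qed.

(** The second difference over a small parallelogram is symmetric in [u] and [v], so the two mixed
    derivatives share a value, taken at two possibly different points near [x]. Continuity at [x]
    then compares both with their values at [x]. *)
Lemma schwarz (f : V -> R) (x u v : V) :
  (\near x, differentiable f x) ->
  (\near x, differentiable ('D_u f) x) -> (\near x, differentiable ('D_v f) x) ->
  {for x, continuous ('D_u ('D_v f))} -> {for x, continuous ('D_v ('D_u f))} ->
  'D_u ('D_v f) x = 'D_v ('D_u f) x.
Proof.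
move=> df dfu dfv cuv cvu; apply/eqP; rewrite -subr_eq0 -normr_le0.
apply/ler_addgt0Pr => e e0; rewrite add0r.
have e20 : 0 < e / 2 by rewrite divr_gt0.
pose P y := [/\ differentiable f y, differentiable ('D_u f) y,
   differentiable ('D_v f) y, `|'D_u ('D_v f) x - 'D_u ('D_v f) y| <= e / 2
   & `|'D_v ('D_u f) x - 'D_v ('D_u f) y| <= e / 2].
have /nbhs_ballP[d /= d0 dP] : \near x, P x.
  move/cvgrPdist_le : cuv => /(_ _ e20) cuv.
  move/cvgrPdist_le : cvu => /(_ _ e20) cvu.
  apply: filterS (filterI df (filterI dfu (filterI dfv (filterI cuv cvu)))).
  by move=> y [h1 [h2 [h3 [h4 h5]]]]; exact: And5 h1 h2 h3 h4 h5.
(* Keeps the parallelogram with sides h u and h v inside the ball of radius [d]; the summand 1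
   avoids a division by 0 when u = v = 0. *)
pose h := d / (`|u| + `|v| + 1).
have n0 : 0 < `|u| + `|v| + 1 by rewrite ltr_wpDl // addr_ge0.
have h0 : 0 < h by rewrite divr_gt0.
have inB s t : 0 <= s <= h -> 0 <= t <= h -> P (x + s *: u + t *: v).
  move=> /andP[s0 sh] /andP[t0 th]; apply: dP; rewrite -ball_normE /=.
  rewrite -addrA opprD addNKr normrN (le_lt_trans (ler_normD _ _)) //.
  rewrite !normrZ !ger0_norm //.
  rewrite (@le_lt_trans _ _ (h * `|u| + h * `|v|)) //.
    by rewrite lerD // ler_wpM2r.
  by rewrite -mulrDr -[ltRHS](divfK (lt0r_neq0 n0)) ltr_pM2l // ltrDl.
have [|s [t [/andP[s0 sh] /andP[t0 th] E1]]] := @second_difference f x u v h h0.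
  move=> a b ah bh; have [Pf Pu _ _ _] := inB _ _ ah bh; exact: conj Pf Pu.
have [|t' [s' [/andP[t0' th'] /andP[s0' sh'] E2]]] := @second_difference f x v u h h0.
  move=> a b ah bh; have [Pf _ Pv _ _] := inB _ _ bh ah.
  rewrite [x + _ + _]addrAC; exact: conj Pf Pv.
have wh (w : R) : 0 < w -> w < h -> 0 <= w <= h by move=> ? ?; rewrite !ltW.
have [_ _ _ B1 _] := inB s' t' (wh _ s0' sh') (wh _ t0' th').
have [_ _ _ _ B2] := inB s t (wh _ s0 sh) (wh _ t0 th).
move: E1 E2 B1 B2; rewrite [x + t' *: v + _]addrAC [x + h *: v + _]addrAC.
move: ('D_v ('D_u f) (x + s *: u + t *: v)) ('D_v ('D_u f) x) => b b0.
move: ('D_u ('D_v f) (x + s' *: u + t' *: v)) ('D_u ('D_v f) x) => a a0 E1 E2.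
have -> : b = a.
  apply: (mulIf (expf_neq0 2 (lt0r_neq0 h0))); rewrite -[LHS]E1 -[RHS]E2.
  congr (_ + _); exact: addrAC.
clear -e => B1 B2.
rewrite [e]splitr (le_trans _ (lerD B1 B2)) // (distrC b0).
by apply: le_trans (ler_normD _ _); rewrite addrA subrK.
Qed.
End Schwarz.

Section SmoothOn.
Context {R : realType} {n : nat} (A : set 'rV[R]_n) (oA : open A).

Lemma smooth_ext (W : normedModType R) (f g : 'rV[R]_n -> W) :
  (forall x, A x -> f x = g x) -> smooth_on A f -> smooth_on A g.
Proof. by move=> fg sf k; apply: Ck_ext (sf k). Qed.

Lemma smooth_diff (W : normedModType R) (f : 'rV[R]_n -> W) x :
  smooth_on A f -> A x -> differentiable f x.
Proof. by move=> sf Ax; case: (sf 1%N) => + _; apply. Qed.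

Lemma smooth_cst (W : normedModType R) (c : W) : smooth_on A (fun=> c).
Proof. by move=> k; apply: Ck_cst. Qed.

Lemma smoothD (W : normedModType R) (f g : 'rV[R]_n -> W) :
  smooth_on A f -> smooth_on A g -> smooth_on A (fun x => f x + g x).
Proof. by move=> sf sg k; apply: CkD. Qed.

Lemma smoothM (f g : 'rV[R]_n -> R) :
  smooth_on A f -> smooth_on A g -> smooth_on A (fun x => f x * g x).
Proof. by move=> sf sg k; apply: CkM. Qed.

Lemma smoothV (f : 'rV[R]_n -> R) : (forall x, A x -> f x != 0) ->
  smooth_on A f -> smooth_on A (fun x => (f x)^-1).
Proof. by move=> f0 sf k; apply: CkV. Qed.

Lemma smooth_sum (W : normedModType R) I (s : seq I) (P : pred I)
    (f : I -> 'rV[R]_n -> W) :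
  (forall i, P i -> smooth_on A (f i)) ->
  smooth_on A (fun x => \sum_(i <- s | P i) f i x).
Proof. by move=> sf k; apply: Ck_sum => // i Pi; apply: sf. Qed.

Lemma smooth_prod I (s : seq I) (P : pred I) (f : I -> 'rV[R]_n -> R) :
  (forall i, P i -> smooth_on A (f i)) ->
  smooth_on A (fun x => \prod_(i <- s | P i) f i x).
Proof. by move=> sf k; apply: Ck_prod => // i Pi; apply: sf. Qed.

Lemma smooth_entry p q (f : 'rV[R]_n -> 'M[R]_(p, q)) a b :
  smooth_on A f -> smooth_on A (fun x => f x a b).
Proof. by move=> sf k; apply: Ck_entry. Qed.

Lemma smooth_mx p q (f : 'rV[R]_n -> 'M[R]_(p, q)) :
  (forall a b, smooth_on A (fun x => f x a b)) -> smooth_on A f.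
Proof. by move=> sf k; apply: Ck_mx => // a b; apply: sf. Qed.

Lemma smooth_mxE p q (f : 'rV[R]_n -> 'M[R]_(p, q))
    (g : 'I_p -> 'I_q -> 'rV[R]_n -> R) :
  (forall x a b, f x a b = g a b x) -> (forall a b, smooth_on A (g a b)) ->
  smooth_on A f.
Proof.
by move=> fg sg; apply: smooth_mx => a b; apply: smooth_ext (sg a b) => x _.
Qed.

Lemma smooth_coord i : smooth_on A (fun x => x 0 i).
Proof. by move=> k; apply: Ck_coord. Qed.

Lemma smooth_id : smooth_on A id.
Proof. by apply: smooth_mx => a b; rewrite (ord1 a); apply: smooth_coord. Qed.

Lemma smoothN p q (f : 'rV[R]_n -> 'M[R]_(p, q)) :
  smooth_on A f -> smooth_on A (fun x => - f x).
Proof.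
move=> sf; apply: (@smooth_mxE _ _ _ (fun a b x => -1 * f x a b)) => [x a b|a b].
  by rewrite mxE mulN1r.
by apply: smoothM; [exact: smooth_cst|exact: smooth_entry].
Qed.

Lemma smoothBr (f g : 'rV[R]_n -> R) :
  smooth_on A f -> smooth_on A g -> smooth_on A (fun x => f x - g x).
Proof.
move=> sf sg; have sNg := smoothM (smooth_cst (-1 : R)) sg.
by apply: smooth_ext (smoothD sf sNg) => x _; rewrite mulN1r.
Qed.

Lemma smoothZ p q (a : 'rV[R]_n -> R) (f : 'rV[R]_n -> 'M[R]_(p, q)) :
  smooth_on A a -> smooth_on A f -> smooth_on A (fun x => a x *: f x).
Proof.
move=> sa sf; apply: (@smooth_mxE _ _ _ (fun i j x => a x * f x i j)).
  by move=> x i j; rewrite mxE.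
by move=> i j; apply: smoothM => //; exact: smooth_entry.
Qed.

Lemma smooth_mulmx p q r (f : 'rV[R]_n -> 'M[R]_(p, q))
    (g : 'rV[R]_n -> 'M[R]_(q, r)) :
  smooth_on A f -> smooth_on A g -> smooth_on A (fun x => f x *m g x).
Proof.
move=> sf sg.
apply: (@smooth_mxE _ _ _ (fun i j x => \sum_k f x i k * g x k j)).
  by move=> x i j; rewrite mxE.
by move=> i j; apply: smooth_sum => k _; apply: smoothM; exact: smooth_entry.
Qed.

Lemma smooth_trmx p q (f : 'rV[R]_n -> 'M[R]_(p, q)) :
  smooth_on A f -> smooth_on A (fun x => (f x)^T).
Proof.
move=> sf; apply: (@smooth_mxE _ _ _ (fun i j x => f x j i)).
  by move=> x i j; rewrite mxE.
by move=> i j; exact: smooth_entry.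
Qed.

Lemma smooth_row_mx p q r (f : 'rV[R]_n -> 'M[R]_(p, q))
    (g : 'rV[R]_n -> 'M[R]_(p, r)) :
  smooth_on A f -> smooth_on A g -> smooth_on A (fun x => row_mx (f x) (g x)).
Proof.
move=> sf sg; apply: smooth_mx => a b.
case: (split_ordP b) => c ->.
  by apply: smooth_ext (smooth_entry a c sf) => x _; rewrite row_mxEl.
by apply: smooth_ext (smooth_entry a c sg) => x _; rewrite row_mxEr.
Qed.

Lemma smooth_col_mx p q r (f : 'rV[R]_n -> 'M[R]_(p, r))
    (g : 'rV[R]_n -> 'M[R]_(q, r)) :
  smooth_on A f -> smooth_on A g -> smooth_on A (fun x => col_mx (f x) (g x)).
Proof.
move=> sf sg; apply: smooth_mx => a b.
case: (split_ordP a) => c ->.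
  by apply: smooth_ext (smooth_entry c b sf) => x _; rewrite col_mxEu.
by apply: smooth_ext (smooth_entry c b sg) => x _; rewrite col_mxEd.
Qed.

Lemma smooth_det p (f : 'rV[R]_n -> 'M[R]_p) :
  smooth_on A f -> smooth_on A (fun x => \det (f x)).
Proof.
move=> sf; apply: smooth_sum => s _; apply: smoothM; first exact: smooth_cst.
by apply: smooth_prod => i _; exact: smooth_entry.
Qed.

(** Cramer's rule: determinant and cofactors are polynomials in the entries, and the determinant has
    no zero on [A]. *)
Lemma smooth_invmx p (f : 'rV[R]_n -> 'M[R]_p) :
  (forall x, A x -> f x \in unitmx) ->
  smooth_on A f -> smooth_on A (fun x => invmx (f x)).
Proof.
move=> fu sf.
apply: (@smooth_ext _ (fun x => (\det (f x))^-1 *: \adj (f x))) => [x Ax|].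
  by rewrite /invmx fu.
apply: smoothZ.
  apply: smoothV => [x Ax|]; last exact: smooth_det.
  by have := fu x Ax; rewrite unitmxE unitfE.
apply: (@smooth_mxE _ _ _ (fun i j x => cofactor (f x) j i)).
  by move=> x i j; rewrite mxE.
move=> i j; apply: smoothM; first exact: smooth_cst.
apply: smooth_det; apply: smooth_mx => a b.
apply: (@smooth_ext _ (fun x => f x (lift j a) (lift i b))).
  by move=> x _; rewrite !mxE.
exact: smooth_entry.
Qed.

Lemma smooth_pd (W : normedModType R) (f : 'rV[R]_n -> W) i :
  smooth_on A f -> smooth_on A (pd i f).
Proof. by move=> sf k; case: (sf k.+1) => _; apply. Qed.

Lemma smooth_derive p q (X : 'rV[R]_n -> 'rV[R]_n) (f : 'rV[R]_n -> 'M[R]_(p, q)) :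
  smooth_on A X -> smooth_on A f -> smooth_on A (fun x => 'D_(X x) f x).
Proof.
move=> sX sf; apply: (@smooth_ext _ (fun x => \sum_i X x 0 i *: pd i f x)).
  by move=> x Ax; rewrite derive_pd //; exact: smooth_diff.
apply: smooth_sum => i _; apply: smoothZ; first exact: smooth_entry.
exact: smooth_pd.
Qed.

Lemma smooth_continuous (W : normedModType R) (f : 'rV[R]_n -> W) x :
  smooth_on A f -> A x -> {for x, continuous f}.
Proof. by move=> sf; apply: (sf 0%N). Qed.

Lemma smooth_deriveC p q (f : 'rV[R]_n -> 'M[R]_(p, q)) u v x :
  smooth_on A f -> A x -> 'D_u ('D_v f) x = 'D_v ('D_u f) x.
Proof.
move=> sf Ax.
have sD w : smooth_on A ('D_w f).
  by apply: (@smooth_derive _ _ (fun=> w)) => //; exact: smooth_cst.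
have sDD w w' : smooth_on A ('D_w ('D_w' f)).
  by apply: (@smooth_derive _ _ (fun=> w)) => //; exact: smooth_cst.
apply/matrixP => i j.
have E w w' y : A y -> ('D_w ('D_w' f)) y i j =
    'D_w ('D_w' (fun y => f y i j)) y.
  move=> Ay; rewrite derive_entry; last exact: smooth_diff (sD _) _.
  apply: near_eq_derive; have := open_near oA Ay.
  apply: filterS => z Az; rewrite derive_entry //; exact: smooth_diff.
have nA (W : normedModType R) (g : 'rV[R]_n -> W) : smooth_on A g ->
    \near x, differentiable g x.
  by move=> sg; apply: filterS (open_near oA Ax) => y; apply: smooth_diff.
have sE w : smooth_on A ('D_w (fun y => f y i j)).
  apply: smooth_ext (smooth_entry i j (sD w)) => y Ay.
  rewrite derive_entry //; exact: smooth_diff.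
have sEE w w' : smooth_on A ('D_w ('D_w' (fun y => f y i j))).
  apply: smooth_ext (smooth_entry i j (sDD w w')) => y Ay; exact: E.
apply: (etrans (E u v x Ax) (etrans _ (esym (E v u x Ax)))).
have nf : \near x, differentiable (fun y => f y i j) x.
  by apply: nA; exact: smooth_entry.
exact: (@schwarz _ _ (fun y => f y i j) x u v nf (nA _ _ (sE u)) (nA _ _ (sE v))
  (smooth_continuous (sEE u v) Ax) (smooth_continuous (sEE v u) Ax)).
Qed.

Lemma derive_mulmx p q r (f : 'rV[R]_n -> 'M[R]_(p, q))
    (g : 'rV[R]_n -> 'M[R]_(q, r)) x v :
  differentiable f x -> differentiable g x ->
  'D_v (fun y => f y *m g y) x = 'D_v f x *m g x + f x *m 'D_v g x.
Proof.
move=> df dg; apply/matrixP => i j.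
have dfg a b : differentiable (fun y => (f y *m g y) a b) x.
  under eq_fun do rewrite mxE.
  rewrite (_ : (fun y => _) = \sum_(k < q) (fun y => f y a k * g y k b)).
    apply: differentiable_sum => k.
    by apply: differentiableM; exact: differentiable_entry.
  by apply/funext => y; rewrite fct_sumE.
rewrite derive_entry; last exact: differentiable_mx.
under eq_fun do rewrite mxE.
rewrite (_ : (fun y => _) = \sum_(k < q) ((fun y => f y i k) * (fun y => g y k j)));
  last by apply/funext => y; rewrite fct_sumE.
rewrite derive_sum => [|k]; last first.
  by apply: derivableM; apply: diff_derivable; exact: differentiable_entry.
rewrite !mxE -big_split; apply: eq_bigr => k _ /=.
rewrite deriveM; try by apply: diff_derivable; exact: differentiable_entry.
by rewrite !derive_entry // [LHS]addrC; congr (_ + _); exact: mulrC.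
Qed.

End SmoothOn.

Lemma smooth_comp {R : realType} {k n p q : nat} (A : set 'rV[R]_k)
    (B : set 'rV[R]_n) (F : 'rV[R]_k -> 'rV[R]_n) (f : 'rV[R]_n -> 'M[R]_(p, q)) :
  open A -> open B -> (forall x, A x -> B (F x)) ->
  smooth_on A F -> smooth_on B f -> smooth_on A (fun x => f (F x)).
Proof.
move=> oA oB AB sF sf; apply: smooth_mx => // a b l.
have := @Ck_comp _ _ _ l A B F (fun x => f x a b) oA oB AB (sF l).
by apply; apply: (smooth_entry oB a b sf).
Qed.

(* Unification is prone to unfold ['D_v f] down to limits; [der] is locked to
   prevent it. *)
Fact der_key : unit. Proof. exact: tt. Qed.
Definition der {R : realType} {n : nat} {W : normedModType R}
    (f : 'rV[R]_n -> W) (x v : 'rV[R]_n) : W :=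
  locked_with der_key (fun f x v => 'D_v f x) f x v.

Section Der.
Context {R : realType} {n : nat}.

Lemma derE (W : normedModType R) (f : 'rV[R]_n -> W) x v : der f x v = 'D_v f x.
Proof. by rewrite /der unlock. Qed.

Lemma pd_der (W : normedModType R) (f : 'rV[R]_n -> W) x i :
  pd i f x = der f x (delta_mx 0 i).
Proof. by rewrite derE. Qed.

Lemma der_sum_pd (W : normedModType R) (f : 'rV[R]_n -> W) x v :
  differentiable f x -> der f x v = \sum_i v 0 i *: pd i f x.
Proof. by rewrite derE; exact: derive_pd. Qed.

Lemma der_near (W : normedModType R) (f g : 'rV[R]_n -> W) x v :
  (\near x, f x = g x) -> der f x v = der g x v.
Proof. by rewrite !derE; exact: near_eq_derive. Qed.

Lemma der_open_ext (W : normedModType R) A (f g : 'rV[R]_n -> W) x v :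
  open A -> (forall y, A y -> f y = g y) -> A x -> der f x v = der g x v.
Proof. by move=> oA fg Ax; apply: der_near; exact: near_eq_open Ax. Qed.

Lemma der_cst (W : normedModType R) (c : W) x (v : 'rV[R]_n) :
  der (fun=> c) x v = 0.
Proof. by rewrite derE derive_cst. Qed.

Lemma der_id (x v : 'rV[R]_n) : der id x v = v.
Proof. by rewrite derE derive_id. Qed.

Lemma derD (W : normedModType R) (f g : 'rV[R]_n -> W) x v :
  differentiable f x -> differentiable g x ->
  der (fun y => f y + g y) x v = der f x v + der g x v.
Proof.
by move=> df dg; rewrite !derE; apply: deriveD; exact: diff_derivable.
Qed.

Lemma derN (W : normedModType R) (f : 'rV[R]_n -> W) x v :
  differentiable f x -> der (fun y => - f y) x v = - der f x v.
Proof.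
by move=> df; rewrite !derE; apply: deriveN; exact: diff_derivable.
Qed.

Lemma der_scale (W : normedModType R) (a : R) (f : 'rV[R]_n -> W) x v :
  differentiable f x -> der (fun y => a *: f y) x v = a *: der f x v.
Proof.
by move=> df; rewrite !derE; apply: deriveZ; exact: diff_derivable.
Qed.

Lemma der_mulmx p q r (f : 'rV[R]_n -> 'M[R]_(p, q))
    (g : 'rV[R]_n -> 'M[R]_(q, r)) x v :
  differentiable f x -> differentiable g x ->
  der (fun y => f y *m g y) x v = der f x v *m g x + f x *m der g x v.
Proof. by rewrite !derE; exact: derive_mulmx. Qed.

Lemma der_entry p q (f : 'rV[R]_n -> 'M[R]_(p, q)) a b x v :
  differentiable f x -> der (fun y => f y a b) x v = der f x v a b.
Proof. by move=> df; rewrite !derE derive_entry. Qed.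

Lemma der_sum (W : normedModType R) p (f : 'I_p -> 'rV[R]_n -> W) x v :
  (forall i, differentiable (f i) x) ->
  der (fun y => \sum_i f i y) x v = \sum_i der (f i) x v.
Proof.
move=> df; rewrite derE (_ : (fun y => _) = \sum_i f i); last first.
  by apply/funext => y; rewrite fct_sumE.
rewrite derive_sum => [|i]; last exact: diff_derivable.
by apply: eq_bigr => i _; rewrite derE.
Qed.

Lemma der_scalel p q (a : 'rV[R]_n -> R) (f : 'rV[R]_n -> 'M[R]_(p, q)) x v :
  differentiable a x -> differentiable f x ->
  der (fun y => a y *: f y) x v = der a x v *: f x + a x *: der f x v.
Proof.
move=> da df; have dfij i j := differentiable_entry i j df.
have E i j : (fun y => (a y *: f y) i j) = a * (fun y => f y i j).
  by apply/funext => y; rewrite mxE.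
apply/matrixP => i j; rewrite -der_entry; last first.
  by apply: differentiable_mx => b c; rewrite E; exact: differentiableM.
rewrite E derE deriveM; try exact: diff_derivable.
rewrite !mxE -der_entry // !derE addrC; congr (_ + _); exact: mulrC.
Qed.

Lemma der_trmx p q (f : 'rV[R]_n -> 'M[R]_(p, q)) x v :
  differentiable f x -> der (fun y => (f y)^T) x v = (der f x v)^T.
Proof.
move=> df; apply/matrixP => i j; rewrite mxE -!der_entry //.
  by under eq_fun do rewrite mxE.
apply: differentiable_mx => a b; under eq_fun do rewrite mxE.
exact: differentiable_entry.
Qed.

Lemma der_row_mx p q r (f : 'rV[R]_n -> 'M[R]_(p, q))
    (g : 'rV[R]_n -> 'M[R]_(p, r)) x v :
  differentiable f x -> differentiable g x ->
  der (fun y => row_mx (f y) (g y)) x v = row_mx (der f x v) (der g x v).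
Proof.
move=> df dg; apply/matrixP => i j; rewrite -der_entry; last first.
  apply: differentiable_mx => a b; case: (split_ordP b) => c ->.
    by under eq_fun do rewrite row_mxEl; exact: differentiable_entry.
  by under eq_fun do rewrite row_mxEr; exact: differentiable_entry.
case: (split_ordP j) => c ->.
  by under eq_fun do rewrite row_mxEl; rewrite row_mxEl der_entry.
by under eq_fun do rewrite row_mxEr; rewrite row_mxEr der_entry.
Qed.

Lemma der_lsubmx q r (f : 'rV[R]_n -> 'rV[R]_(q + r)) x v :
  differentiable f x -> der (fun y => lsubmx (f y)) x v = lsubmx (der f x v).
Proof.
move=> df; apply/matrixP => i j; rewrite mxE -!der_entry //.
  by under eq_fun do rewrite mxE.
apply: differentiable_mx => a b; under eq_fun do rewrite mxE.
exact: differentiable_entry.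
Qed.

Lemma der_rsubmx q r (f : 'rV[R]_n -> 'rV[R]_(q + r)) x v :
  differentiable f x -> der (fun y => rsubmx (f y)) x v = rsubmx (der f x v).
Proof.
move=> df; apply/matrixP => i j; rewrite mxE -!der_entry //.
  by under eq_fun do rewrite mxE.
apply: differentiable_mx => a b; under eq_fun do rewrite mxE.
exact: differentiable_entry.
Qed.

Lemma der_dirD (W : normedModType R) (f : 'rV[R]_n -> W) x u v :
  differentiable f x -> der f x (u + v) = der f x u + der f x v.
Proof. by move=> df; rewrite !derE !deriveE // linearD. Qed.

Lemma der_dirN (W : normedModType R) (f : 'rV[R]_n -> W) x v :
  differentiable f x -> der f x (- v) = - der f x v.
Proof. by move=> df; rewrite !derE !deriveE // linearN. Qed.

Lemma der_dir0 (W : normedModType R) (f : 'rV[R]_n -> W) x : der f x 0 = 0.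
Proof. by rewrite derE derive0. Qed.

Lemma smooth_der A (oA : open A) p q (X : 'rV[R]_n -> 'rV[R]_n)
    (f : 'rV[R]_n -> 'M[R]_(p, q)) :
  smooth_on A X -> smooth_on A f -> smooth_on A (fun x => der f x (X x)).
Proof.
move=> sX sf; apply: smooth_ext (smooth_derive oA sX sf) => // x _.
by rewrite derE.
Qed.

Lemma derC A (oA : open A) p q (f : 'rV[R]_n -> 'M[R]_(p, q)) u v x :
  smooth_on A f -> A x ->
  der (fun y => der f y v) x u = der (fun y => der f y u) x v.
Proof.
move=> sf Ax; under eq_fun do rewrite derE; rewrite derE.
rewrite (smooth_deriveC oA u v sf Ax) -derE.
by congr der; apply/funext => y; rewrite derE.
Qed.

(** A real function is the entry of a 1 x 1 matrix-valued one, to which [derC] applies. *)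
Lemma derC_scalar A (oA : open A) (f : 'rV[R]_n -> R) u v x :
  smooth_on A f -> A x ->
  der (fun y => der f y v) x u = der (fun y => der f y u) x v.
Proof.
move=> sf Ax; pose g y : 'M[R]_1 := \matrix_(i, j) f y.
have gE y : g y 0 0 = f y by rewrite mxE.
have sg : smooth_on A g.
  by apply: (smooth_mxE oA (g := fun _ _ => f)) => // y a b; rewrite mxE.
have sDg w : smooth_on A (fun y => der g y (w : 'rV_n)).
  by apply: (smooth_der oA (X := fun=> w)) => //; exact: smooth_cst.
have E a b : der (fun y => der f y a) x b = der (fun y => der g y a) x b 0 0.
  rewrite -der_entry; last exact: smooth_diff (sDg a) Ax.
  apply: (der_open_ext _ oA) => // y Ay.
  rewrite -der_entry; last exact: smooth_diff sg Ay.
  by congr der; apply/funext.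
by rewrite !E (derC oA u v sg Ax).
Qed.

(** Separates the second derivative with the direction frozen at [X x] from the contribution of the
    variation of [X]. It is this contribution that the bracket compensates in [nab_curv_fields]. *)
Lemma der_der_field A (oA : open A) p q (f : 'rV[R]_n -> 'M[R]_(p, q))
    (X : 'rV[R]_n -> 'rV[R]_n) x v :
  smooth_on A f -> smooth_on A X -> A x ->
  der (fun y => der f y (X y)) x v =
  der (fun y => der f y (X x)) x v + der f x (der X x v).
Proof.
move=> sf sX Ax; have dX := smooth_diff sX Ax.
have sD w : smooth_on A (fun y => der f y (w : 'rV_n)).
  by apply: (smooth_der oA (X := fun=> w)) => //; exact: smooth_cst.
have dD i := smooth_diff (sD (delta_mx 0 i)) Ax.
have dXi i := differentiable_entry 0 i dX.
(* Stated for any field because it is used twice: for [X], and for the constant field [X x], whose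
   own derivative vanishes. *)
have E (Y : 'rV[R]_n -> 'rV[R]_n) : smooth_on A Y ->
    der (fun y => der f y (Y y)) x v =
    \sum_i (der Y x v 0 i *: der f x (delta_mx 0 i) +
            Y x 0 i *: der (fun y => der f y (delta_mx 0 i)) x v).
  move=> sY; have dYi i := differentiable_entry 0 i (smooth_diff sY Ax).
  rewrite (@der_open_ext _ A _
    (fun y => \sum_i Y y 0 i *: der f y (delta_mx 0 i))) //; last first.
    move=> y Ay; rewrite der_sum_pd; last exact: smooth_diff sf Ay.
    by apply: eq_bigr => i _; rewrite pd_der.
  rewrite der_sum => [|i]; last first.
    by apply: (smooth_diff _ Ax); apply: smoothZ => //; exact: smooth_entry.
  apply: eq_bigr => i _; rewrite (der_scalel v (dYi i) (dD i)).
  by rewrite (der_entry _ _ _ (smooth_diff sY Ax)).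
rewrite E // (E (fun=> X x)); last exact: smooth_cst.
rewrite (der_sum_pd (der X x v) (smooth_diff sf Ax)).
rewrite -big_split; apply: eq_bigr => i _ /=.
by rewrite der_cst mxE scale0r add0r pd_der addrC.
Qed.

End Der.

Lemma der_comp {R : realType} {k n : nat} (W : normedModType R)
    (F : 'rV[R]_k -> 'rV[R]_n) (f : 'rV[R]_n -> W) x v :
  differentiable F x -> differentiable f (F x) ->
  der (fun y => f (F y)) x v = der f (F x) (der F x v).
Proof. by rewrite !derE; exact: derive_comp. Qed.

Lemma der_jacobian {R : realType} {k n : nat} (F : 'rV[R]_k -> 'rV[R]_n) x v :
  differentiable F x -> der F x v = v *m jacobian F x.
Proof. by rewrite derE; exact: deriveEjacobian. Qed.

(** * Covariant derivatives and curvature in coordinates *)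

Section Form.
Context {R : realType} {n : nat}.
Implicit Types (A B : 'M[R]_n) (u v w : 'rV[R]_n).

Lemma formDl A u v w : form A (u + v) w = form A u w + form A v w.
Proof. by rewrite /form !mulmxDl mxE. Qed.

Lemma formDr A u v w : form A w (u + v) = form A w u + form A w v.
Proof. by rewrite /form linearD mulmxDr mxE. Qed.

Lemma formNl A u w : form A (- u) w = - form A u w.
Proof. by rewrite /form !mulNmx mxE. Qed.

Lemma formNr A u w : form A w (- u) = - form A w u.
Proof. by rewrite /form linearN mulmxN mxE. Qed.

Lemma formBl A u v w : form A (u - v) w = form A u w - form A v w.
Proof. by rewrite formDl formNl. Qed.

Lemma formBr A u v w : form A w (u - v) = form A w u - form A w v.
Proof. by rewrite formDr formNr. Qed.

Lemma formZl A a u w : form A (a *: u) w = a * form A u w.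
Proof. by rewrite /form -!scalemxAl mxE. Qed.

Lemma formZr A a u w : form A w (a *: u) = a * form A w u.
Proof. by rewrite /form linearZ -scalemxAr mxE. Qed.

Lemma form0l A w : form A 0 w = 0.
Proof. by rewrite /form !mul0mx mxE. Qed.

Lemma form0r A w : form A w 0 = 0.
Proof. by rewrite /form trmx0 mulmx0 mxE. Qed.

Lemma form0 u w : form 0 u w = 0.
Proof. by rewrite /form mulmx0 mul0mx mxE. Qed.

Lemma formC A u w : A^T = A -> form A u w = form A w u.
Proof.
move=> As; rewrite /form -[in LHS](trmxK (u *m A *m w^T)) mxE.
by rewrite !trmx_mul trmxK As mulmxA.
Qed.

Lemma form_suml I (s : seq I) (P : pred I) A (F : I -> 'rV[R]_n) w :
  form A (\sum_(i <- s | P i) F i) w = \sum_(i <- s | P i) form A (F i) w.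
Proof. by rewrite /form !mulmx_suml summxE. Qed.

Lemma form_sumr I (s : seq I) (P : pred I) A (F : I -> 'rV[R]_n) w :
  form A w (\sum_(i <- s | P i) F i) = \sum_(i <- s | P i) form A w (F i).
Proof. by rewrite /form linear_sum mulmx_sumr summxE. Qed.

Lemma form_sum_mx I (s : seq I) (P : pred I) (F : I -> 'M[R]_n) u w :
  form (\sum_(i <- s | P i) F i) u w = \sum_(i <- s | P i) form (F i) u w.
Proof. by rewrite /form mulmx_sumr mulmx_suml summxE. Qed.

Lemma formZ a A u w : form (a *: A) u w = a * form A u w.
Proof. by rewrite /form -scalemxAr -scalemxAl mxE. Qed.

Lemma formD A B u w : form (A + B) u w = form A u w + form B u w.
Proof. by rewrite /form mulmxDr mulmxDl mxE. Qed.

Lemma form_delta A i j : form A (delta_mx 0 i) (delta_mx 0 j) = A i j.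
Proof. by rewrite /form -rowE trmx_delta -colE !mxE. Qed.

Lemma form_coord A u w :
  form A u w = \sum_i \sum_j u 0 i * w 0 j * A i j.
Proof.
rewrite {1}(row_sum_delta u) form_suml; apply: eq_bigr => i _.
rewrite formZl {1}(row_sum_delta w) form_sumr mulr_sumr; apply: eq_bigr => j _.
by rewrite formZr form_delta mulrA.
Qed.

Lemma form_nondeg A u v : A \in unitmx ->
  (forall w, form A u w = form A v w) -> u = v.
Proof.
move=> Au E; rewrite -[u](mulmxK Au) -[v](mulmxK Au); congr (_ *m _).
apply/rowP => i; have := E (delta_mx 0 i).
by rewrite /form trmx_delta -!colE !mxE.
Qed.

End Form.

Lemma form_mulmx {R : realType} {k n : nat} (J : 'M[R]_(k, n)) A u w :
  form A (u *m J) (w *m J) = form (J *m A *m J^T) u w.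
Proof. by rewrite /form trmx_mul !mulmxA. Qed.

Lemma der_form {R : realType} {k n : nat} (h : 'rV[R]_k -> 'M[R]_n)
    (Y Z : 'rV[R]_k -> 'rV[R]_n) x v :
  differentiable h x -> differentiable Y x -> differentiable Z x ->
  der (fun y => form (h y) (Y y) (Z y)) x v =
    form (der h x v) (Y x) (Z x) + form (h x) (der Y x v) (Z x) +
    form (h x) (Y x) (der Z x v).
Proof.
move=> dh dY dZ; rewrite /form.
have dZT : differentiable (fun y => (Z y)^T) x.
  apply: differentiable_mx => a b; under eq_fun do rewrite mxE.
  exact: differentiable_entry.
have dM p q r (f : 'rV[R]_k -> 'M[R]_(p, q)) (g : 'rV[R]_k -> 'M[R]_(q, r)) :
    differentiable f x -> differentiable g x ->
    differentiable (fun y => f y *m g y) x.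
  move=> df dg; apply: differentiable_mx => a b; under eq_fun do rewrite mxE.
  rewrite (_ : (fun y => _) = \sum_(c < q) (fun y => f y a c * g y c b)).
    apply: differentiable_sum => c.
    by apply: differentiableM; exact: differentiable_entry.
  by apply/funext => y; rewrite fct_sumE.
rewrite der_entry; last by apply: (dM _ _ _ _ _ _ dZT); exact: dM.
rewrite der_mulmx //; last exact: dM.
rewrite der_mulmx // der_trmx // mulmxDl mxE; congr (_ + _).
by rewrite mxE addrC.
Qed.

Section Connection.
Context {R : realType} {n : nat} (h : 'rV[R]_n -> 'M[R]_n).

(** The row index is the argument of the connection and the column index its value, so that row
    vectors are multiplied from the right. *)
Definition christoffel_mx (x : 'rV[R]_n) (b : 'I_n) : 'M[R]_n :=
  \matrix_(c, a) christoffel h x a b c.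

(** [omega x v] is the matrix of [w |-> Gamma(v, w)] acting on row vectors. *)
Definition omega (x v : 'rV[R]_n) : 'M[R]_n :=
  \sum_b v 0 b *: christoffel_mx x b.

Definition Gam (x v w : 'rV[R]_n) : 'rV[R]_n := w *m omega x v.

Lemma omegaD x u v : omega x (u + v) = omega x u + omega x v.
Proof.
by rewrite /omega -big_split; apply: eq_bigr => b _; rewrite mxE scalerDl.
Qed.

Lemma omegaZ x a v : omega x (a *: v) = a *: omega x v.
Proof.
by rewrite /omega scaler_sumr; apply: eq_bigr => b _; rewrite mxE scalerA.
Qed.

Lemma omegaN x v : omega x (- v) = - omega x v.
Proof. by rewrite -scaleN1r omegaZ scaleN1r. Qed.

Lemma omega0 x : omega x 0 = 0.
Proof. by rewrite -(scale0r (0 : 'rV_n)) omegaZ scale0r. Qed.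

(** Covariant derivative of a vector field [W] along a map [F]. *)
Definition nab {k : nat} (F W : 'rV[R]_k -> 'rV[R]_n) (y v : 'rV[R]_k) :=
  der W y v + W y *m omega (F y) (der F y v).

(** The matrix of [w |-> R(u, v) w]. *)
Definition riemann_mx (x u v : 'rV[R]_n) : 'M[R]_n :=
  der (omega ^~ v) x u - der (omega ^~ u) x v
  + omega x v *m omega x u - omega x u *m omega x v.

(** Written with the summand of [sectional_curvature], so that the vector in the numerator of the
    latter is an instance of [Rm] by mere folding. *)
Definition Rm (x u v w : 'rV[R]_n) : 'rV[R]_n :=
  \row_l \sum_i \sum_j \sum_k riemann h x l i j k * u 0 i * v 0 j * w 0 k.

End Connection.

(** Nondegeneracy is what recovers a vector from its pairings in [form_nondeg]. Positivity is the
    separate hypothesis [gpos], added where lengths matter. *)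
Definition metric_on {R : realType} {n : nat} (B : set 'rV[R]_n)
    (h : 'rV[R]_n -> 'M[R]_n) : Prop :=
  [/\ open B, smooth_on B h, forall x, B x -> (h x)^T = h x
   & forall x, B x -> h x \in unitmx].

(** The matrix of [u |-> R(u, v) w]. *)
Definition curv_mx {R : realType} {n : nat} (h : 'rV[R]_n -> 'M[R]_n)
    (x v w : 'rV[R]_n) : 'M[R]_n :=
  \matrix_(i, l) \sum_j \sum_k riemann h x l i j k * v 0 j * w 0 k.

Lemma mul_curv_mx {R : realType} {n : nat} (h : 'rV[R]_n -> 'M[R]_n)
    (x u v w : 'rV[R]_n) : u *m curv_mx h x v w = Rm h x u v w.
Proof.
apply/rowP => l; rewrite !mxE; apply: eq_bigr => i _; rewrite mxE mulr_sumr.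
apply: eq_bigr => j _; rewrite mulr_sumr; apply: eq_bigr => k _; ring.
Qed.

Section MetricTheory.
Context {R : realType} {n : nat} (B : set 'rV[R]_n) (h : 'rV[R]_n -> 'M[R]_n).
Hypothesis hm : metric_on B h.

Let oB : open B. Proof. by case: hm. Qed.
Let sh : smooth_on B h. Proof. by case: hm. Qed.
Let hsym x : B x -> (h x)^T = h x. Proof. by case: hm => _ _ + _; apply. Qed.
Let hunit x : B x -> h x \in unitmx. Proof. by case: hm => _ _ _; apply. Qed.

Local Notation omega := (omega h).
Local Notation Gam := (Gam h).
Local Notation nab := (nab h).
Local Notation Rm := (Rm h).

Lemma der_sym x u : B x -> (der h x u)^T = der h x u.
Proof.
move=> Bx; rewrite -der_trmx; last exact: smooth_diff sh Bx.
exact: der_open_ext oB hsym Bx.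
Qed.

Lemma smooth_christoffel k i j : smooth_on B (fun x => christoffel h x k i j).
Proof.
apply: smoothM => //; first exact: smooth_cst.
apply: smooth_sum => // l _; apply: smoothM => //.
  by apply: smooth_entry => //; exact: smooth_invmx.
apply: smoothBr => //.
  by apply: smoothD => //; apply: smooth_pd; exact: smooth_entry.
by apply: smooth_pd; exact: smooth_entry.
Qed.

Lemma smooth_christoffel_mx b : smooth_on B (christoffel_mx h ^~ b).
Proof.
apply: (smooth_mxE oB (g := fun c a x => christoffel h x a b c)) => [x c a|c a].
  by rewrite mxE.
exact: smooth_christoffel.
Qed.

Lemma smooth_omega k (A : set 'rV[R]_k) (F X : 'rV[R]_k -> 'rV[R]_n) :
  open A -> (forall y, A y -> B (F y)) -> smooth_on A F -> smooth_on A X ->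
  smooth_on A (fun y => omega (F y) (X y)).
Proof.
move=> oA AB sF sX; apply: smooth_sum => // b _; apply: smoothZ => //.
  exact: smooth_entry.
exact: (smooth_comp oA oB AB sF (smooth_christoffel_mx b)).
Qed.

Lemma form_der_coord x u v w : B x ->
  form (der h x u) v w =
  \sum_i \sum_j \sum_k u 0 i * v 0 j * w 0 k * pd i (fun y => h y j k) x.
Proof.
move=> Bx; have dh := smooth_diff sh Bx.
rewrite der_sum_pd // form_sum_mx; apply: eq_bigr => i _.
rewrite formZ form_coord mulr_sumr; apply: eq_bigr => j _.
rewrite mulr_sumr; apply: eq_bigr => k _.
by rewrite (pd_entry B) // !mulrA.
Qed.

(** Pairing with [h] cancels the inverse matrix in [christoffel] and leaves the Koszul formula for
    constant fields. Symmetry ([GamC]) and compatibility with the metric ([Gam_metric]) are read off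
    from these pairings. *)
Lemma Gam_low x v w u : B x ->
  form (h x) (Gam x v w) u =
  2^-1 * (form (der h x v) w u + form (der h x w) v u - form (der h x u) v w).
Proof.
move=> Bx.
have hE : forall a b, h x a b = h x b a by move=> a b; rewrite -[in LHS]hsym // mxE.
have low b c d : \sum_a christoffel h x a b c * h x a d =
    2^-1 * (pd b (fun y => h y c d) x + pd c (fun y => h y b d) x
            - pd d (fun y => h y b c) x).
  under eq_bigr do rewrite /christoffel -mulrA mulr_suml.
  rewrite -mulr_sumr; congr (_ * _); rewrite exchange_big /=.
  set E := fun l => pd b (fun y => h y c l) x + pd c (fun y => h y b l) x
                    - pd l (fun y => h y b c) x.
  transitivity (\sum_l (h x *m invmx (h x)) d l * E l).
    apply: eq_bigr => l _; rewrite mxE mulr_suml; apply: eq_bigr => a _.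
    by rewrite (hE a d) -/(E l); ring.
  rewrite mulmxV ?hunit // (bigD1 d) //= big1 => [|l ld].
    by rewrite mxE eqxx mul1r addr0.
  by rewrite mxE eq_sym (negbTE ld) mul0r.
have -> : form (h x) (Gam x v w) u = \sum_b \sum_c \sum_d v 0 b * w 0 c * u 0 d *
    \sum_a christoffel h x a b c * h x a d.
  rewrite /Gam /omega mulmx_sumr form_suml; apply: eq_bigr => b _.
  rewrite -scalemxAr formZl /form -mulmxA -/(form _ w u).
  rewrite -[_ *m (h x *m _)]mulmxA [_ *m (_ *m u^T)]mulmxA mulmxA -/(form _ w u).
  rewrite form_coord mulr_sumr; apply: eq_bigr => c _.
  rewrite mulr_sumr; apply: eq_bigr => d _; rewrite !mulrA; congr (_ * _).
  by rewrite mxE; apply: eq_bigr => a _; rewrite mxE.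
rewrite !form_der_coord //.
(* Renaming of summation indices here and below, to give all three derivative terms the coefficient
   v_b w_c u_d. *)
have -> : \sum_i \sum_j \sum_k w 0 i * v 0 j * u 0 k * pd i (fun y => h y j k) x =
  \sum_b \sum_c \sum_d v 0 b * w 0 c * u 0 d * pd c (fun y => h y b d) x.
  rewrite exchange_big; apply: eq_bigr => b _; apply: eq_bigr => c _.
  by apply: eq_bigr => d _; rewrite [w _ _ * _]mulrC.
have -> : \sum_i \sum_j \sum_k u 0 i * v 0 j * w 0 k * pd i (fun y => h y j k) x =
  \sum_b \sum_c \sum_d v 0 b * w 0 c * u 0 d * pd d (fun y => h y b c) x.
  rewrite exchange_big; apply: eq_bigr => b _; rewrite exchange_big.
  apply: eq_bigr => c _; apply: eq_bigr => d _; congr (_ * _).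
  by rewrite [u _ _ * _]mulrC -!mulrA [u _ _ * _]mulrC.
rewrite -big_split -sumrB mulr_sumr; apply: eq_bigr => b _ /=.
rewrite -big_split -sumrB mulr_sumr; apply: eq_bigr => c _ /=.
rewrite -big_split -sumrB mulr_sumr; apply: eq_bigr => d _ /=.
by rewrite low; ring.
Qed.

Lemma GamC x v w : B x -> Gam x v w = Gam x w v.
Proof.
move=> Bx; apply: (form_nondeg (hunit Bx)) => u; rewrite !Gam_low //.
rewrite (formC v w) ?der_sym //; ring.
Qed.

Lemma Gam_metric x v w u : B x ->
  form (h x) (Gam x v w) u + form (h x) w (Gam x v u) = form (der h x v) w u.
Proof.
move=> Bx; rewrite (formC w) ?hsym // !Gam_low // (formC u w) ?der_sym //.
by rewrite (formC v w) ?der_sym // (formC v u) ?der_sym //; field.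
Qed.

Lemma der_omega x u v : B x -> der (omega ^~ v) x u =
  \sum_i \sum_j (u 0 i * v 0 j) *: der (christoffel_mx h ^~ j) x (delta_mx 0 i).
Proof.
move=> Bx; have dC b : differentiable (christoffel_mx h ^~ b) x.
  by apply: smooth_diff Bx; exact: smooth_christoffel_mx.
rewrite der_sum_pd; last first.
  apply: (smooth_diff _ Bx).
  by apply: (@smooth_omega _ B id (fun=> v)) => //;
    [exact: smooth_id|exact: smooth_cst].
apply: eq_bigr => i _; rewrite /omega.
have -> : pd i (fun x => \sum_b v 0 b *: christoffel_mx h x b) x =
    \sum_b v 0 b *: pd i (christoffel_mx h ^~ b) x.
  rewrite (_ : (fun x => _) = \sum_b (v 0 b *: (christoffel_mx h ^~ b))).
    rewrite /pd derive_sum => [|b]; last exact/derivableZ/diff_derivable.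
    by apply: eq_bigr => b _; rewrite deriveZ //; exact: diff_derivable.
  by apply/funext => z; rewrite fct_sumE.
by rewrite scaler_sumr; apply: eq_bigr => j _; rewrite scalerA pd_der.
Qed.

(** Links the index formula for the curvature to the commutator of covariant derivatives. Operators
    act on rows from the right, so in [riemann_mx] the factor applied first stands on the left. *)
Lemma RmE x u v w : B x -> Rm x u v w = w *m riemann_mx h x u v.
Proof.
move=> Bx.
have dC b : differentiable (christoffel_mx h ^~ b) x.
  by apply: smooth_diff Bx; exact: smooth_christoffel_mx.
have oM a b : omega x a *m omega x b =
    \sum_i \sum_j (a 0 i * b 0 j) *: (christoffel_mx h x i *m christoffel_mx h x j).
  rewrite /omega mulmx_suml; apply: eq_bigr => i _.
  rewrite mulmx_sumr; apply: eq_bigr => j _.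
  by rewrite -scalemxAl -scalemxAr scalerA.
have -> : riemann_mx h x u v = \sum_i \sum_j (u 0 i * v 0 j) *:
    (der (christoffel_mx h ^~ j) x (delta_mx 0 i)
     - der (christoffel_mx h ^~ i) x (delta_mx 0 j)
     + christoffel_mx h x j *m christoffel_mx h x i
     - christoffel_mx h x i *m christoffel_mx h x j).
  rewrite /riemann_mx !der_omega // !oM.
  (* The two terms in which [u] and [v] are interchanged have their indices swapped, so that all
     four share the coefficient u_i v_j. *)
  rewrite [X in _ - X + _ - _]exchange_big [X in _ - _ + X - _]exchange_big.
  rewrite -sumrB -big_split -sumrB; apply: eq_bigr => i _ /=.
  rewrite -sumrB -big_split -sumrB; apply: eq_bigr => j _ /=.
  by rewrite [v _ _ * _]mulrC scalerBr scalerDr scalerBr.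
apply/rowP => l; rewrite !mxE.
under [RHS]eq_bigr do rewrite summxE mulr_sumr.
rewrite [RHS]exchange_big; apply: eq_bigr => i _ /=.
under [RHS]eq_bigr do rewrite summxE mulr_sumr.
rewrite [RHS]exchange_big; apply: eq_bigr => j _ /=.
apply: eq_bigr => k _; rewrite mxE.
have -> : (der (christoffel_mx h ^~ j) x (delta_mx 0 i)
     - der (christoffel_mx h ^~ i) x (delta_mx 0 j)
     + christoffel_mx h x j *m christoffel_mx h x i
     - christoffel_mx h x i *m christoffel_mx h x j) k l = riemann h x l i j k.
  have E (a b c d : 'M[R]_n) : (a - b + c - d) k l = a k l - b k l + (c k l - d k l).
    by rewrite !mxE addrA.
  have P a b : der (christoffel_mx h ^~ b) x (delta_mx 0 a) k l =
      der (fun y => christoffel h y l b k) x (delta_mx 0 a).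
    rewrite -der_entry //.
    by congr (der _ x _); apply/funext => y; exact: mxE.
  rewrite E (P i j) (P j i) /riemann sumrB !pd_der; congr (_ + (_ - _)).
  - by rewrite mxE; apply: eq_bigr => p _; rewrite !mxE mulrC.
  - by rewrite mxE; apply: eq_bigr => p _; rewrite !mxE mulrC.
ring.

Qed.

(** * Covariant derivatives along a map *)

Section Along.
Context {k : nat} (A : set 'rV[R]_k) (F : 'rV[R]_k -> 'rV[R]_n).
Hypotheses (oA : open A) (AB : forall y, A y -> B (F y)) (sF : smooth_on A F).
Implicit Types W Y Z : 'rV[R]_k -> 'rV[R]_n.

Lemma smooth_nab W X : smooth_on A W -> smooth_on A X ->
  smooth_on A (fun y => nab F W y (X y)).
Proof.
move=> sW sX; apply: smoothD => //; first exact: smooth_der.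
apply: smooth_mulmx => //; apply: smooth_omega => //; exact: smooth_der.
Qed.

Lemma nab_metric Y Z y v : smooth_on A Y -> smooth_on A Z -> A y ->
  der (fun y => form (h (F y)) (Y y) (Z y)) y v =
  form (h (F y)) (nab F Y y v) (Z y) + form (h (F y)) (Y y) (nab F Z y v).
Proof.
move=> sY sZ Ay; have By := AB Ay.
have shF : smooth_on A (fun y => h (F y)) by exact: smooth_comp sF sh.
rewrite der_form; try exact: smooth_diff Ay.
rewrite der_comp; [|exact: smooth_diff sF Ay|exact: smooth_diff sh By].
rewrite -Gam_metric // /nab formDl formDr; ring.
Qed.

Lemma nab_torsion u v y : A y ->
  nab F (fun y => der F y u) y v = nab F (fun y => der F y v) y u.
Proof.
move=> Ay; rewrite /nab (derC oA u v sF Ay); congr (_ + _).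
by rewrite -!/(Gam _ _ _) GamC //; exact: AB.
Qed.

Lemma der_omega_along X y v : smooth_on A X -> A y ->
  der (fun y => omega (F y) (X y)) y v =
  der (omega ^~ (X y)) (F y) (der F y v) + omega (F y) (der X y v).
Proof.
move=> sX Ay; have By := AB Ay.
have dX := smooth_diff sX Ay; have dF := smooth_diff sF Ay.
have dC b : differentiable (christoffel_mx h ^~ b) (F y).
  by apply: smooth_diff By; exact: smooth_christoffel_mx.
have dCF b : differentiable (fun y => christoffel_mx h (F y) b) y.
  exact: differentiable_comp dF (dC b).
have dXb b : differentiable (fun y => X y 0 b) y by exact: differentiable_entry.
have dZ (f : 'I_n -> 'rV[R]_k -> 'M[R]_n) b : differentiable (f b) y ->
    differentiable (fun y => X y 0 b *: f b y) y.
  move=> df; apply: differentiable_mx => i j; under eq_fun do rewrite mxE.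
  by apply: differentiableM => //; exact: differentiable_entry.
rewrite der_sum => [|b]; last exact: (dZ (fun b y => christoffel_mx h (F y) b)).
rewrite der_sum => [|b]; last exact: differentiableZ.
rewrite -big_split; apply: eq_bigr => b _ /=.
rewrite (der_scalel v (dXb b) (dCF b)) (der_scale _ _ (dC b)) addrC.
by rewrite (der_comp v dF (dC b)) (der_entry _ _ _ dX).
Qed.

(** Constant directions in the parameter space commute, so no bracket term appears. The mixed second
    derivatives of [W] and of [F] cancel by [derC], and what survives is the curvature of the
    target. *)
Lemma nab_curv W u v y : smooth_on A W -> A y ->
  nab F (fun y => nab F W y v) y u - nab F (fun y => nab F W y u) y v =
  Rm (F y) (der F y u) (der F y v) (W y).
Proof.
move=> sW Ay; have By := AB Ay; rewrite RmE //.
have sd (f : 'rV[R]_k -> 'rV[R]_n) w : smooth_on A f -> smooth_on A (der f ^~ w).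
  move=> sf; apply: (smooth_der oA (X := fun=> w)) => //; exact: smooth_cst.
have so w : smooth_on A (fun y => omega (F y) (der F y w)).
  by apply: smooth_omega => //; exact: sd.
have dW := smooth_diff sW Ay.
have N w z : der (fun y => nab F W y w) y z =
    der (der W ^~ w) y z + der W y z *m omega (F y) (der F y w) +
    W y *m der (fun y => omega (F y) (der F y w)) y z.
  rewrite derD; last 2 first.
  - exact: smooth_diff (sd _ _ sW) Ay.
  - by apply: smooth_diff Ay; apply: smooth_mulmx.
  rewrite der_mulmx //; last exact: smooth_diff (so w) Ay.
  by rewrite addrA.
have O w z : der (fun y => omega (F y) (der F y w)) y z =
    der (omega ^~ (der F y w)) (F y) (der F y z) + omega (F y) (der (der F ^~ w) y z).
  by rewrite der_omega_along //; exact: sd.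
rewrite {1 3}/nab !N !O (derC oA u v sW Ay) (derC oA u v sF Ay) /riemann_mx.
rewrite /nab !mulmxDl !mulmxDr !mulmxN !mulmxA.
set a1 := der _ y v; set a2 := _ *m _; set a3 := _ *m _; set a4 := _ *m _.
set a5 := _ *m _; set a6 := _ *m _ *m _; set b2 := W y *m der _ _ _.
set b6 := W y *m _ *m _; clearbody a1 a2 a3 a4 a5 a6 b2 b6.
by apply/rowP => i; rewrite !mxE; ring.
Qed.

Lemma smooth_dmap w : smooth_on A (fun y => der F y w).
Proof. by apply: (smooth_der oA (X := fun=> w)) => //; exact: smooth_cst. Qed.

Lemma smooth_nab_dmap u v : smooth_on A (fun y => nab F (fun y => der F y v) y u).
Proof.
apply: (smooth_nab (X := fun=> u)); first exact: smooth_dmap.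
exact: smooth_cst.
Qed.

(** Christoffel symbols of the first kind of the pulled back metric *)
Lemma nab_dmap_low u v w y : A y ->
  form (h (F y)) (nab F (fun y => der F y v) y u) (der F y w) =
  2^-1 * (der (fun y => form (h (F y)) (der F y v) (der F y w)) y u
          + der (fun y => form (h (F y)) (der F y u) (der F y w)) y v
          - der (fun y => form (h (F y)) (der F y u) (der F y v)) y w).
Proof.
move=> Ay; have sd := smooth_dmap; have hs := hsym (AB Ay).
rewrite !(nab_metric (Y := fun y => der F y _) (Z := fun y => der F y _)) //.
rewrite (nab_torsion u v Ay) (nab_torsion u w Ay) (nab_torsion v w Ay).
rewrite [form _ (der F y v) (nab _ _ _ _)]formC //.
rewrite [form _ (der F y u) (nab _ _ _ _)]formC //.
by field.
Qed.

(** Metric compatibility takes the outer derivative out of the pairing. By [nab_dmap_low] the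
    derivative terms depend on the pulled back metric only, hence are the same for a submanifold and
    its ambient space; the quadratic terms carry the second fundamental form. *)
Lemma Rm_dmap_low u v w x y : A y ->
  form (h (F y)) (Rm (F y) (der F y u) (der F y v) (der F y w)) (der F y x) =
  der (fun y => form (h (F y)) (nab F (fun y => der F y w) y v) (der F y x)) y u
  - form (h (F y)) (nab F (fun y => der F y w) y v) (nab F (fun y => der F y x) y u)
  - (der (fun y => form (h (F y)) (nab F (fun y => der F y w) y u) (der F y x)) y v
  - form (h (F y)) (nab F (fun y => der F y w) y u) (nab F (fun y => der F y x) y v)).
Proof.
move=> Ay; have sd := smooth_dmap; have sn := smooth_nab_dmap.
rewrite -(nab_curv u v (sd w) Ay) formBl.
rewrite (nab_metric (Y := fun y => nab F _ y v) (Z := fun y => der F y x)) //.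
rewrite (nab_metric (Y := fun y => nab F _ y u) (Z := fun y => der F y x)) //.
ring.
Qed.

End Along.

Lemma nab_id W x v : nab id W x v = der W x v + Gam x v (W x).
Proof. by rewrite /nab der_id. Qed.

Lemma nab_cst w x v : nab id (fun=> w) x v = Gam x v w.
Proof. by rewrite nab_id der_cst add0r. Qed.

Lemma nab_dirD W x u v : differentiable W x ->
  nab id W x (u + v) = nab id W x u + nab id W x v.
Proof. by move=> dW; rewrite !nab_id der_dirD // /Gam omegaD mulmxDr addrACA. Qed.

Lemma nab_dirN W x v : differentiable W x -> nab id W x (- v) = - nab id W x v.
Proof. by move=> dW; rewrite !nab_id der_dirN // /Gam omegaN mulmxN opprD. Qed.

Lemma nab_dirB W x u v : differentiable W x ->
  nab id W x (u - v) = nab id W x u - nab id W x v.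
Proof. by move=> dW; rewrite nab_dirD // nab_dirN. Qed.

Let idB (x : 'rV[R]_n) : B x -> B (id x). Proof. by []. Qed.
Let sid : smooth_on B (id : 'rV[R]_n -> 'rV[R]_n). Proof. exact: smooth_id. Qed.
Let scst (c : 'rV[R]_n) : smooth_on B (fun _ : 'rV[R]_n => c).
Proof. exact: smooth_cst. Qed.

Lemma smooth_nab_id W X : smooth_on B W -> smooth_on B X ->
  smooth_on B (fun x => nab id W x (X x)).
Proof. exact: (smooth_nab oB idB sid). Qed.

Lemma nab_metric_id Y Z x v : smooth_on B Y -> smooth_on B Z -> B x ->
  der (fun x => form (h x) (Y x) (Z x)) x v =
  form (h x) (nab id Y x v) (Z x) + form (h x) (Y x) (nab id Z x v).
Proof. exact: (nab_metric oB idB sid). Qed.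

Lemma nab_curv_id W u v x : smooth_on B W -> B x ->
  nab id (fun x => nab id W x v) x u - nab id (fun x => nab id W x u) x v =
  Rm x u v (W x).
Proof.
by move=> sW Bx; rewrite (nab_curv oB idB sid) // !der_id.
Qed.

Lemma nab_dir_field W Y x v : smooth_on B W -> smooth_on B Y -> B x ->
  nab id (fun z => nab id W z (Y z)) x v =
  nab id (fun z => nab id W z (Y x)) x v + nab id W x (der Y x v).
Proof.
move=> sW sY Bx.
have D X : smooth_on B X -> der (fun z => nab id W z (X z)) x v =
    der (fun z => der W z (X z)) x v + der W x v *m omega x (X x) +
    W x *m der (fun z => omega z (X z)) x v.
  move=> sX; have sO : smooth_on B (fun z => omega z (X z)).
    exact: (smooth_omega oB idB).
  transitivity (der (fun z => der W z (X z) + W z *m omega z (X z)) x v).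
    by congr der; apply/funext => z; exact: nab_id.
  rewrite derD; last 2 first.
  - by apply: (smooth_diff _ Bx); apply: smooth_der.
  - by apply: (smooth_diff _ Bx); apply: smooth_mulmx.
  by rewrite der_mulmx ?addrA //; [exact: smooth_diff sW Bx|exact: smooth_diff sO Bx].
have /= DYx := D _ (scst (Y x)); rewrite 2![in LHS]nab_id [in LHS](D Y sY).
rewrite 3![in RHS]nab_id [in RHS]DYx.
rewrite (der_der_field oB v sW sY Bx) (der_omega_along idB sid v sY Bx) der_id.
rewrite mulmxDr /Gam; set a := _ *m _; set b := _ *m _; set c := _ *m _.
set d := _ *m _; set e := der _ _ _; set f := der _ _ _.
by clearbody a b c d e f; apply/rowP => i; rewrite !mxE; ring.
Qed.

Lemma Rm_low u v w z x : B x ->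
  form (h x) (Rm x u v w) z =
  der (fun x => form (h x) (Gam x v w) z) x u
  - form (h x) (Gam x v w) (Gam x u z)
  - (der (fun x => form (h x) (Gam x u w) z) x v
  - form (h x) (Gam x u w) (Gam x v z)).
Proof.
move=> Bx; have sd c : (fun x : 'rV[R]_n => der id x c) = (fun=> c).
  by apply/funext => y; rewrite der_id.
have NC c d : (fun y => nab id (fun=> c) y d) = (fun y => Gam y d c).
  by apply/funext => y; rewrite nab_cst.
have := Rm_dmap_low oB idB sid u v w z Bx.
rewrite !sd !der_id !nab_cst => ->.
by congr (der _ x u - _ - (der _ x v - _)); apply/funext => y; rewrite nab_cst der_id.
Qed.

Definition bracket (X Y : 'rV[R]_n -> 'rV[R]_n) x := der Y x (X x) - der X x (Y x).

Lemma nab_curv_fields X Y W x :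
  smooth_on B X -> smooth_on B Y -> smooth_on B W -> B x ->
  nab id (fun z => nab id W z (Y z)) x (X x)
  - nab id (fun z => nab id W z (X z)) x (Y x) - nab id W x (bracket X Y x) =
  Rm x (X x) (Y x) (W x).
Proof.
move=> sX sY sW Bx; rewrite nab_dir_field // (@nab_dir_field _ X) // nab_dirB;
  last exact: smooth_diff sW Bx.
rewrite -nab_curv_id //.
set a := nab _ _ _ _; set b := nab _ _ _ _; set c := nab _ _ _ _.
set d := nab _ _ _ _; clearbody a b c d.
by apply/rowP => i; rewrite !mxE; ring.
Qed.

Lemma Rm_antisym12 x u v w : B x -> Rm x u v w = - Rm x v u w.
Proof.
move=> Bx; rewrite !RmE // -mulmxN; congr (_ *m _); rewrite /riemann_mx.
set a := der _ _ _; set b := der _ _ _; set c := _ *m _; set d := _ *m _.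
by clearbody a b c d; apply/matrixP => i j; rewrite !mxE; ring.
Qed.

Lemma nab_torsion_fields X Y x : smooth_on B X -> smooth_on B Y -> B x ->
  nab id Y x (X x) - nab id X x (Y x) = bracket X Y x.
Proof.
move=> sX sY Bx; rewrite !nab_id (GamC (Y x)) // /bracket.
by rewrite opprD addrACA subrr addr0.
Qed.

Lemma nab_ext W X x v : (forall z, B z -> W z = X z) -> B x ->
  nab id W x v = nab id X x v.
Proof.
by move=> WX Bx; rewrite !nab_id (WX x Bx) (der_open_ext _ oB WX Bx).
Qed.

Lemma koszul X Y Z x : smooth_on B X -> smooth_on B Y -> smooth_on B Z -> B x ->
  form (h x) (nab id Y x (X x)) (Z x) =
  2^-1 * (der (fun x => form (h x) (Y x) (Z x)) x (X x)
          + der (fun x => form (h x) (X x) (Z x)) x (Y x)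
          - der (fun x => form (h x) (X x) (Y x)) x (Z x)
          + form (h x) (bracket X Y x) (Z x) - form (h x) (bracket X Z x) (Y x)
          - form (h x) (bracket Y Z x) (X x)).
Proof.
move=> sX sY sZ Bx; rewrite !nab_metric_id // -!nab_torsion_fields // !formBl.
rewrite [form _ (Y x) (nab _ _ _ (X x))]formC ?hsym //.
rewrite [form _ (X x) (nab _ _ _ (Y x))]formC ?hsym //.
rewrite [form _ (X x) (nab _ _ _ (Z x))]formC ?hsym //.
by field.
Qed.

(** Second derivatives of the function <w, z>, for constant [w] and [z], commute. Expanding both
    orders by metric compatibility, the mixed products cancel and <R(u, v)w, z> + <w, R(u, v)z> = 0
    remains. *)
Lemma Rm_antisym34 x u v w z : B x ->
  form (h x) (Rm x u v w) z = - form (h x) (Rm x u v z) w.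
Proof.
move=> Bx.
have sn a c : smooth_on B (fun y => nab id (fun=> c) y a).
  exact: (smooth_nab_id (scst c) (scst a)).
have sF a b : smooth_on B a -> smooth_on B b -> smooth_on B (fun y => form (h y) (a y) (b y)).
  move=> sa sb; apply: smooth_entry => //; apply: smooth_mulmx => //.
    exact: smooth_mulmx.
  exact: smooth_trmx.
have N a b : der (fun y => der (fun y => form (h y) w z) y a) x b =
    form (h x) (nab id (fun y => nab id (fun=> w) y a) x b) z +
    form (h x) (nab id (fun=> w) x a) (nab id (fun=> z) x b) +
    (form (h x) (nab id (fun=> w) x b) (nab id (fun=> z) x a) +
    form (h x) w (nab id (fun y => nab id (fun=> z) y a) x b)).
  rewrite (@der_open_ext _ _ _ B _ (fun y => form (h y) (nab id (fun=> w) y a) z +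
    form (h y) w (nab id (fun=> z) y a))) //; last first.
    by move=> y By; rewrite (nab_metric_id (Y := fun=> w) (Z := fun=> z)).
  rewrite derD; last 2 first.
  - by apply: (smooth_diff _ Bx); exact: sF.
  - by apply: (smooth_diff _ Bx); exact: (sF (fun=> w)).
  by rewrite (nab_metric_id (Z := fun=> z)) // (nab_metric_id (Y := fun=> w)).
have := derC_scalar oB u v (sF _ _ (scst w) (scst z)) Bx; rewrite !N.
rewrite -(nab_curv_id u v (scst w) Bx) -(nab_curv_id u v (scst z) Bx).
rewrite formBl [form _ (_ - _) w]formC ?hsym // formBr.
set a := form _ _ _; set b := form _ _ _; set c := form _ _ _; set d := form _ _ _.
by set e := form _ _ _; set f := form _ _ _; move=> E; lra.
Qed.

(** For constant fields R(a, b)c is the difference of the derivatives of Gam(b, c) along [a] and of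
    Gam(a, c) along [b]. As [Gam] is symmetric, the cyclic sum telescopes. *)
Lemma bianchi x u v w : B x -> Rm x u v w + Rm x v w u + Rm x w u v = 0.
Proof.
move=> Bx.
have E a b c : Rm x a b c = nab id (fun y => Gam y b c) x a -
    nab id (fun y => Gam y a c) x b.
  have NC d : (fun y => nab id (fun=> c) y d) = (fun y => Gam y d c).
    by apply/funext => y; rewrite nab_cst.
  by have := nab_curv_id a b (scst c) Bx; rewrite !NC => <-.
have S a b c : nab id (fun y => Gam y b c) x a = nab id (fun y => Gam y c b) x a.
  rewrite !nab_id (GamC b c Bx); congr (_ + _).
  by apply: (der_open_ext _ oB) => // y; exact: GamC.
rewrite !E (S v u) (S w v) (S u w).
set a := nab _ _ _ _; set b := nab _ _ _ _; set c := nab _ _ _ _.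
by rewrite subrKA subrKA subrr.
Qed.

End MetricTheory.

(** * Gauss equation for a pulled back metric *)

Section Gauss.
Context {R : realType} {k n : nat} (A : set 'rV[R]_k) (B : set 'rV[R]_n).
Context (F : 'rV[R]_k -> 'rV[R]_n) (h : 'rV[R]_n -> 'M[R]_n).
Hypotheses (oA : open A) (AB : forall y, A y -> B (F y)) (sF : smooth_on A F).
Hypotheses (hm : metric_on B h) (pm : metric_on A (pullback F h)).

Lemma form_pullback y u v : A y ->
  form (pullback F h y) u v = form (h (F y)) (der F y u) (der F y v).
Proof.
move=> Ay; have dF := smooth_diff sF Ay.
by rewrite !der_jacobian // form_mulmx.
Qed.

(** The tangential part of the ambient derivative is the intrinsic connection: both sides are the
    same Koszul expression in the pulled back metric. *)
Lemma nab_dmap_pullback u v w y : A y ->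
  form (h (F y)) (nab h F (fun y => der F y v) y u) (der F y w) =
  form (pullback F h y) (Gam (pullback F h) y u v) w.
Proof.
move=> Ay; rewrite (nab_dmap_low hm oA AB sF) // (Gam_low pm) //.
have E a b c : form (der (pullback F h) y a) b c =
    der (fun y => form (h (F y)) (der F y b) (der F y c)) y a.
  rewrite -(der_open_ext a oA (fun y Ay => form_pullback b c Ay) Ay).
  case: pm => _ sp _ _; rewrite der_form; last 3 first.
  - exact: smooth_diff sp Ay.
  - exact: differentiable_cst.
  - exact: differentiable_cst.
  by rewrite !der_cst form0l form0r !addr0.
by rewrite !E.
Qed.

(** No normal field occurs: each parenthesised difference is the inner product of the normal parts
    of two covariant derivatives, the intrinsic term subtracting the tangential parts. *)
Lemma gauss_equation u v w x y : A y ->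
  form (pullback F h y) (Rm (pullback F h) y u v w) x =
  form (h (F y)) (Rm h (F y) (der F y u) (der F y v) (der F y w)) (der F y x)
  + (form (h (F y)) (nab h F (fun y => der F y w) y v) (nab h F (fun y => der F y x) y u)
  - form (pullback F h y) (Gam (pullback F h) y v w) (Gam (pullback F h) y u x))
  - (form (h (F y)) (nab h F (fun y => der F y w) y u) (nab h F (fun y => der F y x) y v)
  - form (pullback F h y) (Gam (pullback F h) y u w) (Gam (pullback F h) y v x)).
Proof.
move=> Ay; rewrite (Rm_low pm) // (Rm_dmap_low hm oA AB sF) //.
have E a b c d :
  der (fun y => form (h (F y)) (nab h F (fun y => der F y b) y a) (der F y c)) y d =
  der (fun y => form (pullback F h y) (Gam (pullback F h) y a b) c) y d.
  by apply: (der_open_ext _ oA) => // z Az; exact: nab_dmap_pullback.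
by rewrite !E; ring.
Qed.

End Gauss.

(** * The metric of the tangent bundle *)

Lemma unitmx_inj {R : fieldType} n (A : 'M[R]_n) :
  (forall u : 'rV_n, u *m A = 0 -> u = 0) -> A \in unitmx.
Proof.
move=> A0; rewrite -row_free_unit -kermx_eq0; apply/eqP/row_matrixP => i.
by rewrite row0; apply: A0; rewrite -row_mul mulmx_ker row0.
Qed.

Section TangentMetric.
Context {R : realType} {m : nat} (B : set 'rV[R]_m) (g : 'rV[R]_m -> 'M[R]_m).
Hypothesis gm : metric_on B g.
Context (f1 f2 : R).
Hypotheses (f1_gt0 : 0 < f1) (f2_gt0 : 0 < f2).

Let oB : open B. Proof. by case: gm. Qed.
Let sg : smooth_on B g. Proof. by case: gm. Qed.
Let gsym x : B x -> (g x)^T = g x. Proof. by case: gm => _ _ + _; apply. Qed.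
Let gunit x : B x -> g x \in unitmx. Proof. by case: gm => _ _ _; apply. Qed.

Definition bundle_set : set 'rV[R]_(m + m) := [set z | B (lsubmx z)].
Local Notation T := bundle_set.

Definition bundle_metric (z : 'rV[R]_(m + m)) : 'M[R]_(m + m) :=
  f1 *: (dpi_mx *m g (lsubmx z) *m dpi_mx^T)
  + f2 *: (vert_mx g z *m g (lsubmx z) *m (vert_mx g z)^T).
Local Notation G := bundle_metric.

(** The connection map of the Levi-Civita connection, as a function; [mul_vert] identifies it with
    multiplication by [vert_mx]. *)
Definition vpr (z W : 'rV[R]_(m + m)) : 'rV[R]_m :=
  rsubmx W + Gam g (lsubmx z) (lsubmx W) (rsubmx z).

(** Lift of a field with constant components in the chart. Such fields commute on the base, so
    brackets of the lifts show only the connection and the curvature. *)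
Definition hlift (X : 'rV[R]_m) (z : 'rV[R]_(m + m)) : 'rV[R]_(m + m) :=
  row_mx X (- Gam g (lsubmx z) X (rsubmx z)).

Definition vlift (X : 'rV[R]_m) : 'rV[R]_(m + m) := row_mx 0 X.

Lemma mul_dpi (W : 'rV[R]_(m + m)) : W *m dpi_mx = lsubmx W.
Proof.
by rewrite -{1}(hsubmxK W) /dpi_mx mul_row_col mulmx1 mulmx0 addr0.
Qed.

Lemma mul_vert z W : W *m vert_mx g z = vpr z W.
Proof.
rewrite -{1}(hsubmxK W) /vert_mx mul_row_col mulmx1 addrC /vpr; congr (_ + _).
apply/rowP => k; rewrite /Gam /omega mulmx_sumr mxE summxE.
apply: eq_bigr => i _; rewrite !mxE mulr_sumr; apply: eq_bigr => j _.
by rewrite !mxE; ring.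
Qed.

Lemma form_bundle z W W' : form (G z) W W' =
  f1 * form (g (lsubmx z)) (lsubmx W) (lsubmx W') +
  f2 * form (g (lsubmx z)) (vpr z W) (vpr z W').
Proof.
by rewrite formD !formZ -!form_mulmx !mul_dpi !mul_vert.
Qed.

Lemma hlift_l X z : lsubmx (hlift X z) = X. Proof. by rewrite row_mxKl. Qed.
Lemma vlift_l X : lsubmx (vlift X) = 0. Proof. by rewrite row_mxKl. Qed.
Lemma vlift_r X : rsubmx (vlift X) = X. Proof. by rewrite row_mxKr. Qed.

Lemma hlift_v X z : vpr z (hlift X z) = 0.
Proof. by rewrite /vpr hlift_l row_mxKr addNr. Qed.

Lemma vlift_v X z : vpr z (vlift X) = X.
Proof. by rewrite /vpr vlift_l vlift_r /Gam omega0 mulmx0 addr0. Qed.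

Lemma lift_decomp z W : W = hlift (lsubmx W) z + vlift (vpr z W).
Proof.
rewrite /hlift /vlift add_row_mx addr0 /vpr addrCA addNr addr0.
by rewrite hsubmxK.
Qed.

Lemma vliftD X Y : vlift (X + Y) = vlift X + vlift Y.
Proof. by rewrite /vlift add_row_mx addr0. Qed.

Lemma vliftN X : vlift (- X) = - vlift X.
Proof. by rewrite /vlift opp_row_mx oppr0. Qed.

Lemma vlift0 : vlift 0 = 0. Proof. exact: row_mx0. Qed.

Lemma form_hh z X Y : form (G z) (hlift X z) (hlift Y z) = f1 * form (g (lsubmx z)) X Y.
Proof. by rewrite form_bundle !hlift_l !hlift_v form0l mulr0 addr0. Qed.

Lemma form_hv z X Y : form (G z) (hlift X z) (vlift Y) = 0.
Proof. by rewrite form_bundle hlift_v vlift_l form0l form0r !mulr0 addr0. Qed.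

Lemma form_vh z X Y : form (G z) (vlift X) (hlift Y z) = 0.
Proof. by rewrite form_bundle hlift_v vlift_l form0l form0r !mulr0 addr0. Qed.

Lemma form_vv z X Y : form (G z) (vlift X) (vlift Y) = f2 * form (g (lsubmx z)) X Y.
Proof. by rewrite form_bundle !vlift_l !vlift_v form0l mulr0 add0r. Qed.

Lemma form_Wh z W Y : form (G z) W (hlift Y z) = f1 * form (g (lsubmx z)) (lsubmx W) Y.
Proof. by rewrite form_bundle hlift_l hlift_v form0r mulr0 addr0. Qed.

Lemma form_Wv z W Y : form (G z) W (vlift Y) = f2 * form (g (lsubmx z)) (vpr z W) Y.
Proof. by rewrite form_bundle vlift_l vlift_v form0r mulr0 add0r. Qed.

Let f1n0 : f1 != 0. Proof. exact: lt0r_neq0. Qed.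
Let f2n0 : f2 != 0. Proof. exact: lt0r_neq0. Qed.

Lemma bundle_ext z W W' : T z ->
  (forall Y, form (G z) W (hlift Y z) = form (G z) W' (hlift Y z)) ->
  (forall Y, form (G z) W (vlift Y) = form (G z) W' (vlift Y)) -> W = W'.
Proof.
move=> Tz Eh Ev; rewrite (lift_decomp z W) (lift_decomp z W').
congr (hlift _ z + vlift _); apply: (form_nondeg (gunit Tz)) => Y.
  by have := Eh Y; rewrite !form_Wh => /(mulfI f1n0).
by have := Ev Y; rewrite !form_Wv => /(mulfI f2n0).
Qed.

Lemma open_bundle_set : open T.
Proof.
have -> : T = lsubmx @^-1` B by [].
by apply: open_comp => // z _; exact: continuous_lsubmx.
Qed.
Let oT := open_bundle_set.

Lemma smooth_lsubmx : smooth_on T (fun z : 'rV[R]_(m + m) => lsubmx z).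
Proof.
apply: (smooth_mxE oT (g := fun a b z => z 0 (lshift m b))) => [z a b|a b].
  by rewrite mxE (ord1 a).
exact: smooth_coord.
Qed.
Let sl := smooth_lsubmx.

Lemma smooth_rsubmx : smooth_on T (fun z : 'rV[R]_(m + m) => rsubmx z).
Proof.
apply: (smooth_mxE oT (g := fun a b z => z 0 (rshift m b))) => [z a b|a b].
  by rewrite mxE (ord1 a).
exact: smooth_coord.
Qed.
Let sr := smooth_rsubmx.

Let lT z : T z -> B (lsubmx z). Proof. by []. Qed.

Lemma smooth_gl : smooth_on T (fun z => g (lsubmx z)).
Proof. exact: smooth_comp sl sg. Qed.

Lemma smooth_Gaml X : smooth_on T (fun z => Gam g (lsubmx z) X (rsubmx z)).
Proof.
apply: smooth_mulmx => //; apply: (smooth_omega gm (X := fun=> X)) => //.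
exact: smooth_cst.
Qed.

Lemma smooth_hlift X : smooth_on T (hlift X).
Proof.
apply: smooth_row_mx => //; first exact: smooth_cst.
by apply: smoothN => //; exact: smooth_Gaml.
Qed.

Lemma smooth_vlift X : smooth_on T (fun _ : 'rV[R]_(m + m) => vlift X).
Proof. exact: smooth_cst. Qed.

Lemma metric_on_bundle : metric_on T G.
Proof.
have svert : smooth_on T (vert_mx g).
  apply: smooth_col_mx => //; last exact: smooth_cst.
  apply: smooth_mx => // i k.
  apply: (@smooth_ext _ _ _ oT _ (fun z => Gam g (lsubmx z) (delta_mx 0 i) (rsubmx z) 0 k)).
    move=> z _; rewrite /Gam /omega (bigD1 i) //= big1 => [|j ji]; last first.
      by rewrite mxE eqxx (negbTE ji) scale0r.
    have -> : (delta_mx 0 i : 'rV[R]_m) 0 i = 1 by rewrite mxE !eqxx.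
    rewrite addr0 scale1r !mxE; apply: eq_bigr => j _.
    by rewrite !mxE mulrC.
  by apply: smooth_entry => //; exact: smooth_Gaml.
split=> // [|z Tz|z Tz].
- have sq (c : R) (P : 'rV[R]_(m + m) -> 'M[R]_(m + m, m)) : smooth_on T P ->
      smooth_on T (fun z => c *: (P z *m g (lsubmx z) *m (P z)^T)).
    move=> sP; apply: smoothZ => //; first exact: smooth_cst.
    apply: smooth_mulmx => //; last exact: smooth_trmx.
    by apply: smooth_mulmx => //; exact: smooth_gl.
  apply: smoothD => //; last exact: sq.
  by apply: (sq _ (fun=> dpi_mx)); exact: smooth_cst.
- by rewrite /G linearD !linearZ /= !trmx_mul !trmxK gsym // !mulmxA.
- apply: unitmx_inj => W W0.
  by apply: (bundle_ext Tz) => Y; rewrite form0l /form W0 mul0mx mxE.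
Qed.
Let Gm := metric_on_bundle.

Local Notation nabG := (nab G id).
Local Notation RmG := (Rm G).

Lemma der_gl z W : T z -> der (fun z => g (lsubmx z)) z W = der g (lsubmx z) (lsubmx W).
Proof.
move=> Tz; rewrite (der_comp W (smooth_diff sl Tz) (smooth_diff sg Tz)).
by rewrite (der_lsubmx _ (f := id)) // der_id.
Qed.

Lemma der_form_gl z W c X Y : T z ->
  der (fun z => c * form (g (lsubmx z)) X Y) z W =
  c * form (der g (lsubmx z) (lsubmx W)) X Y.
Proof.
move=> Tz.
rewrite (der_scale c W (f := fun z => form (g (lsubmx z)) X Y)); last first.
  apply: (smooth_diff _ Tz); apply: smooth_entry => //.
  apply: smooth_mulmx => //; last exact: smooth_cst.
  apply: smooth_mulmx => //; first exact: smooth_cst.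
  exact: smooth_gl.
rewrite (der_form W (smooth_diff smooth_gl Tz)) ?der_cst ?form0l ?form0r ?addr0;
  try exact: differentiable_cst.
by rewrite der_gl.
Qed.

Lemma der_hh z W X Y : T z -> der (fun z => form (G z) (hlift X z) (hlift Y z)) z W =
  f1 * form (der g (lsubmx z) (lsubmx W)) X Y.
Proof.
by move=> Tz; rewrite -der_form_gl //; congr der; apply/funext => y; exact: form_hh.
Qed.

Lemma der_vv z W X Y : T z -> der (fun z => form (G z) (vlift X) (vlift Y)) z W =
  f2 * form (der g (lsubmx z) (lsubmx W)) X Y.
Proof.
by move=> Tz; rewrite -der_form_gl //; congr der; apply/funext => y; exact: form_vv.
Qed.

Lemma der_hv z W X Y : der (fun z => form (G z) (hlift X z) (vlift Y)) z W = 0.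
Proof.
by rewrite -(der_cst (0 : R) z W); congr der; apply/funext => y; exact: form_hv.
Qed.

Lemma der_vh z W X Y : der (fun z => form (G z) (vlift X) (hlift Y z)) z W = 0.
Proof.
by rewrite -(der_cst (0 : R) z W); congr der; apply/funext => y; exact: form_vh.
Qed.

Lemma der_hlift z W X : T z -> der (hlift X) z W =
  - vlift (rsubmx W *m omega g (lsubmx z) X
           + rsubmx z *m der (omega g ^~ X) (lsubmx z) (lsubmx W)).
Proof.
move=> Tz; have sGX := smooth_Gaml X.
have so : smooth_on T (fun z => omega g (lsubmx z) X).
  by apply: (smooth_omega gm (X := fun=> X)) => //; exact: smooth_cst.
rewrite der_row_mx; last 2 first.
- exact: differentiable_cst.
- by apply: smooth_diff Tz; exact: smoothN.
rewrite der_cst derN; last exact: smooth_diff Tz.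
rewrite der_mulmx; [|exact: smooth_diff sr Tz|exact: smooth_diff so Tz].
rewrite (der_rsubmx _ (f := id)) // der_id.
rewrite (der_omega_along gm lT sl (X := fun=> X)) //; last exact: smooth_cst.
rewrite der_cst omega0 addr0 (der_lsubmx _ (f := id)) // der_id.
by rewrite /vlift opp_row_mx oppr0.
Qed.

Local Notation br := bracket.

Lemma bracket_hv z X Y : T z ->
  br (hlift X) (fun=> vlift Y) z = vlift (Gam g (lsubmx z) X Y).
Proof.
move=> Tz; rewrite /bracket der_cst der_hlift // vlift_l vlift_r der_dir0.
by rewrite mulmx0 addr0 opprK add0r.
Qed.

Lemma bracketC (X Y : 'rV[R]_(m + m) -> 'rV[R]_(m + m)) z : br X Y z = - br Y X z.
Proof. by rewrite /bracket opprB. Qed.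

Lemma bracket_vv z X Y : br (fun=> vlift X) (fun=> vlift Y) z = 0.
Proof. by rewrite /bracket !der_cst subrr. Qed.

(** Curvature is the obstruction to integrability of the horizontal bundle. There is no horizontal
    part, because [X] and [Y] have constant components. *)
Lemma bracket_hh z X Y : T z ->
  br (hlift X) (hlift Y) z = - vlift (Rm g (lsubmx z) X Y (rsubmx z)).
Proof.
move=> Tz; rewrite /bracket !der_hlift // !hlift_l !row_mxKr (RmE gm) //.
rewrite opprK -vliftN -vliftD -vliftN; congr vlift.
rewrite /riemann_mx /Gam !mulmxDr !mulmxN !mulNmx !mulmxA.
set a := _ *m _; set b := _ *m _; set c := _ *m _; set d := _ *m _.
by clearbody a b c d; apply/rowP => i; rewrite !mxE; ring.
Qed.

Let sh X := smooth_hlift X.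
Let sv X := smooth_vlift X.

(** The fibres are totally geodesic and flat. Against a horizontal lift, Koszul's formula reduces to
    the compatibility of [Gam] with [g]; against a vertical one, every term vanishes because G is
    constant along a fibre on vertical lifts. *)
Lemma nab_vv z X Y : T z -> nabG (fun=> vlift Y) z (vlift X) = 0.
Proof.
move=> Tz; apply: (bundle_ext Tz) => Z; rewrite form0l.
  rewrite (koszul Gm (X := fun=> vlift X) (Y := fun=> vlift Y) (sv X) (sv Y) (sh Z) Tz).
  rewrite !der_vh der_vv // hlift_l bracket_vv form0l !(bracketC _ (hlift Z)).
  rewrite !bracket_hv // !formNl !form_vv -(Gam_metric gm) //.
  by rewrite (formC X) ?gsym //; ring.
rewrite (koszul Gm (X := fun=> vlift X) (Y := fun=> vlift Y) (Z := fun=> vlift Z)) //.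
rewrite !der_vv // !vlift_l !bracket_vv !form0l !der_dir0 !form0.
ring.
Qed.

Lemma nab_hh z X Y : T z -> nabG (hlift Y) z (hlift X z) =
  hlift (Gam g (lsubmx z) X Y) z
  - vlift (2^-1 *: Rm g (lsubmx z) X Y (rsubmx z)).
Proof.
move=> Tz; apply: (bundle_ext Tz) => Z.
  rewrite (koszul Gm (sh X) (sh Y) (sh Z) Tz) !der_hh // !hlift_l.
  rewrite !bracket_hh // formBl form_hh form_vh (Gam_low gm) //.
  rewrite !formNl !form_vh; ring.
rewrite (koszul Gm (sh X) (sh Y) (sv Z) Tz) !der_hv der_hh // vlift_l der_dir0.
rewrite bracket_hh // !bracket_hv // !form_vh form0 formBl form_hv formNl !form_vv formZl.
ring.
Qed.

(** Differentiate the orthogonality of horizontal and vertical lifts along the fibre; the other term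
    vanishes by [nab_vv]. *)
Lemma vpr_nab_vh z X Y : T z -> vpr z (nabG (hlift Y) z (vlift X)) = 0.
Proof.
move=> Tz; apply: (form_nondeg (gunit Tz)) => Z; rewrite form0l.
apply: (mulfI f2n0); rewrite -form_Wv mulr0.
have := nab_metric_id Gm (vlift X) (sh Y) (sv Z) Tz.
by rewrite der_hv nab_vv // form0r addr0 => <-.
Qed.

(** Left as a pairing, since a closed form would need the adjoint of the curvature. Torsion-freeness
    exchanges the two lifts up to a vertical bracket; metric compatibility then moves the derivative
    onto the lift of [Z], where [nab_hh] applies. *)
Lemma nab_vh_l z X Y Z : T z ->
  f1 * form (g (lsubmx z)) (lsubmx (nabG (hlift Y) z (vlift X))) Z =
  2^-1 * f2 * form (g (lsubmx z)) X (Rm g (lsubmx z) Y Z (rsubmx z)).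
Proof.
move=> Tz; rewrite -form_Wh.
have := nab_torsion_fields Gm (sv X) (sh Y) Tz; rewrite bracketC bracket_hv //.
move/eqP; rewrite subr_eq => /eqP ->; rewrite formDl formNl form_vh oppr0 add0r.
have := nab_metric_id Gm (hlift Y z) (sv X) (sh Z) Tz.
rewrite der_vh nab_hh // formBr form_vh form_vv formZr => /eqP.
by rewrite eq_sym addr_eq0 => /eqP ->; ring.
Qed.

(** * The Euler field and the curvatures of TM *)

Definition euler (z : 'rV[R]_(m + m)) : 'rV[R]_(m + m) := vlift (rsubmx z).

Lemma smooth_euler : smooth_on T euler.
Proof. by apply: smooth_row_mx => //; exact: smooth_cst. Qed.
Let sU := smooth_euler.

Lemma der_euler z W : T z -> der euler z W = vlift (rsubmx W).
Proof.
move=> Tz; rewrite der_row_mx; last 2 first.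
- exact: differentiable_cst.
- exact: smooth_diff sr Tz.
by rewrite der_cst (der_rsubmx _ (f := id)) // der_id.
Qed.

(** By [nab_vh_l] the horizontal part is governed by the product of v with R(X, Z)v, which is 0 by
    skewness. *)
Lemma nab_h_euler z X : T z -> nabG (hlift X) z (euler z) = 0.
Proof.
move=> Tz; apply: (bundle_ext Tz) => Z; rewrite form0l.
  rewrite form_Wh nab_vh_l // formC ?gsym //.
  have := Rm_antisym34 gm X Z (rsubmx z) (rsubmx z) Tz.
  set a := form _ _ _ => a_eq; have -> : a = 0 by lra.
  by rewrite mulr0.
by rewrite form_Wv vpr_nab_vh // form0l mulr0.
Qed.

Lemma nab_euler z W : T z -> nabG euler z W = vlift (vpr z W).
Proof.
move=> Tz; have dU := smooth_diff sU Tz.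
(* Splits off the variation of U. The rest differentiates the constant field with the value U(z), a
   vertical lift, to which the formulas for lifts apply. *)
have E V : nabG euler z V = vlift (rsubmx V) + nabG (fun=> euler z) z V.
  by rewrite nab_id der_euler // nab_cst.
rewrite {1}(lift_decomp z W) nab_dirD // [X in _ + X]E nab_vv // addr0 vlift_r.
(* Horizontal direction: by torsion-freeness the derivative of the vertical lift is the bracket
   alone, and this cancels the variation of U along the horizontal lift. *)
have := nab_torsion_fields Gm (sh (lsubmx W)) (sv (rsubmx z)) Tz.
rewrite [nab _ _ (hlift _) _ _]nab_h_euler // subr0 bracket_hv // => EX.
by rewrite E EX -vliftD row_mxKr addNr vlift0 add0r.
Qed.

Lemma nab_zero z W : nabG (fun=> 0) z W = 0.
Proof. by rewrite nab_cst /Gam mul0mx. Qed.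

Lemma RmDl (n : nat) (h : 'rV[R]_n -> 'M[R]_n) x a b c d :
  Rm h x (a + b) c d = Rm h x a c d + Rm h x b c d.
Proof. by rewrite -!mul_curv_mx mulmxDl. Qed.

Lemma Rm_euler z W : T z -> RmG z W (euler z) (euler z) = 0.
Proof.
move=> Tz; have EE y : T y -> nabG euler y (euler y) = euler y.
  by move=> Ty; rewrite nab_euler // vlift_v.
have nab0 : nabG euler z 0 = 0.
  by rewrite nab_id der_dir0 add0r /Gam omega0 mulmx0.
(* The two kinds of lifts are treated separately. The derivative of U along X^h is 0, along Y^v it
   is Y^v, and both are parallel along U. X^h commutes with U; for Y^v the surviving term Y^v is
   cancelled by the bracket [Y^v, U] = Y^v. *)
rewrite {1}(lift_decomp z W) RmDl; move: (lsubmx W) (vpr z W) => X Y.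
rewrite -(nab_curv_fields Gm (sh X) sU sU Tz) -(nab_curv_fields Gm (sv Y) sU sU Tz).
have -> : nabG (fun y => nabG euler y (hlift X y)) z (euler z) = 0.
  rewrite -(nab_zero z (euler z)); apply: (nab_ext Gm _ _ Tz) => y Ty.
  by rewrite (nab_euler _ Ty) hlift_v vlift0.
have -> : nabG (fun y => nabG euler y (vlift Y)) z (euler z) = 0.
  rewrite -(nab_vv (rsubmx z) Y Tz); apply: (nab_ext Gm _ _ Tz) => y Ty.
  by rewrite (nab_euler _ Ty) vlift_v.
rewrite !(nab_ext Gm _ EE Tz) -(nab_torsion_fields Gm (sh X) sU Tz) nab_h_euler //.
rewrite [nabG _ _ (hlift _ _)]nab_euler // hlift_v vlift0 !subr0 nab0 //.
by rewrite /bracket der_cst der_euler // vlift_r !subr0 subrr addr0.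
Qed.

Lemma Rm_vvv z X Y Z : T z -> RmG z (vlift X) (vlift Y) (vlift Z) = 0.
Proof.
move=> Tz; rewrite -(nab_curv_fields Gm (sv X) (sv Y) (sv Z) Tz).
rewrite bracket_vv (nab_ext Gm (X := fun=> 0)) //; last by move=> y Ty; exact: nab_vv.
rewrite [X in _ - X - _](nab_ext Gm (X := fun=> 0)) //; last by move=> y Ty; exact: nab_vv.
by rewrite !nab_zero nab_cst /Gam omega0 mulmx0 !subr0.
Qed.

Lemma Rm_self x X w : B x -> Rm g x X X w = 0.
Proof.
move=> Bx; have /eqP := Rm_antisym12 gm X X w Bx; rewrite -subr_eq0 opprK.
by rewrite -mulr2n -scaler_nat scaler_eq0 pnatr_eq0 /= => /eqP.
Qed.

(** Only -<D_Y D_X Y, X> survives, D being the connection of G. Since <D_X Y, X> vanishes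
    identically, it equals <D_X Y, D_Y X>; the two vectors differ by a vertical bracket while D_Y X
    is horizontal. As a squared length, the mixed curvature is nonnegative. *)
Lemma Rm_hvvh z X Y : T z ->
  form (G z) (RmG z (hlift X z) (vlift Y) (vlift Y)) (hlift X z) =
  form (G z) (nabG (hlift X) z (vlift Y)) (nabG (hlift X) z (vlift Y)).
Proof.
move=> Tz; rewrite -(nab_curv_fields Gm (sh X) (sv Y) (sv Y) Tz).
rewrite bracket_hv // nab_vv // subr0.
rewrite (nab_ext Gm (W := fun y => nabG _ y (vlift Y)) (X := fun=> 0)) //;
  last by move=> y Ty; exact: nab_vv.
have sN : smooth_on T (fun y => nabG (fun=> vlift Y) y (hlift X y)).
  exact: (smooth_nab_id Gm).
have N0 y : T y -> form (G y) (nabG (fun=> vlift Y) y (hlift X y)) (hlift X y) = 0.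
  move=> Ty; have := nab_metric_id Gm (hlift X y) (sv Y) (sh X) Ty.
  rewrite der_vh nab_hh // Rm_self // scaler0 vlift0 subr0 form_vh addr0.
  by move=> <-.
have := nab_metric_id Gm (vlift Y) sN (sh X) Tz.
rewrite (der_open_ext (vlift Y) oT N0 Tz) der_cst => /eqP.
rewrite eq_sym addr_eq0 => /eqP E.
rewrite nab_zero sub0r formNl E opprK.
have := nab_torsion_fields Gm (sh X) (sv Y) Tz; rewrite bracket_hv // => /eqP.
rewrite subr_eq => /eqP ->; rewrite formDl formC; last by case: Gm => _ _ + _; apply.
by rewrite form_Wv vpr_nab_vh // form0l mulr0 add0r.
Qed.

(** The coefficient 3/4 is 1/4 + 1/2: the product of the vertical parts of the two mixed derivatives
    in [nab_hh], and the bracket term, evaluated by [nab_vh_l]. *)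
Lemma Rm_hhhh z X Y : T z ->
  form (G z) (RmG z (hlift X z) (hlift Y z) (hlift Y z)) (hlift X z) =
  f1 * form (g (lsubmx z)) (Rm g (lsubmx z) X Y Y) X
  - 3 / 4 * f2 * form (g (lsubmx z)) (Rm g (lsubmx z) X Y (rsubmx z))
                     (Rm g (lsubmx z) X Y (rsubmx z)).
Proof.
move=> Tz; rewrite -(nab_curv_fields Gm (sh X) (sh Y) (sh Y) Tz) !formBl.
have Bx := Tz; set x := lsubmx z.
(* Moves the outer derivative out of the pairing. The function to be differentiated depends on the
   base point only, so it becomes a derivative on the base and matches [Rm_low]. *)
have D A C D : T z ->
  form (G z) (nabG (fun y => nabG (hlift C) y (hlift A y)) z (hlift D z)) (hlift X z) =
   f1 * der (fun x => form (g x) (Gam g x A C) X) x D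
   - form (G z) (nabG (hlift C) z (hlift A z)) (nabG (hlift X) z (hlift D z)).
  move=> _; have sN : smooth_on T (fun y => nabG (hlift C) y (hlift A y)).
    exact: (smooth_nab_id Gm).
  apply/eqP; rewrite -subr_eq opprK -(nab_metric_id Gm _ sN (sh X) Tz); apply/eqP.
  have sGf : smooth_on B (fun x => form (g x) (Gam g x A C) X).
    apply: smooth_entry => //; apply: smooth_mulmx => //; last exact: smooth_cst.
    apply: smooth_mulmx => //; apply: smooth_mulmx => //; first exact: smooth_cst.
    apply: (smooth_omega gm (F := id) (X := fun=> A)) => //; last exact: smooth_cst.
    exact: smooth_id.
  have sGl : smooth_on T (fun z => form (g (lsubmx z)) (Gam g (lsubmx z) A C) X).
    apply: smooth_entry => //; apply: smooth_mulmx => //; last exact: smooth_cst.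
    apply: smooth_mulmx => //; last exact: smooth_gl.
    apply: smooth_mulmx => //; first exact: smooth_cst.
    apply: (smooth_omega gm (X := fun=> A)) => //; exact: smooth_cst.
  transitivity (der (fun z => f1 * form (g (lsubmx z)) (Gam g (lsubmx z) A C) X)
    z (hlift D z)).
    apply: (der_open_ext _ oT) => // y Ty.
    by rewrite nab_hh // formBl form_hh form_vh subr0.
  rewrite (der_scale _ _ (smooth_diff sGl Tz)).
  rewrite (der_comp _ (f := fun x => form (g x) (Gam g x A C) X) (smooth_diff sl Tz)) //;
    last exact: smooth_diff sGf Bx.
  by rewrite (der_lsubmx _ (f := id)) // der_id hlift_l.
rewrite !D // bracket_hh // nab_dirN; last exact: smooth_diff (sh Y) Tz.
rewrite formNl form_Wh nab_vh_l // !nab_hh // !Rm_self // !scaler0 !vlift0 !subr0.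
rewrite form_hh !formBl !formBr !form_hh !form_hv !form_vh form_vv !formZl !formZr.
rewrite (Rm_antisym12 gm Y X) // !formNr (GamC gm Y X) //.
by rewrite (Rm_low gm X Y Y X Bx) (GamC gm Y X) // -/x; field.
Qed.

End TangentMetric.

(** * Ricci curvature as a trace *)

Lemma row_free_inj0 {R : fieldType} m n (A : 'M[R]_(m, n)) :
  (forall u : 'rV_m, u *m A = 0 -> u = 0) -> row_free A.
Proof.
move=> A0; rewrite -kermx_eq0; apply/eqP/row_matrixP => i.
by rewrite row0; apply: A0; rewrite -row_mul mulmx_ker row0.
Qed.

Lemma row_free_ker0 {R : fieldType} m n (A : 'M[R]_(m, n)) (u : 'rV_m) :
  row_free A -> u *m A = 0 -> u = 0.
Proof. by move=> Af u0; apply: (row_free_inj Af); rewrite u0 mul0mx. Qed.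

Lemma form_mx11 {R : realType} n (A : 'M[R]_n) u w : u *m A *m w^T = (form A u w)%:M.
Proof. by rewrite [LHS]mx11_scalar. Qed.

Lemma form_inj {R : realType} n (A B : 'M[R]_n) :
  (forall u w, form A u w = form B u w) -> A = B.
Proof. by move=> AB; apply/matrixP => i j; rewrite -!form_delta AB. Qed.

(** The inverse metric is the sum of a tangential and a normal part. The candidate [M] for the
    inverse of [h] is tested on the rows of [J] and on [nu], which form a basis. *)
Lemma hypersurface_inverse {R : realType} k n (J : 'M[R]_(k, n)) (h : 'M[R]_n)
    (nu : 'rV[R]_n) :
  n = k.+1 -> h \in unitmx -> J *m h *m J^T \in unitmx -> h^T = h ->
  J *m h *m nu^T = 0 -> form h nu nu != 0 ->
  J^T *m invmx (J *m h *m J^T) *m J =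
  invmx h - (form h nu nu)^-1 *: (nu^T *m nu).
Proof.
move=> nk hu Pu hs Jnu N0; set P := J *m h *m J^T; set N := form h nu nu.
have nuJ : nu *m h *m J^T = 0.
  by apply: trmx_inj; rewrite !trmx_mul trmxK hs mulmxA Jnu trmx0.
pose K := col_mx J nu; pose M := J^T *m invmx P *m J + N^-1 *: (nu^T *m nu).
have KhM : K *m (h *m M) = K.
  rewrite /K /M mulmxA !mul_col_mx; congr col_mx.
    rewrite mulmxDr !mulmxA -/P mulmxV // mul1mx -scalemxAr mulmxA Jnu mul0mx.
    by rewrite scaler0 addr0.
  rewrite mulmxDr !mulmxA nuJ !mul0mx add0r -scalemxAr mulmxA form_mx11.
  by rewrite mul_scalar_mx scalerA mulVf // scale1r.
have Kfree : row_free K.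
  apply: row_free_inj0 => u; rewrite -{1}(hsubmxK u) mul_row_col => u0.
  have l0 : lsubmx u = 0.
    apply: (can_inj (mulmxK Pu)); rewrite mul0mx.
    have := congr1 (fun w => w *m h *m J^T) u0.
    by rewrite !mulmxDl -!mulmxA (mulmxA nu) nuJ mulmx0 addr0 !mul0mx !mulmxA.
  move: u0; rewrite l0 mul0mx add0r => r0.
  have : rsubmx u *m nu *m h *m nu^T = 0 by rewrite r0 !mul0mx.
  rewrite -!mulmxA (mulmxA nu) form_mx11 mul_mx_scalar => /eqP.
  rewrite scaler_eq0 (negbTE N0) /= => /eqP r00.
  by rewrite -(hsubmxK u) l0 r00 row_mx0.
(* [K] has k + 1 rows and n columns, equal only through the hypothesis [nk]; a left inverse is
   therefore obtained from full column rank. *)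
have Kfull : row_full K by rewrite /row_full (eqP Kfree) nk addn1.
have [K' K'K] := row_fullP Kfull.
have hM : h *m M = 1%:M by rewrite -[LHS]mul1mx -K'K -mulmxA KhM.
rewrite -[invmx h](mulmx1) -hM mulmxA mulVmx // mul1mx /M.
by rewrite addrK.
Qed.

Section Traces.
Context {R : realType} {n : nat} (h : 'rV[R]_n -> 'M[R]_n) (x : 'rV[R]_n).

Lemma form_ricci v w : form (ricci h x) v w = \tr (curv_mx h x v w).
Proof.
rewrite form_coord /mxtrace exchange_big /=.
under eq_bigr do under eq_bigr do rewrite mxE mulr_sumr.
under [RHS]eq_bigr do rewrite mxE.
rewrite [RHS]exchange_big [LHS]exchange_big; apply: eq_bigr => j _ /=.
rewrite [RHS]exchange_big; apply: eq_bigr => k _ /=.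
by apply: eq_bigr => i _; ring.
Qed.

Lemma form_curv u v w z :
  form (curv_mx h x v w *m h x) u z = form (h x) (Rm h x u v w) z.
Proof. by rewrite /form mulmxA mul_curv_mx. Qed.

(** Lowering an index and raising it again brings the trace to a shape into which the Gauss
    equation, a statement on lowered curvature, can be inserted. *)
Lemma ricci_trace v w : h x \in unitmx ->
  form (ricci h x) v w = \tr (curv_mx h x v w *m h x *m invmx (h x)).
Proof. by move=> hu; rewrite mulmxK // form_ricci. Qed.

Lemma frame_invmx (E : 'I_n -> 'rV[R]_n) :
  (forall a b, form (h x) (E a) (E b) = (a == b)%:R) ->
  invmx (h x) = (\matrix_a E a)^T *m \matrix_a E a.
Proof.
move=> Eo; set P := \matrix_a E a.
have P1 : P *m h x *m P^T = 1%:M.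
  apply/matrixP => a b; rewrite -form_delta -form_mulmx -!rowE !rowK Eo.
  by rewrite mxE.
have [Pu _] := mulmx1_unit (etrans (mulmxA P (h x) P^T) P1).
have hu : h x \in unitmx.
  have [+ _] := mulmx1_unit P1; rewrite unitmx_mul => /andP[_].
  by [].
have PhP : h x *m P^T *m P = 1%:M.
  by apply: mulmx1C; rewrite mulmxA.
by rewrite -[LHS]mulmx1 -PhP !mulmxA mulVmx // mul1mx.
Qed.

Lemma tr_frame (A : 'M[R]_n) p (P : 'M[R]_(p, n)) :
  \tr (A *m (P^T *m P)) = \sum_a form A (row a P) (row a P).
Proof.
rewrite mulmxA mxtrace_mulC mulmxA /mxtrace; apply: eq_bigr => a _.
by rewrite -form_delta -form_mulmx -!rowE.
Qed.

Lemma scalar_curvature_frame (E : 'I_n -> 'rV[R]_n) : h x \in unitmx ->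
  (forall a b, form (h x) (E a) (E b) = (a == b)%:R) ->
  scalar_curvature h x = \sum_a \sum_b form (h x) (Rm h x (E b) (E a) (E a)) (E b).
Proof.
move=> hu Eo; have hi := frame_invmx Eo.
rewrite /scalar_curvature mxtrace_mulC hi tr_frame; apply: eq_bigr => a _.
rewrite rowK ricci_trace // hi tr_frame; apply: eq_bigr => b _.
by rewrite rowK form_curv.
Qed.

End Traces.

(** * The tangent sphere bundle as a hypersurface *)

Lemma form_pos_unit {R : realType} n (A : 'M[R]_n) :
  (forall v, v != 0 -> 0 < form A v v) -> A \in unitmx.
Proof.
move=> Apos; apply: unitmx_inj => u u0; apply/eqP/negPn/negP => /Apos.
by rewrite /form u0 mul0mx mxE ltxx.
Qed.

Lemma form_pos_ge0 {R : realType} n (A : 'M[R]_n) v :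
  (forall v, v != 0 -> 0 < form A v v) -> 0 <= form A v v.
Proof.
move=> Apos; have [->|/Apos/ltW//] := eqVneq v 0; by rewrite form0l.
Qed.

Lemma formB {R : realType} n (A B : 'M[R]_n) u w :
  form (A - B) u w = form A u w - form B u w.
Proof. by rewrite formD -scaleN1r formZ mulN1r. Qed.

Lemma form_outer {R : realType} n (u v a b : 'rV[R]_n) :
  form (u^T *m v) a b = (a *m u^T) 0 0 * (v *m b^T) 0 0.
Proof. by rewrite /form mulmxA -mulmxA mxE big_ord1. Qed.

Section Sphere.
Context {R : realType} {m k : nat} (B : set 'rV[R]_m) (g : 'rV[R]_m -> 'M[R]_m).
Hypothesis gm : metric_on B g.
Hypothesis gpos : forall x, B x -> forall v, v != 0 -> 0 < form (g x) v v.
Context (f1 f2 : R).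
Hypotheses (f1_gt0 : 0 < f1) (f2_gt0 : 0 < f2).

Local Notation T := (bundle_set B).
Local Notation G := (bundle_metric g f1 f2).

Let Gm : metric_on T G. Proof. exact: metric_on_bundle. Qed.

Lemma bundle_metric_pos z W : T z -> W != 0 -> 0 < form (G z) W W.
Proof.
move=> Tz W0; rewrite form_bundle.
have ge0 v : 0 <= form (g (lsubmx z)) v v by apply/form_pos_ge0/gpos.
have [l0|l0] := eqVneq (lsubmx W) 0.
  rewrite l0 form0l mulr0 add0r mulr_gt0 // gpos //.
  apply: contraNneq W0 => v0.
  by rewrite (lift_decomp g z W) l0 v0 /hlift /Gam omega0 mulmx0 oppr0 vlift0 row_mx0 addr0.
by rewrite ltr_pwDl // ?mulr_gt0 ?gpos // mulr_ge0 // ltW.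
Qed.

Context (A : set 'rV[R]_k) (F : 'rV[R]_k -> 'rV[R]_(m + m)) (r : R).
Hypotheses (oA : open A) (FT : forall y, A y -> T (F y)) (sF : smooth_on A F).
Hypothesis Fimm : forall y, A y -> row_free (jacobian F y).
Hypothesis dimk : (m + m)%N = k.+1.
Hypothesis r_gt0 : 0 < r.
Hypothesis Fr : forall y, A y ->
  form (g (lsubmx (F y))) (rsubmx (F y)) (rsubmx (F y)) = r ^+ 2.

Local Notation P := (pullback F G).
Local Notation U := euler.
Let N := f2 * r ^+ 2.

Let N_neq0 : N != 0.
Proof. by rewrite mulf_neq0 ?expf_neq0 ?gt_eqF. Qed.

Lemma metric_on_pullback : metric_on A P.
Proof.
split=> // [|y Ay|y Ay].
- have sJ : smooth_on A (jacobian F).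
    apply: smooth_mx => // a b.
    apply: (@smooth_ext _ _ _ oA _ (fun y => der F y (delta_mx 0 a) 0 b)).
      move=> y Ay; rewrite der_jacobian; last exact: smooth_diff sF Ay.
      by rewrite -rowE mxE.
    apply: smooth_entry => //; apply: (smooth_der oA (X := fun=> delta_mx 0 a)) => //.
    exact: smooth_cst.
  apply: smooth_mulmx => //; last exact: smooth_trmx.
  apply: smooth_mulmx => //; case: Gm => oT sG _ _.
  exact: (smooth_comp oA oT FT sF sG).
- by case: Gm => _ _ Gs _; rewrite /pullback !trmx_mul trmxK Gs ?mulmxA //; exact: FT.
- apply: form_pos_unit => v v0; rewrite -form_mulmx.
  apply: bundle_metric_pos; first exact: FT.
  by apply: contra_neq v0; exact: (row_free_ker0 (Fimm Ay)).
Qed.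
Let Pm := metric_on_pullback.

Lemma euler_norm y : A y -> form (G (F y)) (U (F y)) (U (F y)) = N.
Proof. by move=> Ay; rewrite form_vv Fr. Qed.

Lemma smooth_euler_along : smooth_on A (fun y => U (F y)).
Proof. by case: Gm => oT _ _ _; exact: (smooth_comp oA oT FT sF (smooth_euler gm)). Qed.

Lemma nab_euler_along y u : A y ->
  nab G F (fun y => U (F y)) y u = vlift (vpr g (F y) (der F y u)).
Proof.
have sU := smooth_euler gm; move=> Ay.
rewrite /nab (der_comp u (smooth_diff sF Ay) (smooth_diff sU (FT Ay))).
by rewrite -(nab_euler gm f1_gt0 f2_gt0 _ (FT Ay)) nab_id.
Qed.

(** Differentiate the constant |U|^2: as the derivative of U is the vertical projection, this gives
    2 <W, U> = 0 for every tangent vector W. *)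
Lemma euler_normal y u : A y -> form (G (F y)) (der F y u) (U (F y)) = 0.
Proof.
move=> Ay; have sU := smooth_euler_along.
have := nab_metric Gm oA FT sF u sU sU Ay.
rewrite (der_open_ext u oA euler_norm Ay) der_cst nab_euler_along //.
rewrite !form_vv [form (g _) (rsubmx _) _]formC; last by case: gm => _ _ + _; apply; exact: FT.
by rewrite form_Wv => /eqP; rewrite -mulr2n eq_sym mulrn_eq0 /= => /eqP.
Qed.

(** Second fundamental form taken with U instead of a unit normal; hence the factor N^-1 in front of
    its products. *)
Definition second_form y u w :=
  form (G (F y)) (nab G F (fun y => der F y w) y u) (U (F y)).

Definition vertical_form z : 'M[R]_(m + m) :=
  f2 *: (vert_mx g z *m g (lsubmx z) *m (vert_mx g z)^T).

Lemma form_vertical z W W' :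
  form (vertical_form z) W W' = f2 * form (g (lsubmx z)) (vpr g z W) (vpr g z W').
Proof. by rewrite formZ -form_mulmx !mul_vert. Qed.

Let Gs y : A y -> (G (F y))^T = G (F y).
Proof. by move=> Ay; case: Gm => _ _ + _; apply; exact: FT. Qed.

Let Gu y : A y -> G (F y) \in unitmx.
Proof. by move=> Ay; case: Gm => _ _ _; apply; exact: FT. Qed.

Let Pu y : A y -> P y \in unitmx.
Proof. by move=> Ay; case: Pm => _ _ _; apply. Qed.

Let Ps y : A y -> (P y)^T = P y.
Proof. by move=> Ay; case: Pm => _ _ + _; apply. Qed.

Lemma second_formE y u w : A y ->
  second_form y u w = - form (vertical_form (F y)) (der F y u) (der F y w).
Proof.
move=> Ay; have sU := smooth_euler_along; have sd := smooth_dmap oA sF.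
have := nab_metric Gm oA FT sF u (sd w) sU Ay.
rewrite (der_open_ext u oA (fun y => @euler_normal y w) Ay) der_cst nab_euler_along //.
move/eqP; rewrite eq_sym addr_eq0 -/(second_form y u w) => /eqP ->.
rewrite form_Wv form_vertical.
by congr (- (_ * _)); apply: formC; case: gm => _ _ + _; apply; exact: FT.
Qed.

Lemma tangent_inverse y : A y ->
  (jacobian F y)^T *m invmx (P y) *m jacobian F y =
  invmx (G (F y)) - N^-1 *: ((U (F y))^T *m U (F y)).
Proof.
move=> Ay; rewrite -(euler_norm Ay); apply: hypersurface_inverse => //.
- exact: Gu.
- exact: Pu.
- exact: Gs.
- apply/trmx_inj/rowP => i; rewrite trmx0 mxE.
  have := euler_normal (delta_mx 0 i) Ay.
  rewrite (der_jacobian _ (smooth_diff sF Ay)) /form -rowE -!row_mul => E.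
  by rewrite [RHS]mxE -[RHS]E [RHS]mxE.
- by rewrite euler_norm.
Qed.

(** Pythagoras: W G J^T lists the products of [W] with the coordinate tangent vectors of S_rM, and
    the last term is the component along U. *)
Lemma form_tangent_normal y W W' : A y ->
  form (G (F y)) W W' =
  form (invmx (P y)) (W *m G (F y) *m (jacobian F y)^T) (W' *m G (F y) *m (jacobian F y)^T)
  + N^-1 * (form (G (F y)) W (U (F y)) * form (G (F y)) W' (U (F y))).
Proof.
move=> Ay; have Gi := Gu Ay; set H := G (F y) in Gi *; set J := jacobian F y.
have -> : form H W W' = form (invmx H) (W *m H) (W' *m H).
  by rewrite form_mulmx mulmxV // mul1mx /H Gs.
rewrite -(subrK (N^-1 *: ((U (F y))^T *m U (F y))) (invmx H)) -tangent_inverse //.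
rewrite formD formZ; congr (_ + _ * _).
  by rewrite [RHS]form_mulmx trmxK.
by rewrite form_outer trmx_mul /H Gs // mulmxA [_ * form _ W' _]mulrC
  (formC W' _ (Gs Ay)) mulrC.
Qed.

Lemma nab_tangent y u w : A y ->
  nab G F (fun y => der F y w) y u *m G (F y) *m (jacobian F y)^T =
  Gam P y u w *m P y.
Proof.
move=> Ay; apply/rowP => i.
have := nab_dmap_pullback oA FT sF Gm Pm u w (delta_mx 0 i) Ay.
rewrite (der_jacobian (delta_mx 0 i) (smooth_diff sF Ay)) /form trmx_mul !mulmxA.
by rewrite trmx_delta -!colE !mxE.
Qed.

(** In [gauss_equation] the tangential products cancel by [form_tangent_normal], and only the
    components along U are left. *)
Lemma gauss_sphere u v w x y : A y ->
  form (P y) (Rm P y u v w) x =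
  form (G (F y)) (Rm G (F y) (der F y u) (der F y v) (der F y w)) (der F y x)
  + N^-1 * (second_form y v w * second_form y u x
            - second_form y u w * second_form y v x).
Proof.
move=> Ay; rewrite (gauss_equation oA FT sF Gm Pm _ _ _ _ Ay).
have D a b c d := form_tangent_normal (nab G F (fun y => der F y b) y a)
  (nab G F (fun y => der F y d) y c) Ay.
have E a b c d : form (invmx (P y)) (Gam P y a b *m P y) (Gam P y c d *m P y) =
    form (P y) (Gam P y a b) (Gam P y c d).
  by rewrite form_mulmx mulmxV ?Pu // mul1mx Ps.
have {}D a b c d : form (G (F y)) (nab G F (fun y => der F y b) y a)
    (nab G F (fun y => der F y d) y c) =
    form (P y) (Gam P y a b) (Gam P y c d)
    + N^-1 * (second_form y a b * second_form y c d).
  by rewrite D !nab_tangent // E.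
rewrite !D; ring.
Qed.

Definition shape_mx y : 'M[R]_k :=
  - (jacobian F y *m vertical_form (F y) *m (jacobian F y)^T).

Lemma form_shape y u w : A y -> form (shape_mx y) u w = second_form y u w.
Proof.
move=> Ay; rewrite second_formE // /form mulmxN mulNmx mxE -/(form _ u w).
by rewrite -form_mulmx !(der_jacobian _ (smooth_diff sF Ay)).
Qed.

Lemma ricci_sphere y : A y ->
  ricci P y = pullback F (ricci G) y
    + N^-1 *: (\tr (invmx (P y) *m shape_mx y) *: shape_mx y
               - shape_mx y *m invmx (P y) *m shape_mx y).
Proof.
move=> Ay; set S := shape_mx y; set I := invmx (P y); set J := jacobian F y.
apply: form_inj => v w.
rewrite (ricci_trace _ _ (Pu Ay)) -/I.
set Q := curv_mx G (F y) (der F y v) (der F y w) *m G (F y).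
have Qform u z : form Q u z =
    form (G (F y)) (Rm G (F y) u (der F y v) (der F y w)) z by exact: form_curv.
have Qtr : \tr (Q *m invmx (G (F y))) = form (pullback F (ricci G) y) v w.
  rewrite /Q mulmxK ?Gu // -form_ricci -form_mulmx.
  by rewrite !(der_jacobian _ (smooth_diff sF Ay)).
clearbody Q.
have -> : curv_mx P y v w *m P y = J *m Q *m J^T
    + N^-1 *: (form S v w *: S - S *m w^T *m (v *m S)).
  apply: form_inj => u x; rewrite form_curv gauss_sphere // [RHS]formD.
  rewrite -[form (J *m Q *m J^T) _ _]form_mulmx Qform.
  rewrite !(der_jacobian _ (smooth_diff sF Ay)) -/J; congr (_ + _).
  rewrite formZ -!form_shape // -/S; congr (_ * _).
  rewrite [RHS]formB formZ; congr (_ - _).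
  rewrite -[S *m w^T]trmxK form_outer !trmx_mul !trmxK mulmxA.
  by rewrite -!/(form _ _ _).
rewrite mulmxDl -scalemxAl mxtraceD mxtraceZ [RHS]formD formZ; congr (_ + _ * _).
  (* The ambient part of the trace misses only the normal direction, that is <R(U, v)w, U>. Skewness
     in both pairs turns this into <R(v, U)U, w> = 0. *)
  rewrite -!mulmxA mxtrace_mulC -!mulmxA [J^T *m _]mulmxA tangent_inverse //.
  rewrite mulmxBr raddfB /= Qtr -[RHS]subr0; congr (_ - _).
  rewrite -scalemxAr mxtraceZ mulmxA mxtrace_mulC mulmxA form_mx11.
  rewrite mxtrace_scalar mulr1n Qform.
  rewrite (Rm_antisym12 Gm _ _ _ (FT Ay)) formNl (Rm_antisym34 Gm _ _ _ _ (FT Ay)).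
  by rewrite (Rm_euler gm) ?form0l ?oppr0 ?mulr0 //; exact: FT.
rewrite mulmxBl raddfB /= -scalemxAl mxtraceZ [RHS]formB formZ; congr (_ - _).
  by rewrite mulrC mxtrace_mulC.
rewrite -!mulmxA mxtrace_mulC -!mulmxA.
by rewrite mxtrace_mulC form_mx11 mxtrace_scalar mulr1n.
Qed.

Lemma scalar_sphere y : A y ->
  scalar_curvature P y = scalar_curvature G (F y)
    + N^-1 * (\tr (invmx (P y) *m shape_mx y) ^+ 2
              - \tr (invmx (P y) *m shape_mx y *m (invmx (P y) *m shape_mx y))).
Proof.
move=> Ay; rewrite /scalar_curvature ricci_sphere // mulmxDr mxtraceD; congr (_ + _).
  rewrite /pullback !mulmxA mxtrace_mulC !mulmxA tangent_inverse //.
  rewrite mulmxBl raddfB /= -[RHS]subr0; congr (_ - _).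
  rewrite -scalemxAl mxtraceZ -mulmxA mxtrace_mulC form_mx11 mxtrace_scalar mulr1n.
  rewrite form_ricci (_ : curv_mx _ _ _ _ = 0) ?mxtrace0 ?mulr0 //.
  apply/row_matrixP => i; rewrite rowE mul_curv_mx row0.
  by apply: (Rm_euler gm) => //; exact: FT.
rewrite -scalemxAr mxtraceZ mulmxBr raddfB /= -scalemxAr mxtraceZ expr2.
by rewrite !mulmxA.
Qed.

Lemma vlift_mul_vert z : row_mx 0 1%:M *m vert_mx g z = 1%:M :> 'M[R]_m.
Proof. by rewrite /vert_mx mul_row_col mul0mx add0r mulmx1. Qed.

(** As an operator on rows this is the projection onto V along H, which sends W to
    [vlift (vpr g z W)]. *)
Lemma vertical_idem z : T z ->
  vertical_form z *m invmx (G z) = vert_mx g z *m row_mx 0 1%:M.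
Proof.
move=> Tz; have Gi : G z \in unitmx by case: Gm => _ _ _; apply.
rewrite -[RHS](mulmxK Gi); congr (_ *m _); rewrite -mulmxA.
have -> : row_mx 0 1%:M *m G z = f2 *: (g (lsubmx z) *m (vert_mx g z)^T).
  rewrite mulmxDr -!scalemxAr !mulmxA vlift_mul_vert mul1mx.
  by rewrite /dpi_mx mul_row_col mul0mx mulmx0 addr0 !mul0mx scaler0 add0r.
by rewrite -scalemxAr mulmxA.
Qed.

(** [E] is a projector of trace m, [S] the projector of trace 1 belonging to U, and E S = S E = S.
    So E - S is a projector of trace m-1, and the shape operator has the traces of -(E - S): the
    result is (m-1)^2 - (m-1). *)
Lemma shape_traces y : A y ->
  \tr (invmx (P y) *m shape_mx y) ^+ 2
  - \tr (invmx (P y) *m shape_mx y *m (invmx (P y) *m shape_mx y)) =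
  (m%:R - 1) * (m%:R - 2).
Proof.
move=> Ay; have Tz := FT Ay; set z := F y in Tz *; set I := invmx (P y).
set J := jacobian F y; set V := vertical_form z; pose M := J^T *m I *m J.
have Gi : G z \in unitmx by exact: Gu.
pose S := N^-1 *: ((U z)^T *m U z *m G z).
pose E := invmx (G z) *m V.
have UV : U z *m V = U z *m G z.
  apply/rowP => i; have : form V (U z) (delta_mx 0 i) = form (G z) (U z) (delta_mx 0 i).
    by rewrite form_vertical form_bundle vlift_l form0l mulr0 add0r.
  by rewrite /form trmx_delta -!colE !mxE.
have MV : M *m V = E - S.
  rewrite /M tangent_inverse // -/z mulmxBl -scalemxAl /E /S; congr (_ - _ *: _).
  by rewrite -!mulmxA UV.
have EE : E *m E = E.
  apply: trmx_inj; rewrite trmx_mul /E trmx_mul trmx_inv Gs // -/z.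
  have -> : V^T = V.
    rewrite /V /vertical_form linearZ /= !trmx_mul trmxK mulmxA.
    by case: gm => _ _ -> //; exact: FT.
  rewrite vertical_idem // mulmxA -(mulmxA (vert_mx g z)) vlift_mul_vert.
  by rewrite mulmx1.
have trE : \tr E = m%:R.
  by rewrite /E mxtrace_mulC vertical_idem // mxtrace_mulC vlift_mul_vert mxtrace1.
have UGU : U z *m G z *m (U z)^T = N%:M by rewrite form_mx11 euler_norm.
have SS : S *m S = S.
  rewrite /S -scalemxAl -scalemxAr scalerA -!mulmxA.
  rewrite [G z *m _]mulmxA [U z *m (_ *m _)]mulmxA [U z *m (G z *m _)]mulmxA UGU.
  rewrite mul_scalar_mx -scalemxAr scalerA.
  by rewrite -mulrA mulVf // mulr1.
have ES : E *m S = S.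
  rewrite /S -scalemxAr; congr (_ *: _); rewrite /E !mulmxA; congr (_ *m _ *m _).
  have VU : V *m (U z)^T = G z *m (U z)^T.
    apply: trmx_inj; rewrite !trmx_mul !trmxK Gs // -UV; congr (_ *m _).
    rewrite /V /vertical_form linearZ /= !trmx_mul trmxK mulmxA.
    by case: gm => _ _ -> //; exact: FT.
  by rewrite -mulmxA VU mulKmx.
have SE : S *m E = S.
  rewrite /S /E -scalemxAl; congr (_ *: _); rewrite -!mulmxA; congr (_ *m _).
  by rewrite mulKVmx.
have trS : \tr S = 1.
  rewrite /S mxtraceZ -mulmxA mxtrace_mulC UGU mxtrace_scalar mulr1n.
  by rewrite mulVf.
have t1 : \tr (I *m shape_mx y) = - (m%:R - 1).
  rewrite /shape_mx mulmxN raddfN /= mulmxA mxtrace_mulC !mulmxA -/M MV.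
  by rewrite raddfB /= trE trS.
have t2 : \tr (I *m shape_mx y *m (I *m shape_mx y)) = m%:R - 1.
  (* Cyclicity of the trace moves the jacobians together, from matrices of size k to matrices of
     size 2m; the two signs of [shape_mx] cancel. *)
  have -> : \tr (I *m shape_mx y *m (I *m shape_mx y)) = \tr (M *m V *m (M *m V)).
    rewrite /shape_mx !mulmxN !mulNmx opprK -/J -/V /M.
    by rewrite -!mulmxA mxtrace_mulC -!mulmxA mxtrace_mulC -!mulmxA mxtrace_mulC -!mulmxA.
  rewrite MV mulmxBl !mulmxBr EE ES SE SS subrr subr0.
  by rewrite raddfB /= trE trS.
by rewrite t1 t2; ring.
Qed.

Lemma scalar_curvature_sphere y : A y ->
  scalar_curvature P y =
  scalar_curvature G (F y) + (m%:R - 1) * (m%:R - 2) / (f2 * r ^+ 2).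
Proof. by move=> Ay; rewrite scalar_sphere // shape_traces // mulrC. Qed.

End Sphere.

(** The orthogonal complement of a nonzero vector of the plane is spanned by the vector rotated by a
    right angle; the coefficient is that of the orthogonal projection. *)
Lemma line2 {R : realType} (a : 'rV[R]_2) : a != 0 -> exists l : 'rV[R]_2,
  forall p : 'rV[R]_2, p *m a^T = 0 -> exists c, p = c *: l.
Proof.
move=> a0; pose l : 'rV[R]_2 := \row_i (if i == 0 then - a 0 1 else a 0 0).
exists l => p pa.
have E : p 0 0 * a 0 0 + p 0 1 * a 0 1 = 0.
  by have /matrixP/(_ 0 0) := pa; rewrite !mxE !big_ord_recl big_ord0 !mxE addr0 /=;
    rewrite (_ : lift ord0 ord0 = 1) //; exact: val_inj.
have D : a 0 0 ^+ 2 + a 0 1 ^+ 2 != 0.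
  apply: contraNneq a0 => /eqP; rewrite paddr_eq0 ?sqr_ge0 // !expf_eq0 /=.
  move=> /andP[/eqP a00 /eqP a01]; apply/eqP/rowP => i; rewrite mxE.
  case: (split_ordP (i : 'I_(1 + 1))) => j ->; rewrite (ord1 j).
    by rewrite -[RHS]a00; congr (a _ _); exact: val_inj.
  by rewrite -[RHS]a01; congr (a _ _); exact: val_inj.
exists ((p 0 1 * a 0 0 - p 0 0 * a 0 1) / (a 0 0 ^+ 2 + a 0 1 ^+ 2)).
apply/rowP => i; rewrite !mxE.
have [->|i1] := eqVneq i 0.
  apply: (mulIf D); rewrite mulrAC divfK //.
  have -> : p 0 0 * (a 0 0 ^+ 2 + a 0 1 ^+ 2) =
    (p 0 0 * a 0 0 + p 0 1 * a 0 1) * a 0 0 - (p 0 1 * a 0 0 - p 0 0 * a 0 1) * a 0 1 by ring.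
  by rewrite E; ring.
have -> : i = 1 by case: i i1 => [[|[|]]] //= ? _; exact: val_inj.
apply: (mulIf D); rewrite mulrAC divfK //.
have -> : p 0 1 * (a 0 0 ^+ 2 + a 0 1 ^+ 2) =
    (p 0 0 * a 0 0 + p 0 1 * a 0 1) * a 0 1 + (p 0 1 * a 0 0 - p 0 0 * a 0 1) * a 0 0 by ring.
by rewrite E; ring.
Qed.

(** * Curvature bounds *)

(** Induction on the dimension: split off the first basis vector and apply the hypothesis to the
    Schur complement. *)
Lemma orthonormal_basis {R : realType} n (A : 'M[R]_n) : A^T = A ->
  (forall v, v != 0 -> 0 < form A v v) ->
  exists e : 'M[R]_n, e *m A *m e^T = 1%:M.
Proof.
elim: n A => [|n IH] A As Apos.
  by exists 1%:M; apply/matrixP => -[].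
pose A' : 'M[R]_(1 + n) := A.
pose b : 'rV[R]_n := ursubmx A'; pose D := drsubmx A'; pose a := ulsubmx A' 0 0.
have AE : A' = block_mx a%:M b b^T D.
  rewrite -[LHS]submxK -mx11_scalar; congr (block_mx _ _ _ _).
  by rewrite /b trmx_ursub; congr dlsubmx; exact: esym.
have a0 : 0 < a.
  have d0 : (delta_mx 0 0 : 'rV[R]_(1 + n)) != 0.
    apply/eqP => /matrixP/(_ 0 0)/eqP; rewrite !mxE !eqxx oner_eq0 //.
  have := Apos _ d0; rewrite form_delta /a !mxE.
  by congr (0 < A _ _); exact: val_inj.
have an0 : a != 0 by rewrite gt_eqF.
have Ds : D^T = D by rewrite /D trmx_drsub; congr drsubmx.
pose S := D - a^-1 *: (b^T *m b).
have Ss : S^T = S by rewrite /S linearB linearZ /= trmx_mul trmxK Ds.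
have Spos v : v != 0 -> 0 < form S v v.
  (* [w] is [v] corrected to be orthogonal to the first basis vector, and the Schur complement is A
     restricted to such vectors, hence positive. *)
  move=> v0; pose w : 'rV[R]_(1 + n) := row_mx (- a^-1 *: (v *m b^T)) v.
  have w0 : w != 0.
    apply: contra_neq v0 => w0; rewrite -(row_mxKr (- a^-1 *: (v *m b^T)) v).
    by rewrite -/w w0 linear0.
  suff -> : form S v v = form A' w w by exact: Apos.
  rewrite /form AE /w mul_row_block tr_row_mx mul_row_col.
  have -> : - a^-1 *: (v *m b^T) *m a%:M + v *m b^T = 0.
    by rewrite mul_mx_scalar scalerA mulrN mulfV // scaleN1r addNr.
  rewrite mul0mx add0r; congr ((_ *m _) 0 0).
  by rewrite /S mulmxBr -scalemxAr mulmxA scaleNr mulNmx -scalemxAl addrC.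
have [e eS] := IH S Ss Spos.
pose s := (Num.sqrt a)^-1.
have s2 : s * s * a = 1.
  by rewrite -expr2 /s exprVn sqr_sqrtr ?ltW // mulVf.
suff : exists e : 'M[R]_(1 + n), e *m A' *m e^T = 1%:M by [].
exists (block_mx s%:M 0 (- a^-1 *: (e *m b^T)) e).
rewrite AE mulmx_block tr_block_mx mulmx_block.
rewrite !mul0mx !addr0 !trmx0 !mulmx0 !addr0 !tr_scalar_mx.
have E1 : - a^-1 *: (e *m b^T) *m a%:M + e *m b^T = 0.
  by rewrite mul_mx_scalar scalerA mulrN mulfV // scaleN1r addNr.
have E2 : - a^-1 *: (e *m b^T) *m b + e *m D = e *m S.
  by rewrite /S mulmxBr -scalemxAr mulmxA scaleNr mulNmx -scalemxAl addrC.
rewrite E1 E2 !mul0mx !add0r eS.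
have -> : s%:M *m a%:M *m (- a^-1 *: (e *m b^T))^T + s%:M *m b *m e^T = 0.
  rewrite linearZ /= trmx_mul trmxK -scalar_mxM mul_scalar_mx !mul_scalar_mx scalerA.
  by rewrite mulrN mulfK // scaleNr -scalemxAl addNr.
rewrite -!scalar_mxM mulrAC s2 -scalar_mx_block //.
Qed.

(** * From sectional curvature to all curvature components *)

Section Polarization.
Context {R : realFieldType} {V : zmodType} (K : V -> V -> V -> V -> R) (q : V -> R).
Hypothesis KD : forall x x' y z w, K (x + x') y z w = K x y z w + K x' y z w.
Hypothesis KN : forall x y z w, K (- x) y z w = - K x y z w.
Hypothesis K12 : forall x y z w, K x y z w = - K y x z w.
Hypothesis K34 : forall x y z w, K x y z w = - K x y w z.
Hypothesis Kbianchi : forall x y z w, K x y z w + K y z x w + K z x y w = 0.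
Hypothesis q_ge0 : forall x, 0 <= q x.
Hypothesis q_par : forall x y, q (x + y) + q (x - y) = 2 * q x + 2 * q y.

(** The four Bianchi identities with the arguments cyclically shifted, combined with both skew
    symmetries. *)
Lemma curvature_pair x y z w : K x y z w = K z w x y.
Proof.
have K1234 a b c d : K a b c d = K b a d c by rewrite K12 K34 opprK.
have := Kbianchi x y z w; have := Kbianchi y z w x.
have := Kbianchi z w x y; have := Kbianchi w x y z.
have := K12 w x y z; have := K34 x y w z; have := K1234 w x z y.
have := K34 x z w y; have := K34 y z w x; have := K34 z w y x.
have := K1234 w y z x; have := K12 z x y w.
by lra.
Qed.

Let KDm x y y' z w : K x (y + y') z w = K x y z w + K x y' z w.
Proof. by rewrite K12 KD opprD -!K12. Qed.
Let KNm x y z w : K x (- y) z w = - K x y z w.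
Proof. by rewrite K12 KN -K12. Qed.
Let KDr x y z z' w : K x y (z + z') w = K x y z w + K x y z' w.
Proof. by rewrite curvature_pair KD ![K _ w x y]curvature_pair. Qed.
Let KNr x y z w : K x y (- z) w = - K x y z w.
Proof. by rewrite curvature_pair KN [K _ w x y]curvature_pair. Qed.
Let KDl x y z w w' : K x y z (w + w') = K x y z w + K x y z w'.
Proof. by rewrite K34 KDr opprD -!K34. Qed.
Let KNl x y z w : K x y z (- w) = - K x y z w.
Proof. by rewrite K34 KNr -K34. Qed.

Context (C : R).
Hypothesis C_ge0 : 0 <= C.
Hypothesis K_sect : forall x y, `|K x y y x| <= C * q x * q y.

(** Polarization in the two middle arguments, in which K(x, ., ., x) is symmetric; the parallelogram
    law [q_par] evaluates the sum of the two bounds. *)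
Let bound1 x y z : `|K x y z x| <= C / 2 * q x * (q y + q z).
Proof.
have E : 4 * K x y z x = K x (y + z) (y + z) x - K x (y - z) (y - z) x.
  have S : K x y z x = K x z y x by rewrite curvature_pair K12 K34 opprK.
  rewrite !KDm !KDr !KNm !KNr; move: S.
  by set a := K x y z x; set b := K x z y x; set c := K x y y x; set d := K x z z x; lra.
rewrite -(ler_pM2l (ltr0n R 4)) -[X in X * `|_|]ger0_norm // -normrM E.
apply: le_trans (ler_normB _ _) _; apply: le_trans (lerD (K_sect _ _) (K_sect _ _)) _.
by rewrite -mulrDr q_par; lra.
Qed.

(** Polarization in the outer arguments. K(., y, z, .) is not symmetric, so only the part symmetric
    in [y] and [z] is bounded. *)
Let bound2 x y z w : `|K x y z w + K x z y w| <= C / 2 * (q x + q w) * (q y + q z).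
Proof.
have E : 2 * (K x y z w + K x z y w) = K (x + w) y z (x + w) - K (x - w) y z (x - w).
  have S : K w y z x = K x z y w by rewrite curvature_pair K12 K34 opprK.
  rewrite !KD !KDl !KN !KNl; move: S.
  set a := K w y z x; set b := K x z y w; set c := K x y z w; set d := K x y z x.
  by set e := K w y z w; lra.
rewrite -(ler_pM2l (ltr0n R 2)) -[X in X * `|_|]ger0_norm // -normrM E.
apply: le_trans (ler_normB _ _) _; apply: le_trans (lerD (bound1 _ _ _) (bound1 _ _ _)) _.
by rewrite -mulrDl -mulrDr q_par; lra.
Qed.

(** The Bianchi identity writes 3 K as a difference of two symmetrised terms bounded by [bound2].
    Each is at most 2 C b^2, so the factor 2 is generous. *)
Lemma curvature_bound b x y z w : q x <= b -> q y <= b -> q z <= b -> q w <= b ->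
  `|K x y z w| <= 2 * C * b ^+ 2.
Proof.
move=> xb yb zb wb; have b0 : 0 <= b := le_trans (q_ge0 x) xb.
have E : 3 * K x y z w = K x y z w + K x z y w - (K y x z w + K y z x w).
  have := Kbianchi x y z w; have := K12 z x y w; have := K12 y x z w.
  set a1 := K y x z w; set a2 := K x y z w; set a3 := K z x y w.
  by set a4 := K x z y w; set a5 := K y z x w; lra.
have P s t : 0 <= s -> s <= 2 * b -> 0 <= t -> t <= 2 * b -> C / 2 * s * t <= 2 * C * b ^+ 2.
  move=> s0 sb t0 tb; have C2 : 0 <= C / 2 by rewrite divr_ge0.
  have -> : 2 * C * b ^+ 2 = C / 2 * (2 * b) * (2 * b) by field.
  by apply: ler_pM => //; [apply: mulr_ge0|apply: ler_wpM2l].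
rewrite -(ler_pM2l (ltr0n R 3)) -[X in X * `|_|]ger0_norm // -normrM E.
apply: le_trans (ler_normB _ _) _; apply: le_trans (lerD (bound2 _ _ _ _) (bound2 _ _ _ _)) _.
have s0 s t : 0 <= q s + q t by rewrite addr_ge0.
have s1 s t : q s <= b -> q t <= b -> q s + q t <= 2 * b by move=> ? ?; lra.
have := P _ _ (s0 x w) (s1 _ _ xb wb) (s0 y z) (s1 _ _ yb zb).
have := P _ _ (s0 y w) (s1 _ _ yb wb) (s0 x z) (s1 _ _ xb zb).
have : 0 <= C * b ^+ 2 by rewrite mulr_ge0 // sqr_ge0.
set p1 := C / 2 * _ * _; set p2 := C / 2 * _ * _; set p3 := C * b ^+ 2.
by rewrite -mulrA -/p3; lra.
Qed.

End Polarization.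

Section CurvatureBound.
Context {R : realType} {n : nat} (B : set 'rV[R]_n) (g : 'rV[R]_n -> 'M[R]_n).
Hypothesis gm : metric_on B g.
Hypothesis gpos : forall x, B x -> forall v, v != 0 -> 0 < form (g x) v v.
Context (x : 'rV[R]_n) (Bx : B x) (C : R).
Hypothesis C_ge0 : 0 <= C.
Hypothesis gC : forall v w : 'rV[R]_n, row_free (col_mx v w) ->
  `|sectional_curvature g x v w| <= C.

Let gs : (g x)^T = g x. Proof. by case: gm => _ _ + _; apply. Qed.

Lemma RmZ a b c u v w : Rm g x (a *: u) (b *: v) (c *: w) = (a * b * c) *: Rm g x u v w.
Proof.
apply/rowP => l; rewrite !mxE mulr_sumr; apply: eq_bigr => i _.
rewrite mulr_sumr; apply: eq_bigr => j _; rewrite mulr_sumr; apply: eq_bigr => k _.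
by rewrite !mxE; ring.
Qed.

(** The hypothesis [gC] speaks of independent vectors only. For dependent ones the left side is 0;
    for independent ones the Gram determinant is positive and at most |v|^2 |w|^2. *)
Lemma sectional_bound v w :
  `|form (g x) (Rm g x v w w) v| <= C * form (g x) v v * form (g x) w w.
Proof.
have q0 u : 0 <= form (g x) u u by apply/form_pos_ge0/gpos.
have Z0 : (0 : R)%:M = 0 :> 'M[R]_1 by apply/matrixP => i j; rewrite !mxE mul0rn.
have [vw|] := boolP (row_free (col_mx v w)); last first.
  have self u z : Rm g x u u z = 0 by exact: (Rm_self gm).
  rewrite -kermx_eq0 => /rowV0Pn[u /sub_kermxP]; rewrite -(hsubmxK u).
  move: (lsubmx u) (rsubmx u) => a b; rewrite mul_row_col (mx11_scalar a) (mx11_scalar b).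
  rewrite !mul_scalar_mx => ab u0.
  have -> : form (g x) (Rm g x v w w) v = 0.
    have [a0|a0] := eqVneq (a 0 0) 0.
      have b0 : b 0 0 != 0.
        by apply: contraNneq u0 => b0; rewrite a0 b0 Z0 row_mx0.
      move: ab; rewrite a0 scale0r add0r => /eqP; rewrite scaler_eq0 (negbTE b0) /= => /eqP ->.
      by rewrite -(scale0r (0 : 'rV_n)) -[X in Rm _ _ X]scale1r RmZ mulr0 scale0r form0l.
    have -> : v = (- ((a 0 0)^-1 * b 0 0)) *: w.
      apply: (scalerI a0); rewrite scalerA mulrN mulrA mulfV // mul1r scaleNr.
      by apply/eqP; rewrite -addr_eq0 ab.
    by rewrite -mul_curv_mx -scalemxAl mul_curv_mx self scaler0 form0l.
  by rewrite normr0 !mulr_ge0.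
have indep a b : a *: v + b *: w = 0 -> a = 0 /\ b = 0.
  rewrite -!mul_scalar_mx -mul_row_col => /(row_free_ker0 vw) ab0.
  have := congr1 lsubmx ab0; have := congr1 rsubmx ab0.
  rewrite row_mxKl row_mxKr !linear0 => /matrixP/(_ 0 0) + /matrixP/(_ 0 0).
  by rewrite !mxE eqxx !mulr1n.
have w0 : w != 0.
  apply/eqP => w0; have [|_ /eqP] := indep 0 1; last by rewrite oner_eq0.
  by rewrite w0 scale0r scaler0 addr0.
set den := form (g x) v v * form (g x) w w - form (g x) v w ^+ 2.
have wpos := gpos Bx w0.
have den0 : 0 < den.
  (* |w|^2 times the component of [v] orthogonal to [w]: its squared length is |w|^2 times the Gram
     determinant, which is therefore positive. *)
  pose z := form (g x) w w *: v - form (g x) v w *: w.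
  have z0 : z != 0.
    apply/eqP => z0; have [|/eqP] := indep (form (g x) w w) (- form (g x) v w).
      by rewrite scaleNr.
    by rewrite gt_eqF.
  have := gpos Bx z0.
  have -> : form (g x) z z = form (g x) w w * den.
    rewrite /z !formBl !formBr !formZl !formZr (formC w v) // /den; ring.
  by rewrite pmulr_rgt0.
have := gC vw; rewrite /sectional_curvature -/den -/(Rm g x v w w).
rewrite normrM normfV (gtr0_norm den0) ler_pdivrMr // => /le_trans; apply.
rewrite -mulrA ler_wpM2l // /den lerBlDr lerDl sqr_ge0 //.
Qed.

Lemma Rm_bound b u v w z :
  form (g x) u u <= b -> form (g x) v v <= b -> form (g x) w w <= b ->
  form (g x) z z <= b -> `|form (g x) (Rm g x u v w) z| <= 2 * C * b ^+ 2.
Proof.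
apply: (curvature_bound (K := fun u v w z => form (g x) (Rm g x u v w) z)
  (q := fun u => form (g x) u u)).
- by move=> *; rewrite RmDl formDl.
- by move=> a *; rewrite -!mul_curv_mx mulNmx formNl.
- by move=> *; rewrite (Rm_antisym12 gm) // formNl.
- by move=> *; exact: (Rm_antisym34 gm).
- by move=> *; rewrite -!formDl (bianchi gm) // form0l.
- by move=> u'; apply/form_pos_ge0/gpos.
- move=> a c; rewrite !formDl !formDr !formNl !formNr; ring.
- exact: C_ge0.
- by move=> *; exact: sectional_bound.
Qed.

(** Parseval in the orthonormal basis [e]: each of the [n] coefficients obeys [Rm_bound]. The
    condition 1 <= b lets the unit vectors of the basis satisfy the same bound. *)
Lemma Rm_norm_bound (e : 'M[R]_n) b u v w : e *m g x *m e^T = 1%:M -> 1 <= b ->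
  form (g x) u u <= b -> form (g x) v v <= b -> form (g x) w w <= b ->
  form (g x) (Rm g x u v w) (Rm g x u v w) <= n%:R * (2 * C * b ^+ 2) ^+ 2.
Proof.
move=> e1 b1 ub vb wb; set k := Rm g x u v w.
have ei i : form (g x) (row i e) (row i e) = 1.
  have := congr1 (fun A : 'M[R]_n => A i i) e1.
  by rewrite -form_delta -form_mulmx -!rowE mxE eqxx.
have eg : g x *m e^T *m e *m g x = g x.
  have : e *m (g x *m e^T) = 1%:M by rewrite mulmxA.
  by move/mulmx1C => ->; rewrite mul1mx.
have kE : k *m g x *m k^T = (e *m g x *m k^T)^T *m (e *m g x *m k^T).
  by rewrite !trmx_mul trmxK gs -{1}eg !mulmxA.
have -> : form (g x) k k = \sum_i form (g x) (row i e) k ^+ 2.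
  rewrite {1}/form kE mxE; apply: eq_bigr => i _; rewrite mxE expr2.
  have -> : (e *m g x *m k^T) i 0 = form (g x) (row i e) k.
    by rewrite /form -!row_mul [RHS]mxE.
  by [].
have -> : n%:R * (2 * C * b ^+ 2) ^+ 2 = \sum_(i < n) (2 * C * b ^+ 2) ^+ 2.
  by rewrite sumr_const card_ord mulr_natl.
apply: ler_sum => i _; rewrite -real_normK ?num_real // ler_sqr ?nnegrE //.
  by rewrite formC // Rm_bound // ei.
by rewrite mulr_ge0 ?sqr_ge0 // mulr_ge0.
Qed.

End CurvatureBound.

(** * Lower bound for the scalar curvature of TM *)

Section ScalarBound.
Context {R : realType} {m : nat} (B : set 'rV[R]_m) (g : 'rV[R]_m -> 'M[R]_m).
Hypothesis gm : metric_on B g.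
Hypothesis gpos : forall x, B x -> forall v, v != 0 -> 0 < form (g x) v v.
Context (f1 f2 : R).
Hypotheses (f1_gt0 : 0 < f1) (f2_gt0 : 0 < f2).

Local Notation T := (bundle_set B).
Local Notation G := (bundle_metric g f1 f2).

Let Gm : metric_on T G. Proof. exact: metric_on_bundle. Qed.

Context (z : 'rV[R]_(m + m)) (Tz : T z) (e : 'M[R]_m).
Hypothesis e1 : e *m g (lsubmx z) *m e^T = 1%:M.

Let s1 := (Num.sqrt f1)^-1.
Let s2 := (Num.sqrt f2)^-1.

Let s1E : s1 ^+ 2 = f1^-1. Proof. by rewrite exprVn sqr_sqrtr // ltW. Qed.
Let s2E : s2 ^+ 2 = f2^-1. Proof. by rewrite exprVn sqr_sqrtr // ltW. Qed.

Definition lift_frame (a : 'I_(m + m)) : 'rV[R]_(m + m) :=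
  match fintype.split a with
  | inl i => s1 *: hlift g (row i e) z
  | inr i => s2 *: vlift (row i e)
  end.

Local Notation E := lift_frame.

Let El i : E (lshift m i) = s1 *: hlift g (row i e) z.
Proof. by rewrite /E -[lshift m i]/(unsplit (inl i)) unsplitK. Qed.

Let Er i : E (rshift m i) = s2 *: vlift (row i e).
Proof. by rewrite /E -[rshift m i]/(unsplit (inr i)) unsplitK. Qed.

Let ee i j : form (g (lsubmx z)) (row i e) (row j e) = (i == j)%:R.
Proof.
have := congr1 (fun A : 'M[R]_m => A i j) e1.
by rewrite -form_delta -form_mulmx -!rowE mxE.
Qed.

Lemma lift_frame_orthonormal a b : form (G z) (E a) (E b) = (a == b)%:R.
Proof.
case: (split_ordP a) => i ->; case: (split_ordP b) => j ->;
  rewrite ?El ?Er formZl formZr.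
- rewrite form_hh ee eq_lshift mulrA mulrA -expr2 s1E mulVf ?mul1r //.
  by rewrite gt_eqF.
- by rewrite form_hv !mulr0 eq_lrshift.
- by rewrite form_vh !mulr0 eq_rlshift.
- rewrite form_vv ee eq_rshift mulrA mulrA -expr2 s2E mulVf ?mul1r //.
  by rewrite gt_eqF.
Qed.

(** In the lifted frame the double sum splits into four blocks. Vertical pairs give 0 and both mixed
    blocks are nonnegative, so only the m^2 ordered horizontal pairs can contribute negatively. *)
Lemma scalar_curvature_bundle_ge (C D : R) :
  let x := lsubmx z in
  let v := rsubmx z in
  (forall i j, - C <=
     form (g x) (Rm g x (row i e) (row j e) (row j e)) (row i e)) ->
  (forall i j, form (g x) (Rm g x (row i e) (row j e) v)
                          (Rm g x (row i e) (row j e) v) <= D) ->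
  - (m%:R ^+ 2 * (C / f1 + 3 / 4 * D * f2 / f1 ^+ 2)) <= scalar_curvature G z.
Proof.
move=> /= hC hD; have Gi : G z \in unitmx by case: Gm => _ _ _; apply.
rewrite (scalar_curvature_frame Gi lift_frame_orthonormal).
set t := C / f1 + _.
have Q a b u v : form (G z) (Rm G z (a *: u) (b *: v) (b *: v)) (a *: u) =
    a ^+ 2 * b ^+ 2 * form (G z) (Rm G z u v v) u.
  by rewrite RmZ formZl formZr !expr2; ring.
have Q0 (a b c : R) : 0 <= c -> 0 <= a ^+ 2 * b ^+ 2 * c.
  by move=> c0; apply: mulr_ge0 => //; apply: mulr_ge0; exact: sqr_ge0.
have hv_ge0 i j : 0 <= form (G z) (Rm G z (hlift g (row i e) z) (vlift (row j e))
    (vlift (row j e))) (hlift g (row i e) z).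
  by rewrite (Rm_hvvh gm) //; apply: form_pos_ge0 => W;
    exact: (bundle_metric_pos gpos f1_gt0 f2_gt0 Tz).
have vh_ge0 i j : 0 <= form (G z) (Rm G z (vlift (row i e)) (hlift g (row j e) z)
    (hlift g (row j e) z)) (vlift (row i e)).
  by rewrite (Rm_antisym12 Gm) // formNl (Rm_antisym34 Gm) // opprK.
have -> : - (m%:R ^+ 2 * t) = \sum_(i < m) \sum_(j < m) - t.
  by rewrite !sumr_const card_ord -mulrnA -[RHS]mulr_natl natrM mulrN expr2.
rewrite big_split_ord /= -[X in X <= _]addr0 lerD //.
  apply: ler_sum => i _; rewrite big_split_ord /= -[X in X <= _]addr0 lerD //.
    apply: ler_sum => j _; rewrite !El Q (Rm_hhhh gm) // s1E.
    have := hC j i; have := hD j i; set K := form _ _ (row j e); set n := form _ _ _.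
    move=> nD CK.
    have -> : f1^-1 * f1^-1 * (f1 * K - 3 / 4 * f2 * n) =
        K / f1 - 3 / 4 * n * f2 / f1 ^+ 2 by field; rewrite gt_eqF.
    have h1 : - C / f1 <= K / f1 by rewrite ler_wpM2r // invr_ge0 ltW.
    have h2 : 3 / 4 * n * f2 / f1 ^+ 2 <= 3 / 4 * D * f2 / f1 ^+ 2.
      rewrite ler_wpM2r ?invr_ge0 ?sqr_ge0 // ler_wpM2r ?(ltW f2_gt0) //.
      by rewrite ler_wpM2l // divr_ge0.
    by rewrite /t opprD -mulNr lerB.
  by apply: sumr_ge0 => j _; rewrite El Er Q; exact: Q0.
apply: sumr_ge0 => i _; rewrite big_split_ord /= addr_ge0 //.
  by apply: sumr_ge0 => j _; rewrite El Er Q; exact: Q0.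
by apply: sumr_ge0 => j _; rewrite !Er Q (Rm_vvv gm) // form0l mulr0.
Qed.

End ScalarBound.

(** * Proof of the theorem *)

Section Manifold.
Context {R : realType} {m : nat} (M : riemannian_manifold R m).
Context (r : R) (r_gt0 : 0 < r) (m_gt0 : (0 < m)%N).
Context (f1 f2 : R) (f1_gt0 : 0 < f1) (f2_gt0 : 0 < f2).
Context (i : chart M) (s : sphere_param r i).

Local Notation B := (coord i @` dom i).
Local Notation g := (metric i).
Local Notation A := (sdom s).
Local Notation F := (tcoord i \o s).

Lemma metric_on_chart : metric_on B g.
Proof.
split; [exact: coord_open|exact: metric_smooth|exact: metric_sym|].
by move=> x Bx; apply: form_pos_unit => v; exact: metric_pos.
Qed.

Let gpos x : B x -> forall v, v != 0 -> 0 < form (g x) v v.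
Proof. exact: metric_pos. Qed.

Lemma sphere_param_bundle y : A y -> bundle_set B (F y).
Proof.
by move=> Ay; exists (tpt (s y)); [exact: sfun_tdom|rewrite row_mxKl].
Qed.

Lemma sphere_param_norm y : A y ->
  form (g (lsubmx (F y))) (rsubmx (F y)) (rsubmx (F y)) = r ^+ 2.
Proof.
move=> Ay; have := sfun_sphere Ay (sfun_tdom Ay); rewrite /tnorm.
have Bx := sphere_param_bundle Ay.
move/(congr1 (fun t => t ^+ 2)); rewrite sqr_sqrtr.
  by move=> <-; rewrite row_mxKl row_mxKr.
have := Bx; rewrite /bundle_set /= row_mxKl => Bc.
by apply: form_pos_ge0 => v; exact: gpos.
Qed.

(** The predecessor truncates at 0, so [m_gt0] is what makes S_rM a hypersurface dimensionally. *)
Lemma dim_sphere : (m + m)%N = (m + m).-1.+1.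
Proof. by rewrite prednK // addn_gt0 m_gt0. Qed.

Lemma TM_metricE : TM_metric f1 f2 i = bundle_metric g f1 f2.
Proof. by []. Qed.

Lemma ricci_sphere_param y : A y ->
  ricci (sphere_metric f1 f2 s) y =
  pullback F (ricci (TM_metric f1 f2 i)) y
  + (f2 * r ^+ 2)^-1 *:
    (\tr (invmx (sphere_metric f1 f2 s y) *m shape_mx g f2 F y) *: shape_mx g f2 F y
     - shape_mx g f2 F y *m invmx (sphere_metric f1 f2 s y) *m shape_mx g f2 F y).
Proof.
move=> Ay; rewrite /sphere_metric TM_metricE.
exact: (ricci_sphere metric_on_chart gpos f1_gt0 f2_gt0 (@sdom_open _ _ _ _ _ s)
  sphere_param_bundle (@sfun_smooth _ _ _ _ _ s) (@sfun_immersion _ _ _ _ _ s) dim_sphere r_gt0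
  sphere_param_norm Ay).
Qed.

Lemma scalar_curvature_sphere_param y : A y ->
  scalar_curvature (sphere_metric f1 f2 s) y =
  scalar_curvature (TM_metric f1 f2 i) (F y)
  + (m%:R - 1) * (m%:R - 2) / (f2 * r ^+ 2).
Proof.
move=> Ay; rewrite /sphere_metric TM_metricE.
exact: (scalar_curvature_sphere metric_on_chart gpos f1_gt0 f2_gt0 (@sdom_open _ _ _ _ _ s)
  sphere_param_bundle (@sfun_smooth _ _ _ _ _ s) (@sfun_immersion _ _ _ _ _ s) dim_sphere r_gt0
  sphere_param_norm Ay).
Qed.

(** When the vertical parts of tangent vectors lie on a line, S(v, w) S(u, x) = S(u, w) S(v, x).
    Tracing this over [u] and [x] gives the identity, so the quadratic terms of [ricci_sphere_param]
    cancel. *)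
Lemma shape_rank1 (l : 'rV[R]_m) y : A y ->
  (forall u, exists c, vpr g (F y) (der F y u) = c *: l) ->
  \tr (invmx (sphere_metric f1 f2 s y) *m shape_mx g f2 F y) *: shape_mx g f2 F y
  = shape_mx g f2 F y *m invmx (sphere_metric f1 f2 s y) *m shape_mx g f2 F y.
Proof.
move=> Ay hl; set S := shape_mx g f2 F y; set I := invmx _.
have SE u w : form S u w = - form (vertical_form g f2 (F y)) (der F y u) (der F y w).
  rewrite (form_shape metric_on_chart f1_gt0 f2_gt0 (@sdom_open _ _ _ _ _ s)
    sphere_param_bundle (@sfun_smooth _ _ _ _ _ s) sphere_param_norm) //.
  by rewrite (second_formE metric_on_chart f1_gt0 f2_gt0 (@sdom_open _ _ _ _ _ s)
    sphere_param_bundle (@sfun_smooth _ _ _ _ _ s) sphere_param_norm).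
have S1 u v w x : form S v w * form S u x = form S u w * form S v x.
  rewrite !SE !form_vertical.
  have [a ->] := hl u; have [b ->] := hl v; have [c ->] := hl w; have [d ->] := hl x.
  by rewrite !formZl !formZr; ring.
apply: form_inj => v w; rewrite formZ mulrC.
have SS : form S v w *: S = S *m w^T *m (v *m S).
  apply: form_inj => u x; rewrite formZ S1.
  rewrite -[S *m w^T]trmxK form_outer !trmx_mul !trmxK mulmxA.
  by rewrite -!/(form _ _ _).
have := congr1 (fun X => \tr (X *m I)) SS.
rewrite -scalemxAl mxtraceZ mxtrace_mulC => ->.
rewrite -!mulmxA mxtrace_mulC -!mulmxA mxtrace_mulC form_mx11.
by rewrite mxtrace_scalar mulr1n.
Qed.

(** The bound 1 + r^2 covers the squared lengths of both the unit frame vectors and v, which has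
    length r; the constant before f2/f1^2 comes from [Rm_norm_bound] with this value. *)
Lemma scalar_sphere_lower C y : 0 <= C -> A y ->
  (forall p (v w : 'rV[R]_m), dom i p -> row_free (col_mx v w) ->
     `|sectional_curvature g (coord i p) v w| <= C) ->
  (m%:R - 1) * (m%:R - 2) / (f2 * r ^+ 2)
  - m%:R ^+ 2 * (C / f1 + 3 / 4 * (m%:R * (2 * C * (1 + r ^+ 2) ^+ 2) ^+ 2) * f2 / f1 ^+ 2)
  <= scalar_curvature (sphere_metric f1 f2 s) y.
Proof.
move=> C0 Ay hC; rewrite scalar_curvature_sphere_param // addrC lerD2r.
have Bx := sphere_param_bundle Ay; set x := lsubmx (F y) in Bx *.
have gs : (g x)^T = g x by exact: metric_sym.
have [e e1] := orthonormal_basis gs (gpos Bx).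
have xE : x = coord i (tpt (s y)) by rewrite /x row_mxKl.
have hCx (v w : 'rV[R]_m) : row_free (col_mx v w) -> `|sectional_curvature g x v w| <= C.
  by rewrite xE; apply: hC; exact: sfun_tdom.
have ee j : form (g x) (row j e) (row j e) = 1.
  have := congr1 (fun A : 'M[R]_m => A j j) e1.
  by rewrite -form_delta -form_mulmx -!rowE mxE eqxx.
have b1 : 1 <= 1 + r ^+ 2 by rewrite lerDl sqr_ge0.
have br : r ^+ 2 <= 1 + r ^+ 2 by rewrite lerDr.
apply: (scalar_curvature_bundle_ge metric_on_chart gpos f1_gt0 f2_gt0 Bx e1) => a b.
  have := sectional_bound metric_on_chart gpos Bx C0 hCx (row a e) (row b e).
  by rewrite !ee !mulr1 ler_norml => /andP[].
apply: (Rm_norm_bound metric_on_chart gpos Bx C0 hCx e1) => //; rewrite ?ee //.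
by rewrite sphere_param_norm.
Qed.

End Manifold.

Theorem theorem1p2 (R : realType) (m : nat) (M : riemannian_manifold R m)
    (r : R) (r_gt0 : 0 < r) :
  (m = 2%N ->
     forall f1 f2 : R, 0 < f1 -> 0 < f2 ->
       same_ricci_curvature M r f1 f2 /\ same_scalar_curvature M r f1 f2)
  /\
  ((3 <= m)%N -> bounded_sectional_curvature M ->
     (forall f2 : R, 0 < f2 ->
        exists2 c : R, 0 < c &
          forall f1 : R, c <= f1 -> sphere_positive_scalar_curvature M r f1 f2)
     /\
     (forall f1 : R, 0 < f1 ->
        exists2 c : R, 0 < c &
          forall f2 : R, 0 < f2 -> f2 <= c ->
            sphere_positive_scalar_curvature M r f1 f2)).
Proof.
split=> [m2 f1 f2 f1_gt0 f2_gt0|m3 [C0 hC0]].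
  subst m; split=> i s y Ay.
    have Bx := sphere_param_bundle Ay; set F := tcoord i \o s in Bx *.
    (* On a surface the vectors orthogonal to v form a line, as v has length r > 0. By
       [euler_normal] the vertical parts of all tangent vectors of S_rM lie on it. *)
    have [l hl] : exists l : 'rV[R]_2, forall p, form (metric i (lsubmx (F y)))
        p (rsubmx (F y)) = 0 -> exists c, p = c *: l.
      have [|l hl] := @line2 R (rsubmx (F y) *m (metric i (lsubmx (F y)))^T).
        apply/eqP => v0; have := sphere_param_norm Ay.
        rewrite /form -mulmxA -[_ *m _^T]trmxK trmx_mul trmxK v0 trmx0 mulmx0 mxE.
        by move/eqP; rewrite eq_sym expf_eq0 gt_eqF.
      exists l => p p0; apply: hl; rewrite trmx_mul trmxK mulmxA.
      by rewrite form_mx11 p0; apply/matrixP => a b; rewrite !mxE mul0rn.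
    rewrite (ricci_sphere_param r_gt0 _ f1_gt0) //.
    suff hu u : exists c, vpr (metric i) (F y) (der F y u) = c *: l.
      by rewrite (shape_rank1 f1_gt0 f2_gt0 Ay hu) subrr scaler0 addr0.
    apply: hl.
    have := euler_normal (metric_on_chart i) f1_gt0 f2_gt0 (@sdom_open _ _ _ _ _ s)
      (@sphere_param_bundle _ _ _ _ _ s) (@sfun_smooth _ _ _ _ _ s)
      (@sphere_param_norm _ _ _ _ _ s) u Ay.
    by rewrite form_Wv => /eqP; rewrite mulf_eq0 gt_eqF //= => /eqP.
  by rewrite (scalar_curvature_sphere_param r_gt0 _ f1_gt0 f2_gt0) // subrr mulr0 mul0r addr0.
(* For empty [M] the given bound may be negative. *)
pose C : R := `|C0|.
have C_ge0 : 0 <= C by exact: normr_ge0.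
have hC (i : chart M) (p : M) (v w : 'rV[R]_m) : dom i p -> row_free (col_mx v w) ->
    `|sectional_curvature (metric i) (coord i p) v w| <= C.
  by move=> ip vw; apply: le_trans (hC0 i p v w ip vw) _; exact: ler_norm.
have m_gt0 : (0 < m)%N by apply: leq_trans m3.
pose A1 : R := m%:R ^+ 2 * C.
pose A2 : R := m%:R ^+ 2 * (3 / 4 * (m%:R * (2 * C * (1 + r ^+ 2) ^+ 2) ^+ 2)).
have A1_ge0 : 0 <= A1 by rewrite mulr_ge0 ?sqr_ge0.
have A2_ge0 : 0 <= A2.
  by rewrite mulr_ge0 ?sqr_ge0 // mulr_ge0 ?divr_ge0 // mulr_ge0 ?ler0n ?sqr_ge0.
have r2 : 0 < r ^+ 2 by rewrite exprn_gt0.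
have mm : 2 <= (m%:R - 1) * (m%:R - 2) :> R.
  have m3R : 3 <= m%:R :> R by rewrite ler_nat.
  have -> : 2 = 2 * 1 :> R by rewrite mulr1.
  by apply: ler_pM => //; lra.
(* [scalar_sphere_lower] with the denominator f2 r^2 cleared; 2 is the least value of (m-1)(m-2) for
   m >= 3. *)
have key f1 f2 : 0 < f1 -> 0 < f2 ->
    (A1 / f1 + A2 * f2 / f1 ^+ 2) * (f2 * r ^+ 2) < 2 ->
    sphere_positive_scalar_curvature M r f1 f2.
  move=> f1_gt0 f2_gt0 small i s y Ay.
  apply: lt_le_trans (scalar_sphere_lower r_gt0 m_gt0 f1_gt0 f2_gt0 C_ge0 Ay (hC i)).
  have d_gt0 : 0 < f2 * r ^+ 2 by rewrite mulr_gt0.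
  have -> : m%:R ^+ 2 * (C / f1 + 3 / 4 * (m%:R * (2 * C * (1 + r ^+ 2) ^+ 2) ^+ 2)
        * f2 / f1 ^+ 2)
      = A1 / f1 + A2 * f2 / f1 ^+ 2 by rewrite /A1 /A2; ring.
  by rewrite subr_gt0 ltr_pdivlMr // (lt_le_trans small).
clearbody A1 A2; split=> [f2 f2_gt0|f1 f1_gt0].
  (* With f1 >= 1 the factor 1/f1^2 is at most 1/f1, so the left side of [key] is at most (c - 1)/f1
     < 2. *)
  pose c := 1 + (A1 + A2 * f2) * (f2 * r ^+ 2).
  have c1 : 1 <= c.
    by rewrite lerDl mulr_ge0 ?addr_ge0 // mulr_ge0 // ltW.
  exists c => [|f1 cf1]; first exact: lt_le_trans c1.
  have f1_ge1 : 1 <= f1 by exact: le_trans c1 cf1.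
  have f1_gt0 : 0 < f1 by exact: lt_le_trans f1_ge1.
  apply: key => //.
  have le1 : A1 / f1 + A2 * f2 / f1 ^+ 2 <= (A1 + A2 * f2) / f1.
    rewrite mulrDl lerD2l expr2 invfM mulrA ler_piMr //.
      by rewrite divr_ge0 ?mulr_ge0 // ltW.
    by rewrite invf_le1.
  have d_ge0 : 0 <= f2 * r ^+ 2 by rewrite mulr_ge0 // ltW.
  apply: le_lt_trans (ler_wpM2r d_ge0 le1) _.
  rewrite mulrAC ltr_pdivrMr //.
  by move: cf1 f1_ge1; rewrite /c; set t := (A1 + A2 * f2) * _; lra.
pose K := (A1 / f1 + A2 / f1 ^+ 2) * r ^+ 2.
have K_ge0 : 0 <= K.
  by rewrite mulr_ge0 ?addr_ge0 ?divr_ge0 ?sqr_ge0 // ltW.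
(* This gives f2 <= 1, so the left side of [key] is at most K f2 <= K/(1 + K) <= 1. *)
pose c := (1 + K)^-1.
have c_gt0 : 0 < c by rewrite invr_gt0 ltr_pwDl.
exists c => // f2 f2_gt0 f2c; apply: key => //.
have f2_le1 : f2 <= 1.
  by apply: le_trans f2c _; rewrite invf_le1 ?ltr_pwDl // lerDl.
have le1 : (A1 / f1 + A2 * f2 / f1 ^+ 2) * (f2 * r ^+ 2) <= K * f2.
  have -> : K * f2 = (A1 / f1 + A2 / f1 ^+ 2) * (f2 * r ^+ 2) by rewrite /K; ring.
  have d_ge0 : 0 <= f2 * r ^+ 2 by rewrite mulr_ge0 // ltW.
  rewrite (ler_wpM2r d_ge0) // lerD2l ler_wpM2r ?invr_ge0 ?sqr_ge0 //.
  by rewrite ler_piMr.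
apply: le_lt_trans le1 _; apply: (@le_lt_trans _ _ 1); last by rewrite ltr1n.
apply: le_trans (ler_wpM2l K_ge0 f2c) _.
by rewrite /c ler_pdivrMr ?ltr_pwDl // mul1r lerDr.
Qed.
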